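(* Let $p>1$ and $\alpha>-1$. Suppose $\varphi\in\mathcal{D}^p_\alpha$ satisfies $\varphi(\mathbb{D})\subset\mathbb{D}$. Fix $\beta\ge 0$ such that $\delta:=2+\beta-\frac{2+\alpha}{p}>0$. Then: (a) $C_\varphi$ is bounded on $\mathcal{D}^p_\alpha$ if and only if $\displaystyle \sup_{\lambda\in\mathbb{D}}(1-|\lambda|^2)^{\delta}\,\|F_{\lambda,\beta}\circ\varphi\|_{\mathcal{D}^p_\alpha}<\infty$; (b) $C_\varphi$ is compact on $\mathcal{D}^p_\alpha$ if and only if $\displaystyle \lim_{|\lambda|\to 1}(1-|\lambda|^2)^{\delta}\,\|F_{\lambda,\beta}\circ\varphi\|_{\mathcal{D}^p_\alpha}=0$.
   Context: $\mathbb{D}$ is the open unit disc in $\mathbb{C}$ and $dA(z)=dx\,dy/\pi$ is normalized area measure on $\mathbb{D}$. For $\alpha>-1$, $dA_\alpha(z)=(1+\alpha)(1-|z|^2)^\alpha\,dA(z)$. For a holomorphic function $g$ on $\mathbb{D}$, $\|g\|_{p,\alpha}=\left[\int_{\mathbb{D}}|g(z)|^p\,dA_\alpha(z)\right]^{1/p}$. The space $\mathcal{D}^p_\alpha$ consists of all holomorphic functions $f$ on $\mathbb{D}$ such that $\|f\|_{\mathcal{D}^p_\alpha}^p:=|f(0)|^p+\|f'\|_{p,\alpha}^p<\infty$. For a holomorphic map $\varphi:\mathbb{D}\to\mathbb{D}$, the composition operator is $C_\varphi(f)=f\circ\varphi$. For $\lambda\in\mathbb{D}$ and $\beta\ge 0$,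 $F_{\lambda,\beta}(z)=\dfrac{1}{(1-\overline{\lambda}z)^{1+\beta}}$ for $z\in\mathbb{D}$ (principal branch of the power). *)

(* Defs.v *)
From HB Require Import structures.
From mathcomp Require Import all_boot all_order all_algebra.
From mathcomp Require Import all_classical all_reals all_analysis.
From mathcomp Require Import complex.

Set Implicit Arguments.
Unset Strict Implicit.
Unset Printing Implicit Defensive.

Import Order.TTheory GRing.Theory Num.Theory numFieldNormedType.Exports.
Import ComplexField.Normc.

Local Open Scope classical_set_scope.
Local Open Scope ring_scope.
Local Open Scope complex_scope.

Definition disc (R : realType) : set R[i] := [set z | normc z < 1].
Arguments disc : clear implicits.

(* Functions on the disc are represented by total functions [R[i] -> R[i]]
   whose values outside [disc R] are irrelevant. [R[i]^o] is the type that
   carries the norm topology, so [derivable _ z 1] is complex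
   differentiability at [z] and [derive1 f] is the complex derivative. *)
Definition holomorphic (R : realType) (f : R[i] -> R[i]) : Prop :=
  forall z, disc R z -> derivable (f : R[i]^o -> R[i]^o) z 1.

Definition cderiv (R : realType) (f : R[i] -> R[i]) : R[i] -> R[i] :=
  derive1 (f : R[i]^o -> R[i]^o).

(* [disc_integral alpha h] is the integral of [h] against [dA_alpha]; the disc
   is read in the coordinates [w = (x, y)], with Lebesgue measure on [R * R]. *)
Definition disc_integral (R : realType) (alpha : R) (h : R[i] -> R) : \bar R :=
  (\int[(@lebesgue_measure R \x @lebesgue_measure R)%E]_(w in
      [set w : R * R | disc R (w.1 +i* w.2)])
    (h (w.1 +i* w.2) *
     ((1 + alpha) * (1 - normc (w.1 +i* w.2) ^+ 2) `^ alpha / pi))%:E)%E.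

Definition bergman_norm (R : realType) (p alpha : R) (g : R[i] -> R[i])
    : \bar R :=
  (disc_integral alpha (fun z => (normc (g z) `^ p)%R) `^ p^-1)%E.

Definition dirichlet_norm (R : realType) (p alpha : R) (f : R[i] -> R[i])
    : \bar R :=
  (((normc (f 0) `^ p)%:E + bergman_norm p alpha (cderiv f) `^ p) `^ p^-1)%E.

Definition dirichlet_space (R : realType) (p alpha : R)
    : set (R[i] -> R[i]) :=
  [set f | holomorphic f /\ (dirichlet_norm p alpha f < +oo)%E].

Record dirichlet (R : realType) (p alpha : R) := Dirichlet {
  dirichlet_fun :> R[i] -> R[i];
  dirichlet_funP : dirichlet_space p alpha dirichlet_fun }.

Section dirichlet_topology.
Context {R : realType} (p alpha : R).
Local Notation D := (dirichlet p alpha).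

HB.instance Definition _ := gen_eqMixin D.
HB.instance Definition _ := gen_choiceMixin D.

Definition dirichlet_ball (f : D) (e : R) : set D :=
  [set g : D | (dirichlet_norm p alpha (g \- f)%R < e%:E)%E].

Definition dirichlet_open (U : set D) : Prop :=
  forall f, U f -> exists2 e : R, 0 < e & dirichlet_ball f e `<=` U.

Let dirichlet_openT : dirichlet_open setT.
Proof. by move=> f _; exists 1. Qed.

Let dirichlet_openI (U V : set D) :
  dirichlet_open U -> dirichlet_open V -> dirichlet_open (U `&` V).
Proof.
move=> oU oV f [/oU [d d0 dU] /oV [e e0 eV]].
exists (Num.min d e); first by rewrite lt_min d0.
move=> g fg; split; [apply: dU|apply: eV]; apply: (lt_le_trans fg);
  by rewrite lee_fin ge_min lexx ?orbT.
Qed.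

Let dirichlet_open_bigU (I : Type) (U : I -> set D) :
  (forall i, dirichlet_open (U i)) -> dirichlet_open (\bigcup_i U i).
Proof.
move=> oU f [i _ /oU [e e0 eU]].
by exists e => // g /eU Ug; exists i.
Qed.

(* The norm topology. Elements of [D] that agree on the disc are at distance
   zero, so this topology is separated only up to values outside the disc. *)
HB.instance Definition _ := isOpenTopological.Build D
  dirichlet_openT dirichlet_openI dirichlet_open_bigU.

End dirichlet_topology.

Definition composition (R : realType) (phi f : R[i] -> R[i]) : R[i] -> R[i] :=
  f \o phi.

Definition maps_dirichlet (R : realType) (p alpha : R)
    (T : (R[i] -> R[i]) -> R[i] -> R[i]) : Prop :=
  forall f, dirichlet_space p alpha f -> dirichlet_space p alpha (T f).

Definition bounded_on_dirichlet (R : realType) (p alpha : R)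
    (T : (R[i] -> R[i]) -> R[i] -> R[i]) : Prop :=
  maps_dirichlet p alpha T /\
  exists M : R, forall f, dirichlet_space p alpha f ->
    (dirichlet_norm p alpha (T f) <= M%:E * dirichlet_norm p alpha f)%E.

Definition compact_on_dirichlet (R : realType) (p alpha : R)
    (T : (R[i] -> R[i]) -> R[i] -> R[i]) : Prop :=
  maps_dirichlet p alpha T /\
  precompact [set g : dirichlet p alpha |
    exists2 f : dirichlet p alpha,
      (dirichlet_norm p alpha f <= 1)%E & g = T f :> (R[i] -> R[i])].

(* Principal argument, in ]-pi, pi], for [w != 0]. *)
Definition carg (R : realType) (w : R[i]) : R :=
  let t := acos (complex.Re w / normc w) in if 0 <= complex.Im w then t else - t.

(* Principal branch of [w ^ s] for a real exponent [s] and [w != 0]. *)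
Definition cpow (R : realType) (w : R[i]) (s : R) : R[i] :=
  (normc w `^ s)%:C * (cos (s * carg w) +i* sin (s * carg w)).

Definition testF (R : realType) (lambda : R[i]) (beta : R) (z : R[i]) : R[i] :=
  (cpow (1 - conjc lambda * z) (1 + beta))^-1.

(* The filter on the disc expressing [`|lambda| -> 1]. *)
Definition to_circle (R : realType) : set_system R[i] :=
  filter_from [set r : R | r < 1] (fun r => [set l : R[i] | r < normc l < 1]).
Arguments to_circle : clear implicits.

#[export] Instance to_circle_filter (R : realType) : ProperFilter (to_circle R).
Proof.
apply: filter_from_proper; first apply: filter_from_filter.
- by exists 0; rewrite /= ltr01.
- move=> r s /= r1 s1; exists (Num.max r s); first by rewrite /= gt_max r1.
  by move=> l /= /andP[]; rewrite gt_max => /andP[-> ->] ->.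
- move=> r /= r1; have m1 : Num.max r 0 < 1 by rewrite gt_max r1 ltr01.
  exists ((Num.max r 0 + 1) / 2)%:C.
  have h := midf_lt m1.
  have m0 : 0 <= Num.max r 0 by rewrite le_max lexx orbT.
  have h0 : 0 <= (Num.max r 0 + 1) / 2 by rewrite divr_ge0 ?addr_ge0.
  rewrite /= expr0n addr0 sqrtr_sqr ger0_norm // h.2 andbT.
  by rewrite (le_lt_trans _ h.1) // le_max lexx.
Qed.

(* Main.v *)
Require Import Defs.
From HB Require Import structures.
From mathcomp Require Import all_boot all_order all_algebra.
From mathcomp Require Import all_classical all_reals all_analysis.
From mathcomp Require Import measurable_realfun complex ring lra.
Import Order.TTheory GRing.Theory Num.Theory numFieldNormedType.Exports.
Import ComplexField.Normc.
Set Implicit Arguments.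
Unset Strict Implicit.
Unset Printing Implicit Defensive.
Local Open Scope classical_set_scope.
Local Open Scope ring_scope.
Local Open Scope complex_scope.

(** Write [q = (2 + beta) p] and [c = delta p], so that [q = 2 + alpha + c]. The
    derivative of the test function [F_lambda] has modulus
    [(1 + beta) |lambda| |1 - conj lambda z|^(-2 - beta)]; hence, as long as
    [|lambda|] stays away from 0, the [p]-th power of the quantity in the theorem is
    comparable with
      [G(lambda) = (1 - |lambda|^2)^c int |phi'|^p |1 - conj lambda phi|^-q dA_alpha]
    up to the contribution of the value at 0, and [G] is bounded on smaller discs
    because [phi] has finite norm ([carleson_fun], [carleson_fun_test],
    [carleson_fun_bounded]).

    Sufficiency. Sub-mean values of [|g|^p] over squares of side comparable with
    [1 - |z|] give the reproducing estimate
      [|g z|^p <= C int (1 - |w|^2)^(q - 2) |1 - conj w z|^-q |g w|^p dw]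
    for holomorphic [g] ([reproducing_estimate]). Apply it to [g = f'] at [phi z],
    integrate against [|phi'|^p dA_alpha] and exchange the integrals: the energy of
    [f \o phi] is at most a constant times [int |f'|^p G dA_alpha] ([carleson],
    [denergy_comp]). If [G] is bounded, then so is [C_phi]. If [G] tends to 0 at
    the circle, then [C_phi] maps sequences, or ultrafilters, in the unit ball that
    converge locally uniformly to norm convergent ones ([composition_small]). By
    Montel's theorem every ultrafilter in the unit ball converges in this way to
    some element of the ball ([normal_limit], [normal_limit_unif],
    [normal_limit_dnorm]), so the image of the unit ball lies in a compact set
    ([image_ball_compact]); that set is closed because norm convergence implies
    pointwise convergence ([image_ball_closed]).

    Necessity. The integral of [(1 - |w|^2)^alpha |1 - conj lambda w|^-q] over the
    disc is at most a constant times [(1 - |lambda|)^-c] ([forelli_rudin]), so the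
    functions [(1 - |lambda|^2)^delta F_lambda] form a bounded family, which also
    tends to 0 at each point as [|lambda|] tends to 1. Boundedness of [C_phi] thus
    bounds the supremum, and compactness forces the norms of the images to tend to
    0 ([dnorm_testF_le], [compact_testF]).

    The function theory is developed from Goursat's theorem on rectangles: Cauchy's
    formula on squares yields the area sub-mean value property ([area_submean]) and
    a second order Taylor estimate that is uniform on bounded families
    ([taylor_quad]), which together carry all the complex analysis. *)

(** * Complex derivatives *)

Section ComplexNorm.
Context {R : realType}.
Implicit Types (x y : R) (z w : R[i]).

Lemma normc_ge0 z : 0 <= normc z.
Proof. by case: z => a b; apply: sqrtr_ge0. Qed.

Lemma normc_eq0 z : (normc z == 0) = (z == 0).
Proof. by apply/eqP/eqP => [/eq0_normc//|->]; rewrite normc0. Qed.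

Lemma normc_gt0 z : (0 < normc z) = (z != 0).
Proof. by rewrite lt0r normc_eq0 normc_ge0 andbT. Qed.

Lemma normcR x : normc x%:C = `|x|.
Proof. by rewrite /= expr0n addr0 sqrtr_sqr. Qed.

Lemma normc_distC z w : normc (z - w) = normc (w - z).
Proof. by rewrite -normcN opprB. Qed.

Lemma normc_Re z : `|complex.Re z| <= normc z.
Proof. by case: z => a b /=; rewrite -sqrtr_sqr ler_wsqrtr// lerDl sqr_ge0. Qed.

Lemma normc_Im z : `|complex.Im z| <= normc z.
Proof. by case: z => a b /=; rewrite -sqrtr_sqr ler_wsqrtr// lerDr sqr_ge0. Qed.

Lemma normc_le_ReIm z : normc z <= `|complex.Re z| + `|complex.Im z|.
Proof.
case: z => a b; rewrite [a +i* b](_ : _ = a%:C + 'i * b%:C); last first.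
  by apply/eqP; rewrite eq_complex /= !(mul0r, mul1r, subr0, addr0, add0r) !eqxx.
rewrite (le_trans (le_normcD _ _))// normcM !normcR.
rewrite (_ : normc 'i = 1) ?mul1r /= ?expr0n ?expr1n ?add0r ?sqrtr1//.
by rewrite !(mul0r, mul1r, subr0, addr0, add0r).
Qed.

Lemma normc_sqr z : normc z ^+ 2 = complex.Re z ^+ 2 + complex.Im z ^+ 2.
Proof. by case: z => a b; rewrite /= sqr_sqrtr// addr_ge0 ?sqr_ge0. Qed.

Lemma ler_normcB z w : normc z - normc w <= normc (z - w).
Proof. by rewrite lerBlDr -{1}(subrK w z) le_normcD. Qed.

Lemma normc_conj z : normc z^* = normc z.
Proof. by case: z => a b /=; rewrite sqrrN. Qed.

Lemma normr_normc z : `|z| = (normc z)%:C.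
Proof. by case: z. Qed.

Lemma nbhs_normcP (z : R[i]^o) (A : set R[i]^o) :
  nbhs z A <-> exists2 e : R, 0 < e & forall w, normc (w - z) < e -> A w.
Proof.
split.
- move=> /nbhs_ballP[[e e'] /=]; rewrite ltcE /= => /andP[/eqP -> e0] H.
  exists e => // w wz; apply: H; rewrite /ball /= distrC normr_normc.
  by rewrite ltcE /= eqxx.
- move=> [e e0 H]; apply/nbhs_ballP; exists e%:C; first by rewrite /= ltcR.
  by move=> w; rewrite /ball /= distrC normr_normc ltcR => ?; apply: H.
Qed.

End ComplexNorm.

Section ComplexDerivative.
Context {R : realType}.
Implicit Types (f g : R[i] -> R[i]) (z w d : R[i]).

(** Differentiability as a bound on the remainder, in the real-valued norm
    [normc]: remainders are estimated explicitly throughout. *)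
Definition has_cderiv f z d := forall e : R, 0 < e -> exists2 r : R, 0 < r &
  forall h, normc h < r -> normc (f (z + h) - f z - d * h) <= e * normc h.

Lemma has_cderiv_derive f z d :
  has_cderiv f z d <-> is_derive (z : R[i]^o) 1 (f : R[i]^o -> R[i]^o) d.
Proof.
have E h : h != 0 -> normc (h^-1 * (f (z + h) - f z) - d) =
     normc (f (z + h) - f z - d * h) / normc h.
  move=> h0; rewrite -normcV -normcM; congr normc; field; exact: h0.
split=> [H|[df]].
- have cv : h^-1 *: ((f : R[i]^o -> R[i]^o) (h *: (1 : R[i]^o) + z) - f z)
      @[h --> (0 : R[i]^o)^'] --> (d : R[i]^o).
    move=> A /nbhs_normcP[e e0 HA].
    have e20 : 0 < e / 2 by lra.
    have [r r0 Hr] := H _ e20.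
    apply/nbhs_normcP; exists r => // h; rewrite subr0 => hr h0.
    apply: HA; rewrite [_ *: 1](mulr1 h) (addrC h) E//.
    rewrite ltr_pdivrMr ?normc_gt0// (le_lt_trans (Hr _ hr))//.
    by rewrite ltr_pM2r ?normc_gt0//; lra.
  by apply: DeriveDef; [apply/cvg_ex; exists d | apply: cvg_lim].
- rewrite /derive => dd e e0.
  have : nbhs (0 : R[i]^o) [set h | h != 0 ->
      normc (h^-1 * (f (z + h) - f z) - d) < e].
    have := df; rewrite /derivable dd => cv.
    have N : nbhs (d : R[i]^o) [set w | normc (w - d) < e].
      by apply/nbhs_normcP; exists e.
    have X : nbhs (0 : R[i]^o) (fun h => h != 0 ->
        normc (h^-1 * (f (h *: (1 : R[i]^o) + z) - f z) - d) < e) := cv _ N.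
    apply: filterS X => h H h0; have := H h0.
    by rewrite /= [_ *: 1](mulr1 h) (addrC h).
  move=> /nbhs_normcP[r r0 Hr].
  exists r => // h hr; have [->|h0] := eqVneq h 0.
    by rewrite !addr0 mulr0 subr0 subrr normc0 mulr0.
  have := Hr h; rewrite subr0 => /(_ hr h0).
  by rewrite E// ltr_pdivrMr ?normc_gt0// => /ltW.
Qed.

Lemma cderivE f z d : has_cderiv f z d -> cderiv f z = d.
Proof. by move=> /has_cderiv_derive[_ <-]; rewrite /cderiv derive1E. Qed.

Lemma holomorphicP f : holomorphic f <->
  forall z, disc R z -> has_cderiv f z (cderiv f z).
Proof.
split=> H z /H.
- by move=> /derivableP/has_cderiv_derive /[dup] /cderivE <-.
- by move=> /has_cderiv_derive[].
Qed.

Lemma has_cderiv_near f g z d r : 0 < r ->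
  (forall w, normc (w - z) < r -> f w = g w) ->
  has_cderiv f z d -> has_cderiv g z d.
Proof.
move=> r0 fg H e /H[s s0 Hs]; exists (Num.min r s); first by rewrite lt_min r0.
move=> h; rewrite lt_min => /andP[hr hs].
by rewrite -!fg ?Hs// ?subrr ?normc0// addrC addKr.
Qed.

Lemma has_cderiv_continuous f z d : has_cderiv f z d ->
  forall e : R, 0 < e -> exists2 r : R, 0 < r &
    forall w, normc (w - z) < r -> normc (f w - f z) <= e.
Proof.
move=> H e e0; have [r r0 Hr] := H 1 ltr01.
have d0 : 0 < normc d + 1 by rewrite ltr_pwDr ?ltr01 ?normc_ge0.
exists (Num.min r (e / (normc d + 1))); first by rewrite lt_min r0 divr_gt0.
move=> w; rewrite lt_min => /andP[/Hr]; rewrite (addrC z) subrK mul1r => A B.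
rewrite -(subrK (d * (w - z)) (f w - f z)) (le_trans (le_normcD _ _))//.
rewrite normcM; move: B; rewrite ltr_pdivlMr// => B.
by lra.
Qed.

Lemma has_cderivZ f z d a : has_cderiv f z d ->
  has_cderiv (fun w => a * f w) z (a * d).
Proof.
move=> H e e0; have a0 : 0 < normc a + 1 by rewrite ltr_pwDr ?ltr01 ?normc_ge0.
have [|r r0 Hr] := H (e / (normc a + 1)); first by rewrite divr_gt0.
exists r => // h /Hr A; rewrite -mulrA -!mulrBr normcM.
apply: (le_trans (ler_wpM2l (normc_ge0 _) A)).
rewrite mulrA ler_wpM2r ?normc_ge0// mulrCA ler_piMr ?ltW//.
by rewrite ltr_pdivrMr// mul1r; lra.
Qed.

Lemma has_cderivD f g z d d' : has_cderiv f z d -> has_cderiv g z d' ->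
  has_cderiv (fun w => f w + g w) z (d + d').
Proof.
move=> Hf Hg e e0; have e20 : 0 < e / 2 by lra.
have [r r0 Hr] := Hf _ e20; have [s s0 Hs] := Hg _ e20.
exists (Num.min r s); first by rewrite lt_min r0.
move=> h; rewrite lt_min => /andP[/Hr A /Hs B].
rewrite (_ : _ - _ = (f (z + h) - f z - d * h) + (g (z + h) - g z - d' * h)).
  by rewrite (le_trans (le_normcD _ _))//; lra.
by ring.
Qed.

Lemma has_cderiv_affine z a b : has_cderiv (fun w => a * w + b) z a.
Proof.
move=> e e0; exists 1 => // h _; rewrite (_ : _ - _ = 0) ?normc0; last by ring.
by rewrite mulr_ge0 ?normc_ge0 ?ltW.
Qed.

Lemma has_cderiv_id z : has_cderiv id z 1.
Proof.
have := @has_cderiv_affine z 1 0; apply: (@has_cderiv_near _ _ _ _ 1) => // w _.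
by rewrite mul1r addr0.
Qed.

Lemma has_cderiv_cst z a : has_cderiv (fun=> a) z 0.
Proof.
have := @has_cderiv_affine z 0 a; apply: (@has_cderiv_near _ _ _ _ 1) => // w _.
by rewrite mul0r add0r.
Qed.

Lemma has_cderivB f g z d d' : has_cderiv f z d -> has_cderiv g z d' ->
  has_cderiv (fun w => f w - g w) z (d - d').
Proof.
move=> Hf Hg; have := has_cderivD Hf (has_cderivZ (-1) Hg).
rewrite mulN1r; apply: (@has_cderiv_near _ _ _ _ 1) => // w _; by rewrite mulN1r.
Qed.

Lemma has_cderiv_comp f g z d d' : has_cderiv g z d' -> has_cderiv f (g z) d ->
  has_cderiv (f \o g) z (d * d').
Proof.
move=> Hg Hf e e0.
pose L := normc d' + 1; have L0 : 0 < L by rewrite ltr_pwDr ?normc_ge0.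
pose M := normc d + 1; have M0 : 0 < M by rewrite ltr_pwDr ?normc_ge0.
have e1 : 0 < e / 2 / M by rewrite !divr_gt0.
have e2 : 0 < e / 2 / L by rewrite !divr_gt0.
have [r r0 Hr] := Hg _ e1; have [s s0 Hs] := Hf _ e2.
have [t t0 Ht] := Hg 1 ltr01.
exists (Num.min r (Num.min t (s / L))); first by rewrite !lt_min r0 t0 divr_gt0.
move=> h; rewrite !lt_min ltr_pdivlMr// => /and3P[/Hr A /Ht B C].
have D : normc (g (z + h) - g z) <= L * normc h.
  rewrite -(subrK (d' * h) (_ - _)) (le_trans (le_normcD _ _))// normcM.
  by rewrite /L mulrDl mul1r addrC lerD2l; move: B; rewrite mul1r.
have := Hs (g (z + h) - g z); rewrite (addrC (g z)) subrK => E.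
have {}E : normc (f (g (z + h)) - f (g z) - d * (g (z + h) - g z)) <= e / 2 * normc h.
  apply: (le_trans (E _)); first by rewrite (le_lt_trans D)// mulrC.
  apply: (le_trans (ler_wpM2l (ltW e2) D)).
  by rewrite mulrA divfK ?gt_eqF.
rewrite /= (_ : _ - _ = (f (g (z + h)) - f (g z) - d * (g (z + h) - g z)) +
  d * (g (z + h) - g z - d' * h)); last by ring.
rewrite (le_trans (le_normcD _ _))//.
suff : normc (d * (g (z + h) - g z - d' * h)) <= e / 2 * normc h by lra.
rewrite normcM (le_trans (ler_wpM2l (normc_ge0 _) A))// mulrA ler_wpM2r ?normc_ge0//.
rewrite mulrCA ler_piMr ?ltW//; first lra.
by rewrite ltr_pdivrMr// mul1r /M; lra.
Qed.

Lemma has_cderivM f g z d d' : has_cderiv f z d -> has_cderiv g z d' ->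
  has_cderiv (fun w => f w * g w) z (d * g z + f z * d').
Proof.
(* polarization : 4fg = (f+g)^2 - (f-g)^2 reduces to the derivative of a square *)
have sq (w : R[i]) : has_cderiv (fun u => u * u) w (2 * w).
  move=> e e0; exists e => // h he.
  rewrite (_ : _ - _ = h * h); last by ring.
  by rewrite normcM ler_wpM2r ?normc_ge0 ?ltW.
move=> Hf Hg.
have := has_cderivZ 4^-1 (has_cderivB
  (has_cderiv_comp (has_cderivD Hf Hg) (sq _))
  (has_cderiv_comp (has_cderivB Hf Hg) (sq _))).
rewrite (_ : 4^-1 * _ = d * g z + f z * d'); last by field.
by apply: (@has_cderiv_near _ _ _ _ 1) => // w _ /=; field.
Qed.

Lemma has_cderivV z : z != 0 -> has_cderiv GRing.inv z (- z^-2).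
Proof.
move=> z0 e e0; have nz0 : 0 < normc z by rewrite normc_gt0.
exists (Num.min (normc z / 2) (e * normc z ^+ 3 / 2)).
  by rewrite lt_min !divr_gt0 ?mulr_gt0 ?exprn_gt0.
move=> h; rewrite lt_min => /andP[h1 h2].
have zh : normc z / 2 <= normc (z + h).
  by have := ler_normcB z (- h); rewrite normcN opprK; lra.
have zh0 : 0 < normc (z + h) by apply: lt_le_trans zh; lra.
have zh00 : z + h != 0 by rewrite -normc_gt0.
rewrite (_ : _ - _ = h * h * (z ^- 2 * (z + h)^-1)); last first.
  by field; rewrite z0 zh00.
rewrite 2!normcM mulrAC ler_wpM2r ?normc_ge0// normcM !normcV.
have -> : normc (z ^+ 2) = normc z ^+ 2 by rewrite expr2 normcM expr2.
rewrite -invfM ler_pdivrMr ?mulr_gt0 ?exprn_gt0//.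
have : 0 <= e * normc z ^+ 2 * (normc (z + h) - normc z / 2).
  by rewrite mulr_ge0 ?subr_ge0// mulr_ge0 ?exprn_ge0 ?normc_ge0 ?ltW.
by move: h2; rewrite !exprS expr0 mulr1; lra.
Qed.

Lemma has_cderiv_inv f z d : has_cderiv f z d -> f z != 0 ->
  has_cderiv (fun w => (f w)^-1) z (- d / f z ^+ 2).
Proof.
move=> Hf f0; have := has_cderiv_comp Hf (has_cderivV f0).
by rewrite (_ : - d / _ = - (f z) ^- 2 * d) // mulrC mulrN mulNr.
Qed.

(** Reduces derivatives along a segment to real derivatives of two components. *)
Lemma has_cderiv_line f z v d (t : R) : has_cderiv f (z + t%:C * v) d ->
  is_derive t 1 (fun s : R => complex.Re (f (z + s%:C * v))) (complex.Re (d * v)) /\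
  is_derive t 1 (fun s : R => complex.Im (f (z + s%:C * v))) (complex.Im (d * v)).
Proof.
move=> H.
have key (p : R[i] -> R) : (forall a b, p (a - b) = p a - p b) ->
    (forall (x : R) a, p (x%:C * a) = x * p a) ->
    (forall a, `|p a| <= normc a) ->
    is_derive t 1 (fun s : R => p (f (z + s%:C * v))) (p (d * v)).
  move=> pB pZ pn.
  have cv : h^-1 *: (p (f (z + (h *: 1 + t)%:C * v)) - p (f (z + t%:C * v)))
      @[h --> (0 : R)^'] --> p (d * v).
    apply/cvgrPdist_le => e e0.
    have v0 : 0 < normc v + 1 by rewrite ltr_pwDr ?normc_ge0.
    have [r r0 Hr] := H _ (divr_gt0 e0 v0).
    have [s s0 Hs] : exists2 s : R, 0 < s & forall h : R, `|h| < s -> normc (h%:C * v) < r.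
      exists (r / (normc v + 1)); first by rewrite divr_gt0.
      move=> h; rewrite ltr_pdivlMr// => hh; rewrite normcM normcR.
      by apply: le_lt_trans hh; rewrite ler_wpM2l//; lra.
    exists s => // h /=; rewrite sub0r normrN => hs h0.
    have := Hr _ (Hs _ hs).
    rewrite [h *: 1]mulr1 (addrC h) rmorphD /= mulrDl addrA.
    rewrite -(ler_pM2l (_ : 0 < `|h^-1|)) ?normr_gt0 ?invr_neq0//.
    move=> A; rewrite -pB -[h^-1 *: _]pZ distrC -pB.
    apply: (le_trans (pn _)); rewrite -normcR -normcM in A.
    have -> : (h^-1)%:C * (f (z + t%:C * v + h%:C * v) - f (z + t%:C * v)) - d * v =
        (h^-1)%:C * (f (z + t%:C * v + h%:C * v) - f (z + t%:C * v) - d * (h%:C * v)).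
      rewrite [RHS]mulrBr; congr (_ - _).
      rewrite [_ * (d * _)]mulrCA; congr (_ * _).
      by rewrite mulrA -rmorphM /= mulVf// mul1r.
    apply: (le_trans A).
    rewrite !normcM !normcR mulrCA [X in _ * X <= _]mulrA -normrM mulVf//.
    rewrite normr1 mul1r mulrAC ler_pdivrMr// ler_wpM2l ?ltW//; lra.
  by apply: DeriveDef; [apply/cvg_ex; exists (p (d * v)) | apply: cvg_lim].
split; apply: key.
- by move=> [a b] [a' b'].
- by move=> x [a b] /=; rewrite mul0r subr0.
- exact: normc_Re.
- by move=> [a b] [a' b'].
- by move=> x [a b] /=; rewrite mul0r addr0.
- exact: normc_Im.
Qed.

(** The real mean value theorem is applied to the real and to the imaginary part
    of [f] along the segment, whence the factor 2. *)
Lemma cmean_value f (f' : R[i] -> R[i]) z w M :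
  (forall t : R, 0 <= t <= 1 -> has_cderiv f (z + t%:C * (w - z)) (f' (z + t%:C * (w - z)))) ->
  (forall t : R, 0 <= t <= 1 -> normc (f' (z + t%:C * (w - z))) <= M) ->
  normc (f w - f z) <= 2 * M * normc (w - z).
Proof.
move=> H HM.
have key (p : R[i] -> R) : (forall a b, p (a - b) = p a - p b) ->
    (forall a, `|p a| <= normc a) ->
    (forall t : R, 0 <= t <= 1 -> is_derive t 1 (fun s : R => p (f (z + s%:C * (w - z)))) 
      (p (f' (z + t%:C * (w - z)) * (w - z)))) ->
    `|p (f w - f z)| <= M * normc (w - z).
  move=> pB pn D.
  have [||c c01] := @MVT R (fun s : R => p (f (z + s%:C * (w - z)))) 
    (fun t => p (f' (z + t%:C * (w - z)) * (w - z))) 0 1 ltr01.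
  - by move=> x; rewrite in_itv /= => /andP[/ltW a /ltW b]; apply: D; rewrite a.
  - apply: derivable_within_continuous => x; rewrite in_itv /= => ab.
    by have [] := D _ ab.
  rewrite mul1r mul0r addr0 [z + _]addrC subrK subr0 mulr1 -pB => ->.
  move: c01; rewrite in_itv /= => /andP[/ltW a /ltW b].
  apply: (le_trans (pn _)); rewrite normcM ler_wpM2r ?normc_ge0//.
  by apply: HM; rewrite a.
apply: (le_trans (normc_le_ReIm _)); rewrite -mulrA mulrDl !mul1r.
apply: lerD; apply: key.
- by move=> [a b] [a' b'].
- exact: normc_Re.
- by move=> t /H/has_cderiv_line[].
- by move=> [a b] [a' b'].
- exact: normc_Im.
- by move=> t /H/has_cderiv_line[].
Qed.

End ComplexDerivative.

(** * Integrals over rectangles and Goursat's theorem *)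

Section ComplexIntegral.
Context {R : realType}.
Notation mu := (@lebesgue_measure R).
Implicit Types (h g : R -> R[i]) (a b t : R).

Definition ccont h t := forall e : R, 0 < e -> exists2 r : R, 0 < r &
  forall s, `|s - t| < r -> normc (h s - h t) <= e.

Definition ccont_on a b h := forall t, a <= t <= b -> ccont h t.

Definition cint a b h : R[i] :=
  (\int[mu]_(t in `[a, b]) complex.Re (h t)) +i*
  (\int[mu]_(t in `[a, b]) complex.Im (h t)).

Lemma ccont_continuous h t (q : R[i] -> R) :
  (forall z w, `|q z - q w| <= normc (z - w)) -> ccont h t ->
  {for t, continuous (q \o h : R -> R)}.
Proof.
move=> qB H; apply/cvgrPdist_le => e e0; have [r r0 Hr] := H e e0.
exists r => // s /=; rewrite distrC => /Hr A.
by rewrite distrC (le_trans (qB _ _)).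
Qed.

Lemma Re_dist (z w : R[i]) : `|complex.Re z - complex.Re w| <= normc (z - w).
Proof.
by rewrite (_ : _ - _ = complex.Re (z - w)) ?normc_Re//; case: z w => [? ?] [].
Qed.

Lemma Im_dist (z w : R[i]) : `|complex.Im z - complex.Im w| <= normc (z - w).
Proof.
by rewrite (_ : _ - _ = complex.Im (z - w)) ?normc_Im//; case: z w => [? ?] [].
Qed.

Lemma normc_dist (z w : R[i]) : `|normc z - normc w| <= normc (z - w).
Proof.
by rewrite ler_norml lerNl opprB {1}normc_distC !ler_normcB.
Qed.

Lemma ccont_on_integrable a b h (q : R[i] -> R) :
  (forall z w, `|q z - q w| <= normc (z - w)) -> ccont_on a b h ->
  mu.-integrable `[a, b] (EFin \o (fun t => q (h t))).
Proof.
move=> qB H; apply: continuous_compact_integrable; first exact: segment_compact.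
apply: continuous_in_subspaceT => t; rewrite inE /= in_itv /= => tab.
exact: (ccont_continuous qB (H _ tab)).
Qed.

Definition integrable_Re a b h H := @ccont_on_integrable a b h _ Re_dist H.
Definition integrable_Im a b h H := @ccont_on_integrable a b h _ Im_dist H.
Definition integrable_normc a b h H := @ccont_on_integrable a b h _ normc_dist H.

Lemma ccont_onW a b a' b' h : a <= a' -> b' <= b ->
  ccont_on a b h -> ccont_on a' b' h.
Proof.
move=> aa bb H t /andP[ta tb]; apply: H.
by rewrite (le_trans aa)// (le_trans tb).
Qed.

Lemma ccontD h g t : ccont h t -> ccont g t -> ccont (fun s => h s + g s) t.
Proof.
move=> Hh Hg e e0; have e2 : 0 < e / 2 by lra.
have [r r0 Hr] := Hh _ e2; have [s s0 Hs] := Hg _ e2.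
exists (Num.min r s); first by rewrite lt_min r0.
move=> u; rewrite lt_min => /andP[/Hr A /Hs B].
rewrite (_ : _ - _ = (h u - h t) + (g u - g t)); last by ring.
by rewrite (le_trans (le_normcD _ _))//; lra.
Qed.

Lemma ccontZ (c : R[i]) h t : ccont h t -> ccont (fun s => c * h s) t.
Proof.
move=> Hh e e0; have c0 : 0 < normc c + 1 by rewrite ltr_pwDr ?normc_ge0.
have [r r0 Hr] := Hh _ (divr_gt0 e0 c0).
exists r => // u /Hr; rewrite ler_pdivlMr// => A.
rewrite -mulrBr normcM (le_trans _ A)// mulrC ler_wpM2l ?normc_ge0//; lra.
Qed.

Lemma ccontB h g t : ccont h t -> ccont g t -> ccont (fun s => h s - g s) t.
Proof.
move=> Hh Hg; have := ccontD Hh (ccontZ (-1) Hg).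
by congr (ccont _ t); apply/funext => s; rewrite mulN1r.
Qed.

Lemma ReDc (z w : R[i]) : complex.Re (z + w) = complex.Re z + complex.Re w.
Proof. by case: z w => ? ? []. Qed.
Lemma ImDc (z w : R[i]) : complex.Im (z + w) = complex.Im z + complex.Im w.
Proof. by case: z w => ? ? []. Qed.
Lemma ReNc (z : R[i]) : complex.Re (- z) = - complex.Re z.
Proof. by case: z. Qed.
Lemma ImNc (z : R[i]) : complex.Im (- z) = - complex.Im z.
Proof. by case: z. Qed.
Lemma ReMc (z w : R[i]) : complex.Re (z * w) =
  complex.Re z * complex.Re w - complex.Im z * complex.Im w.
Proof. by case: z w => ? ? []. Qed.
Lemma ImMc (z w : R[i]) : complex.Im (z * w) =
  complex.Re z * complex.Im w + complex.Im z * complex.Re w.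
Proof. by case: z w => ? ? []. Qed.

Lemma complexP (z w : R[i]) : complex.Re z = complex.Re w ->
  complex.Im z = complex.Im w -> z = w.
Proof. by case: z w => ? ? [? ?] /= -> ->. Qed.

Lemma cintD a b h g : ccont_on a b h -> ccont_on a b g ->
  cint a b (fun t => h t + g t) = cint a b h + cint a b g.
Proof.
move=> Hh Hg; apply: complexP; rewrite ?ReDc ?ImDc /=.
- rewrite -RintegralD//; [|exact: integrable_Re|exact: integrable_Re].
  by apply: eq_Rintegral => t _; rewrite ReDc.
- rewrite -RintegralD//; [|exact: integrable_Im|exact: integrable_Im].
  by apply: eq_Rintegral => t _; rewrite ImDc.
Qed.

Lemma integrableZlR a b (c : R) (f : R -> R) : mu.-integrable `[a, b] (EFin \o f) ->
  mu.-integrable `[a, b] (EFin \o (fun t => c * f t)).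
Proof.
move=> H; have := @integrableZl _ _ R mu _ (measurable_itv _) c _ H.
by congr (mu.-integrable _ _); apply/funext => t /=; rewrite EFinM.
Qed.

Lemma cintZ a b (c : R[i]) h : ccont_on a b h ->
  cint a b (fun t => c * h t) = c * cint a b h.
Proof.
move=> Hh; have iR := integrable_Re Hh; have iI := integrable_Im Hh.
apply: complexP; rewrite ?ReMc ?ImMc /= -!RintegralZl//.
- rewrite -RintegralB//; [|exact: integrableZlR|exact: integrableZlR].
  by apply: eq_Rintegral => t _; rewrite ReMc.
- rewrite -RintegralD//; [|exact: integrableZlR|exact: integrableZlR].
  by apply: eq_Rintegral => t _; rewrite ImMc.
Qed.

Lemma cintB a b h g : ccont_on a b h -> ccont_on a b g ->
  cint a b (fun t => h t - g t) = cint a b h - cint a b g.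
Proof.
move=> Hh Hg; rewrite -mulN1r -cintZ// -cintD//.
  by congr cint; apply/funext => t; rewrite mulN1r.
by move=> t tab; exact/ccontZ/Hg.
Qed.

Lemma cint_split a b c h : a <= c -> c <= b -> ccont_on a b h ->
  cint a b h = cint a c h + cint c b h.
Proof.
move=> ac cb H.
have key (f : R -> R) : mu.-integrable `[a, b] (EFin \o f) ->
    \int[mu]_(t in `[a, b]) f t = \int[mu]_(t in `[a, c]) f t + \int[mu]_(t in `[c, b]) f t.
  move=> If; apply/eqP; rewrite addrC -subr_eq Rintegral_itvB ?bnd_simp//.
  rewrite Rintegral_itv_obnd_cbnd//; apply: integrableS If => //.
  by apply: subset_itvr; rewrite bnd_simp.
by apply: complexP; rewrite ?ReDc ?ImDc /= -key//; [exact: integrable_Re|exact: integrable_Im].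
Qed.

(** The factor 2 comes from treating real and imaginary parts separately. *)
Lemma normc_cint_le a b h : ccont_on a b h ->
  normc (cint a b h) <= 2 * \int[mu]_(t in `[a, b]) normc (h t).
Proof.
move=> H; apply: (le_trans (normc_le_ReIm _)); rewrite mulrDl mul1r /=.
have key (q : R[i] -> R) : (forall z w, `|q z - q w| <= normc (z - w)) ->
    (forall z, `|q z| <= normc z) ->
    `|\int[mu]_(t in `[a, b]) q (h t)| <= \int[mu]_(t in `[a, b]) normc (h t).
  move=> qB qn; have I := ccont_on_integrable qB H.
  rewrite (le_trans (le_normr_Rintegral _ I))//.
  apply: le_Rintegral => //; [|exact: integrable_normc].
  by have := integrable_abse I; congr (mu.-integrable _ _).
by apply: lerD; apply: key; [exact: Re_dist|exact: normc_Re|exact: Im_dist|exact: normc_Im].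
Qed.

Lemma lebesgue_segment a b : a <= b -> mu `[a, b] = (b - a)%:E.
Proof.
move=> ab; have := lebesgue_measure_itv `[a, b]; rewrite /= lte_fin => ->.
by case: ltgtP ab => [//|//|->]; rewrite subrr.
Qed.

Lemma normc_cint_sup a b h (M : R) : a <= b -> ccont_on a b h ->
  (forall t, a <= t <= b -> normc (h t) <= M) ->
  normc (cint a b h) <= 2 * M * (b - a).
Proof.
move=> ab H HM; rewrite (le_trans (normc_cint_le H))// -mulrA ler_wpM2l//.
have -> : M * (b - a) = \int[mu]_(t in `[a, b]) (cst M t).
  rewrite Rintegral_cst//; congr (M * _).
  by rewrite -[LHS]/(fine (b - a)%:E) -(lebesgue_segment ab).
apply: le_Rintegral => //; first exact: integrable_normc.
  by apply: continuous_compact_integrable; [exact: segment_compact|exact: cst_continuous].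
Qed.

Lemma cint_FTC a b (H : R -> R[i]) h : a <= b -> ccont_on a b h ->
  (forall t, a <= t <= b -> is_derive t 1 (fun s => complex.Re (H s)) (complex.Re (h t)) /\
     is_derive t 1 (fun s => complex.Im (H s)) (complex.Im (h t))) ->
  cint a b h = H b - H a.
Proof.
move=> ab Ch D.
have key (q : R[i] -> R) : (forall z w, `|q z - q w| <= normc (z - w)) ->
    (forall t, a <= t <= b -> is_derive t 1 (fun s => q (H s)) (q (h t))) ->
    \int[mu]_(t in `[a, b]) q (h t) = q (H b) - q (H a).
  move=> qB qD; have [<-|nab] := eqVneq a b.
    by rewrite subrr set_itv1 Rintegral_set1.
  have {}ab : a < b by rewrite lt_neqAle nab.
  have cH t : a <= t <= b -> {for t, continuous (fun s => q (H s))}.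
    by move=> /qD[+ _]; move=> /derivable1_diffP/differentiable_continuous.
  rewrite /Rintegral (@continuous_FTC2 _ _ (fun s => q (H s)) _ _ ab)//.
  - apply: continuous_in_subspaceT => t; rewrite inE /= in_itv /= => /Ch.
    exact: ccont_continuous.
  - split.
    + by move=> x; rewrite in_itv /= => /andP[/ltW ? /ltW ?]; have [] := qD x; first lra.
    + by apply: cvg_at_right_filter; apply: cH; rewrite lexx ltW.
    + by apply: cvg_at_left_filter; apply: cH; rewrite lexx ltW.
  - move=> x; rewrite in_itv /= => /andP[/ltW ? /ltW ?]; rewrite derive1E.
    by have [] := qD x; first lra.
apply: complexP; rewrite ?ReDc ?ImDc ?ReNc ?ImNc /=.
- by apply: key => [|t /D[]//]; exact: Re_dist.
- by apply: key => [|t /D[]//]; exact: Im_dist.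
Qed.

End ComplexIntegral.

Section Goursat.
Context {R : realType}.
Implicit Types (F G : R[i] -> R[i]) (a b c d : R) (z w u : R[i]).

Definition cbox a b c d : set R[i] :=
  [set z | a <= complex.Re z <= b /\ c <= complex.Im z <= d].

(** Pointwise, so that it makes sense on closed boxes and on their boundaries. *)
Definition cdiff_on (A : set R[i]) F := forall z, A z -> exists d0 : R[i], has_cderiv F z d0.

(** The boundary integral of [F z dz], counterclockwise: [dz] is [dx] on the
    horizontal sides and ['i dy] on the vertical ones. *)
Definition rect F a b c d : R[i] :=
  (cint a b (fun x => F (x +i* c)) - cint a b (fun x => F (x +i* d))) +
  'i * (cint c d (fun y => F (b +i* y)) - cint c d (fun y => F (a +i* y))).

Lemma lineH (x y : R) : x +i* y = 0 +i* y + x%:C * 1.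
Proof. by rewrite mulr1; apply: complexP; rewrite ?ReDc ?ImDc /= ?add0r ?addr0. Qed.

Lemma lineV (x y : R) : x +i* y = x +i* 0 + y%:C * 'i.
Proof. by apply: complexP; rewrite ?ReDc ?ImDc ?ReMc ?ImMc /=; ring. Qed.

Lemma cdiff_ccontH F (x y : R) (d0 : R[i]) : has_cderiv F (x +i* y) d0 -> ccont (fun x => F (x +i* y)) x.
Proof.
move=> H e e0; have [r r0 Hr] := has_cderiv_continuous H e0.
exists r => // s sx; apply: Hr.
by rewrite (_ : _ - _ = (s - x)%:C) ?normcR//; apply: complexP; rewrite /= ?subrr.
Qed.

Lemma normc_i : normc ('i : R[i]) = 1.
Proof. by rewrite /= expr0n expr1n add0r sqrtr1. Qed.

Lemma cdiff_ccontV F (x y : R) (d0 : R[i]) : has_cderiv F (x +i* y) d0 -> ccont (fun y => F (x +i* y)) y.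
Proof.
move=> H e e0; have [r r0 Hr] := has_cderiv_continuous H e0.
exists r => // s sx; apply: Hr.
rewrite (_ : _ - _ = (s - y)%:C * 'i) ?normcM ?normcR ?normc_i ?mulr1//.
by apply: complexP; rewrite ?ReMc ?ImMc /=; ring.
Qed.

Lemma cdiff_on_ccontH A F a b y : (forall x, a <= x <= b -> A (x +i* y)) ->
  cdiff_on A F -> ccont_on a b (fun x => F (x +i* y)).
Proof. by move=> sub H x /sub/H[d0]; exact: cdiff_ccontH. Qed.

Lemma cdiff_on_ccontV A F c d x : (forall y, c <= y <= d -> A (x +i* y)) ->
  cdiff_on A F -> ccont_on c d (fun y => F (x +i* y)).
Proof. by move=> sub H y /sub/H[d0]; exact: cdiff_ccontV. Qed.

Lemma cdiff_onW (A B : set R[i]) F : A `<=` B -> cdiff_on B F -> cdiff_on A F.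
Proof. by move=> AB H z /AB/H. Qed.

Definition cbdry a b c d : set R[i] := [set z | cbox a b c d z /\
  [\/ complex.Re z = a, complex.Re z = b, complex.Im z = c | complex.Im z = d]].

Lemma cbdry_sub a b c d : cbdry a b c d `<=` cbox a b c d.
Proof. by move=> z []. Qed.

Lemma bdryV F a b c d : a <= b -> cdiff_on (cbdry a b c d) F ->
  ccont_on c d (fun y => F (a +i* y)) /\ ccont_on c d (fun y => F (b +i* y)).
Proof.
move=> ab H; split; apply: cdiff_on_ccontV H => y yd.
- by split; [split; rewrite //= lexx|apply: Or41].
- by split; [split; rewrite //= lexx andbT|apply: Or42].
Qed.

Lemma bdryH F a b c d : c <= d -> cdiff_on (cbdry a b c d) F ->
  ccont_on a b (fun x => F (x +i* c)) /\ ccont_on a b (fun x => F (x +i* d)).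
Proof.
move=> ab H; split; apply: cdiff_on_ccontH H => y yd.
- by split; [split; rewrite //= lexx|apply: Or43].
- by split; [split; rewrite //= lexx andbT|apply: Or44].
Qed.

Lemma boxH F a b c d (y : R) : cdiff_on (cbox a b c d) F -> c <= y <= d ->
  ccont_on a b (fun x => F (x +i* y)).
Proof. by move=> H cyd; apply: cdiff_on_ccontH H => x axb; split. Qed.

Lemma boxV F a b c d (x : R) : cdiff_on (cbox a b c d) F -> a <= x <= b ->
  ccont_on c d (fun y => F (x +i* y)).
Proof. by move=> H cyd; apply: cdiff_on_ccontV H => y ayb; split. Qed.

Lemma rect_splitx F a b c d m : a <= m <= b -> c <= d -> cdiff_on (cbox a b c d) F ->
  rect F a b c d = rect F a m c d + rect F m b c d.
Proof.
move=> /andP[am mb] cd H; rewrite /rect.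
rewrite !(@cint_split _ a b m)//; first ring.
all: by apply: (boxH H); rewrite lexx cd.
Qed.

Lemma rect_splity F a b c d m : a <= b -> c <= m <= d -> cdiff_on (cbox a b c d) F ->
  rect F a b c d = rect F a b c m + rect F a b m d.
Proof.
move=> ab /andP[cm md] H; rewrite /rect.
rewrite !(@cint_split _ c d m)//; first ring.
all: by apply: (boxV H); rewrite lexx ab.
Qed.

Lemma rect_split4 F a b c d (m n : R) : a <= m <= b -> c <= n <= d ->
  cdiff_on (cbox a b c d) F ->
  rect F a b c d = rect F a m c n + rect F a m n d +
                   (rect F m b c n + rect F m b n d).
Proof.
move=> /andP[am mb] /andP[cn nd] H; rewrite (@rect_splitx _ _ _ _ _ m)//; last 2 first.
- by rewrite am.
- exact: le_trans nd.
congr (_ + _); apply: rect_splity; rewrite ?cn//.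
- by apply: cdiff_onW H => z [/= /andP[az zm] czd]; split; rewrite // az (le_trans zm).
- by apply: cdiff_onW H => z [/= /andP[mz zb] czd]; split; rewrite // zb (le_trans am).
Qed.

Lemma rectB F G a b c d : a <= b -> c <= d -> cdiff_on (cbdry a b c d) F ->
  cdiff_on (cbdry a b c d) G ->
  rect (fun z => F z - G z) a b c d = rect F a b c d - rect G a b c d.
Proof.
move=> ab cd HF HG; have [? ?] := bdryH cd HF; have [? ?] := bdryH cd HG.
have [? ?] := bdryV ab HF; have [? ?] := bdryV ab HG.
by rewrite /rect !cintB//; ring.
Qed.

Lemma rectZ F (u : R[i]) a b c d : a <= b -> c <= d -> cdiff_on (cbdry a b c d) F ->
  rect (fun z => u * F z) a b c d = u * rect F a b c d.
Proof.
move=> ab cd HF; have [? ?] := bdryH cd HF; have [? ?] := bdryV ab HF.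
by rewrite /rect !cintZ//; ring.
Qed.

Lemma normc_rect_sup F a b c d (M : R) : a <= b -> c <= d -> cdiff_on (cbdry a b c d) F ->
  (forall z, cbdry a b c d z -> normc (F z) <= M) ->
  normc (rect F a b c d) <= 4 * M * ((b - a) + (d - c)).
Proof.
move=> ab cd HF HM; have [C1 C2] := bdryH cd HF; have [C3 C4] := bdryV ab HF.
have A1 : normc (cint a b (fun x => F (x +i* c))) <= 2 * M * (b - a).
  by apply: normc_cint_sup => // t tab; apply: HM; split;
    [split; rewrite //= lexx|apply: Or43].
have A2 : normc (cint a b (fun x => F (x +i* d))) <= 2 * M * (b - a).
  by apply: normc_cint_sup => // t tab; apply: HM; split;
    [split; rewrite //= lexx andbT|apply: Or44].
have B1 : normc (cint c d (fun y => F (a +i* y))) <= 2 * M * (d - c).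
  by apply: normc_cint_sup => // t tab; apply: HM; split;
    [split; rewrite //= lexx|apply: Or41].
have B2 : normc (cint c d (fun y => F (b +i* y))) <= 2 * M * (d - c).
  by apply: normc_cint_sup => // t tab; apply: HM; split;
    [split; rewrite //= lexx andbT|apply: Or42].
rewrite /rect (le_trans (le_normcD _ _))// normcM normc_i mul1r.
have := le_normcD (cint a b (fun x => F (x +i* c))) (- cint a b (fun x => F (x +i* d))).
have := le_normcD (cint c d (fun y => F (b +i* y))) (- cint c d (fun y => F (a +i* y))).
rewrite !normcN; lra.
Qed.
Lemma has_cderiv_H F (x y : R) (d0 : R[i]) : has_cderiv F (x +i* y) d0 ->
  is_derive x 1 (fun s : R => complex.Re (F (s +i* y))) (complex.Re d0) /\
  is_derive x 1 (fun s : R => complex.Im (F (s +i* y))) (complex.Im d0).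
Proof.
rewrite lineH => /has_cderiv_line; rewrite mulr1.
move=> [A B]; split; [have := A|have := B]; congr (is_derive _ _ _ _);
  by apply/funext => s; rewrite -lineH.
Qed.

Lemma has_cderiv_V F (x y : R) (d0 : R[i]) : has_cderiv F (x +i* y) d0 ->
  is_derive y 1 (fun s : R => complex.Re (F (x +i* s))) (complex.Re ('i * d0)) /\
  is_derive y 1 (fun s : R => complex.Im (F (x +i* s))) (complex.Im ('i * d0)).
Proof.
rewrite lineV => /has_cderiv_line; rewrite [_ * 'i]mulrC.
move=> [A B]; split; [have := A|have := B]; congr (is_derive _ _ _ _);
  by apply/funext => s; rewrite -lineV.
Qed.

(** By the fundamental theorem of calculus each side contributes the difference
    of the primitive at its ends, and these cancel around the boundary. *)
Lemma rect_primitive F G a b c d : a <= b -> c <= d -> cdiff_on (cbox a b c d) F ->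
  (forall z, cbox a b c d z -> has_cderiv G z (F z)) -> rect F a b c d = 0.
Proof.
move=> ab cd HF HG; rewrite /rect.
have A y : c <= y <= d -> cint a b (fun x => F (x +i* y)) = G (b +i* y) - G (a +i* y).
  move=> cyd; rewrite (@cint_FTC _ a b (fun x => G (x +i* y)))//.
    exact: (boxH HF).
  by move=> x axb; apply: has_cderiv_H; exact: HG.
have B x : a <= x <= b -> 'i * cint c d (fun y => F (x +i* y)) = G (x +i* d) - G (x +i* c).
  move=> axb; rewrite -cintZ; last exact: (boxV HF).
  rewrite (@cint_FTC _ c d (fun y => G (x +i* y)))//.
    by move=> y cyd; apply: ccontZ; exact: (boxV HF).
  by move=> y cyd; apply: has_cderiv_V; exact: HG.
rewrite mulrBr !A ?B ?lexx ?ab ?cd//; ring.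
Qed.

Lemma rect_affine (u v : R[i]) a b c d : a <= b -> c <= d ->
  rect (fun z => u * z + v) a b c d = 0.
Proof.
move=> ab cd; apply: (@rect_primitive _ (fun z => z * (u / 2 * z + v))) => //.
  by move=> z _; exists u; exact: has_cderiv_affine.
move=> z _; have := has_cderivM (has_cderiv_id z) (has_cderiv_affine z (u / 2) v).
by rewrite (_ : _ + _ = u * z + v) //; field.
Qed.

(** The nested interval principle for bisection: [x n] is the left end of an
    interval of length [l / 2 ^+ n]. *)
Lemma nested_halves (l : R) (x : nat -> R) : 0 <= l ->
  (forall n, x n <= x n.+1 <= x n + l / 2 ^+ n.+1) ->
  exists X, forall n, x n <= X <= x n + l / 2 ^+ n.
Proof.
move=> l0 H.
have E n : l / 2 ^+ n = l / 2 ^+ n.+1 + l / 2 ^+ n.+1.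
  by rewrite exprS invfM mulrCA -mulrDl (_ : 2^-1 + 2^-1 = 1) ?mul1r//; lra.
have up n k : x n <= x (n + k)%N.
  elim: k => [|k IH]; first by rewrite addn0.
  by rewrite addnS (le_trans IH)//; case/andP: (H (n + k)%N).
have dn n k : x (n + k)%N + l / 2 ^+ (n + k) <= x n + l / 2 ^+ n.
  elim: k => [|k IH]; first by rewrite addn0.
  apply: le_trans IH; rewrite addnS [X in _ <= _ + X]E.
  by case/andP: (H (n + k)%N); lra.
have P n : 0 <= l / 2 ^+ n by rewrite divr_ge0// exprn_ge0.
have bd n k : x k <= x n + l / 2 ^+ n.
  have [nk|/ltnW kn] := leqP n k.
    by have := dn n (k - n)%N; rewrite subnKC//; have := P k; lra.
  by have := up k (n - k)%N; rewrite subnKC//; have := P n; lra.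
exists (sup (range x)) => n; apply/andP; split.
  apply: ub_le_sup; last by exists n.
  by exists (x 0%N + l / 2 ^+ 0) => _ [k _ <-].
apply: ge_sup; first by exists (x 0%N); exists 0%N.
by move=> _ [k _ <-].
Qed.

(** Subtracting the first order Taylor polynomial at [p] does not change the
    boundary integral, because affine functions have a primitive; what remains is
    of size [e * |z - p|] on a boundary whose length is twice the half-perimeter. *)
Lemma rect_small F (p d0 : R[i]) : has_cderiv F p d0 ->
  forall e : R, 0 < e -> exists2 r : R, 0 < r & forall a b c d,
    cbox a b c d p -> (b - a) + (d - c) < r -> cdiff_on (cbox a b c d) F ->
    normc (rect F a b c d) <= e * ((b - a) + (d - c)) ^+ 2.
Proof.
move=> H e e0; have e4 : 0 < e / 4 by lra.
have [r r0 Hr] := H _ e4; exists r => // a b c d [pa pc] sr HF.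
have ab : a <= b by case/andP: pa => /le_trans; apply.
have cd : c <= d by case/andP: pc => /le_trans; apply.
set s := (b - a) + (d - c) in sr *.
pose aff z := d0 * z + (F p - d0 * p).
have HA : cdiff_on (cbox a b c d) aff.
  by move=> z _; exists d0; exact: has_cderiv_affine.
have -> : rect F a b c d = rect (fun z => F z - aff z) a b c d.
  by rewrite rectB ?rect_affine ?subr0//; apply: cdiff_onW (@cbdry_sub _ _ _ _) _.
have -> : e * s ^+ 2 = 4 * (e / 4 * s) * s by field.
apply: normc_rect_sup => // z /cbdry_sub Bz.
  have [d1 H1] := HF z Bz; have [d2 H2] := HA z Bz.
  by exists (d1 - d2); exact: has_cderivB.
have zs : normc (z - p) <= s.
  rewrite (le_trans (normc_le_ReIm _))// ReDc ImDc ReNc ImNc.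
  by case: Bz => za zc; apply: lerD; rewrite ler_norml; lra.
have := Hr (z - p); rewrite [p + _]addrC subrK => /(_ (le_lt_trans zs sr)) A.
have -> : F z - aff z = F z - F p - d0 * (z - p) by rewrite /aff; ring.
by apply: (le_trans A); rewrite ler_wpM2l// ltW.
Qed.

(** Bisection. If the integral is nonzero, some quarter carries at least a quarter
    of it, and so on; [rect_small] at the common point of the nested quarters
    gives a contradiction. *)
Theorem goursat F a b c d : a <= b -> c <= d -> cdiff_on (cbox a b c d) F ->
  rect F a b c d = 0.
Proof.
move=> ab cd HF; apply/eqP; rewrite -normc_eq0 eq_le normc_ge0 andbT.
pose l := b - a; pose m := d - c; pose s := l + m.
have l0 : 0 <= l by rewrite subr_ge0.
have m0 : 0 <= m by rewrite subr_ge0.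
rewrite leNgt; apply/negP => rpos.
pose e := normc (rect F a b c d) / (s ^+ 2 + 1).
have s1 : 0 < s ^+ 2 + 1 by rewrite ltr_wpDl ?sqr_ge0.
have e0 : 0 < e by rewrite divr_gt0.
pose Q n (p : R * R) := rect F p.1 (p.1 + l / 2 ^+ n) p.2 (p.2 + m / 2 ^+ n).
pose ins n (p : R * R) := [/\ a <= p.1, p.1 + l / 2 ^+ n <= b, c <= p.2 & p.2 + m / 2 ^+ n <= d].
pose bad n p := ins n p /\ e * (s / 2 ^+ n) ^+ 2 < normc (Q n p).
have P (u : R) n : 0 <= u -> 0 <= u / 2 ^+ n by move=> ?; rewrite divr_ge0// exprn_ge0.
have E (u : R) n : u / 2 ^+ n = u / 2 ^+ n.+1 + u / 2 ^+ n.+1.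
  by rewrite exprS invfM mulrCA -mulrDl (_ : 2^-1 + 2^-1 = 1) ?mul1r//; lra.
have bad0 : bad 0%N (a, c).
  split; first by rewrite /ins /= expr0 !divr1 /l /m !lexx; split=> //; lra.
  have -> : Q 0%N (a, c) = rect F a b c d.
    by rewrite /Q /= expr0 !divr1 /l /m [a + _]addrC subrK [c + _]addrC subrK.
  rewrite expr0 divr1.
  by rewrite /e mulrAC ltr_pdivrMr// ltr_pM2l//; lra.
have step n p : bad n p -> exists p', [/\ bad n.+1 p',
    p.1 <= p'.1 <= p.1 + l / 2 ^+ n.+1 & p.2 <= p'.2 <= p.2 + m / 2 ^+ n.+1].
  have sum4 (q1 q2 q3 q4 q5 q6 q7 k : R) : q1 <= k -> q2 <= k -> q3 <= k -> q4 <= k ->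
      q6 <= q3 + q4 -> q5 <= q1 + q2 -> q7 <= q5 + q6 -> q7 <= 4 * k by clear; lra.
  have half (u v q L h x : R) : u <= q -> q + L <= v -> L = h + h -> q <= x -> x <= q + h ->
      u <= x /\ x + h <= v by clear; lra.
  move=> [[i1 i2 i3 i4] B].
  have l1 := P l n.+1 l0; have m1 := P m n.+1 m0.
  have El := E l n; have Em := E m n; have Es := E s n.
  set l' := l / 2 ^+ n.+1 in l1 El *; set m' := m / 2 ^+ n.+1 in m1 Em *.
  have HQ : cdiff_on (cbox p.1 (p.1 + l / 2 ^+ n) p.2 (p.2 + m / 2 ^+ n)) F.
    by apply: cdiff_onW HF => z [/= /andP[? ?] /andP[? ?]]; split; lra.
  have spl : Q n p = Q n.+1 p + Q n.+1 (p.1, p.2 + m') +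
      (Q n.+1 (p.1 + l', p.2) + Q n.+1 (p.1 + l', p.2 + m')).
    rewrite /Q /= -/l' -/m' -(addrA p.1 l' l') -(addrA p.2 m' m') -El -Em.
    by apply: rect_split4 => //; rewrite ?El ?Em; move: l1 m1; clear; lra.
  apply: contrapT => N.
  have good x y : p.1 <= x <= p.1 + l' -> p.2 <= y <= p.2 + m' ->
      normc (Q n.+1 (x, y)) <= e * (s / 2 ^+ n.+1) ^+ 2.
    move=> /andP[x1 x2] /andP[y1 y2]; rewrite leNgt; apply/negP => BB; apply: N.
    exists (x, y); split => /=; [|by apply/andP|by apply/andP].
    have [j1 j2] := half _ _ _ _ _ _ i1 i2 El x1 x2.
    have [j3 j4] := half _ _ _ _ _ _ i3 i4 Em y1 y2.
    by split.
  move: B; rewrite spl; apply/negP; rewrite -leNgt.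
  have g0 : p.1 <= p.1 <= p.1 + l' /\ p.1 <= p.1 + l' <= p.1 + l'.
    by move: l1; clear; lra.
  have g0' : p.2 <= p.2 <= p.2 + m' /\ p.2 <= p.2 + m' <= p.2 + m'.
    by move: m1; clear; lra.
  have g1 : normc (Q n.+1 p) <= e * (s / 2 ^+ n.+1) ^+ 2.
    by rewrite [p in Q _ p]surjective_pairing; apply: good; [case: g0|case: g0'].
  have g2 := good p.1 (p.2 + m') g0.1 g0'.2.
  have g3 := good (p.1 + l') p.2 g0.2 g0'.1.
  have g4 := good (p.1 + l') (p.2 + m') g0.2 g0'.2.
  have := le_normcD (Q n.+1 p + Q n.+1 (p.1, p.2 + m')) (Q n.+1 (p.1 + l', p.2) + Q n.+1 (p.1 + l', p.2 + m')).
  have := le_normcD (Q n.+1 p) (Q n.+1 (p.1, p.2 + m')).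
  have := le_normcD (Q n.+1 (p.1 + l', p.2)) (Q n.+1 (p.1 + l', p.2 + m')).
  rewrite Es (_ : e * _ ^+ 2 = 4 * (e * (s / 2 ^+ n.+1) ^+ 2)); last by ring.
  exact: (sum4 _ _ _ _ _ _ _ _ g1 g2 g3 g4).
have nxt n p : {p' | bad n p -> [/\ bad n.+1 p',
    p.1 <= p'.1 <= p.1 + l / 2 ^+ n.+1 & p.2 <= p'.2 <= p.2 + m / 2 ^+ n.+1]}.
  apply: cid; have [/step[p' Hp']|nb] := pselect (bad n p); first by exists p'.
  by exists p.
pose q := fix q n := if n is k.+1 then sval (nxt k (q k)) else (a, c).
have qbad n : bad n (q n).
  by elim: n => [//|n IH] /=; case: (nxt n (q n)) => p' /= /(_ IH)[].
have qs n := svalP (nxt n (q n)) (qbad n).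
have [X HX] : exists X, forall n, (q n).1 <= X <= (q n).1 + l / 2 ^+ n.
  by apply: nested_halves => // n; have [] := qs n.
have [Y HY] : exists Y, forall n, (q n).2 <= Y <= (q n).2 + m / 2 ^+ n.
  by apply: nested_halves => // n; have [] := qs n.
have [d0 Hd0] : exists d0 : R[i], has_cderiv F (X +i* Y) d0.
  have := HX 0%N; have := HY 0%N; rewrite /= expr0 !divr1 /l /m => H1 H2.
  by apply: HF; split => /=; lra.
have [r r0 Hr] := rect_small Hd0 e0.
have [n Hn] : exists n, s / 2 ^+ n < r.
  have s0 : 0 <= s by exact: addr_ge0.
  have sr : 0 <= s / r by rewrite divr_ge0// ltW.
  exists (Num.truncn (s / r)).+1; rewrite ltr_pdivrMr ?exprn_gt0// mulrC -ltr_pdivrMr//.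
  apply: lt_le_trans (truncnS_gt _) _; rewrite -natrX ler_nat.
  exact: ltn_trans (ltnSn _) (ltn_expl _ _).
have [[i1 i2 i3 i4]] := qbad n; apply/negP; rewrite -leNgt.
have HQ : cdiff_on (cbox (q n).1 ((q n).1 + l / 2 ^+ n) (q n).2 ((q n).2 + m / 2 ^+ n)) F.
  apply: cdiff_onW HF => z [/= /andP[za zb] /andP[zc zd]].
  by rewrite /cbox /= (le_trans i1 za) (le_trans zb i2) (le_trans i3 zc) (le_trans zd i4).
have E' : (q n).1 + l / 2 ^+ n - (q n).1 + ((q n).2 + m / 2 ^+ n - (q n).2) = s / 2 ^+ n.
  have K (x y : R) : x + y - x = y by rewrite [x + y]addrC addrK.
  by rewrite !K /s [RHS]mulrDl.
have := Hr _ _ _ _ (conj (HX n) (HY n)); rewrite E'; apply => //.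
Qed.
End Goursat.

(** * Cauchy's formula on rectangles and squares *)

Section Cauchy.
Context {R : realType}.
Implicit Types (F G : R[i] -> R[i]) (a b c d r : R) (z w u : R[i]).

(** The frame between the two rectangles is the union of four rectangles to which
    [goursat] applies. *)
Lemma rect_deform F a b c d a' b' c' d' :
  [/\ a <= a', a' < b' & b' <= b] -> [/\ c <= c', c' < d' & d' <= d] ->
  cdiff_on (cbox a b c d `\` [set z | a' < complex.Re z < b' /\ c' < complex.Im z < d']) F ->
  rect F a b c d = rect F a' b' c' d'.
Proof.
move=> [aa ab' bb] [cc cd' dd] H.
have ab := le_trans aa (le_trans (ltW ab') bb).
have cd := le_trans cc (le_trans (ltW cd') dd).
have CV x : a <= x <= b -> (x <= a') || (b' <= x) -> ccont_on c d (fun y => F (x +i* y)).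
  move=> xab xo; apply: cdiff_on_ccontV H => y ycd; split; first by split.
  by move=> [/= /andP[x1 x2] _]; case/orP: xo; rewrite leNgt ?x1 ?x2.
have CH y : c <= y <= d -> (y <= c') || (d' <= y) -> ccont_on a b (fun x => F (x +i* y)).
  move=> yab yo; apply: cdiff_on_ccontH H => x xab; split; first by split.
  by move=> [_ /= /andP[x1 x2]]; case/orP: yo; rewrite leNgt ?x1 ?x2.
have Z x1 x2 y1 y2 : a <= x1 -> x1 <= x2 -> x2 <= b -> c <= y1 -> y1 <= y2 -> y2 <= d ->
    [|| x2 <= a', b' <= x1, y2 <= c' | d' <= y1] -> rect F x1 x2 y1 y2 = 0.
  move=> ax x12 xb cy y12 yd out; apply: goursat => //.
  apply: cdiff_onW H => z [/andP[x1z zx2] /andP[y1z zy2]]; split.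
    by split; rewrite ?(le_trans ax x1z) ?(le_trans cy y1z) ?(le_trans zx2 xb) ?(le_trans zy2 yd).
  move=> [/= /andP[A B] /andP[C D]]; case/or4P: out; apply/negP; rewrite -ltNge.
  - exact: lt_le_trans A zx2.
  - exact: le_lt_trans x1z B.
  - exact: lt_le_trans C zy2.
  - exact: le_lt_trans y1z D.
have := Z a a' c d; have := Z b' b c d; have := Z a' b' c c'; have := Z a' b' d' d.
rewrite !lexx !orbT /= => /(_ aa (ltW ab') bb (le_trans cc (ltW cd')) dd isT isT) Z1.
move=> /(_ aa (ltW ab') bb isT cc (le_trans (ltW cd') dd) isT) Z2.
move=> /(_ (le_trans aa (ltW ab')) bb isT isT cd isT isT) Z3.
move=> /(_ isT aa (le_trans (ltW ab') bb) isT cd isT isT) Z4.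
have h1 : ccont_on a b (fun x => F (x +i* c)) by apply: CH; rewrite ?lexx ?cd ?cc.
have h2 : ccont_on a b (fun x => F (x +i* d)) by apply: CH; rewrite ?lexx ?cd ?dd ?orbT.
have v1 : ccont_on c d (fun y => F (a' +i* y)).
  by apply: CV; rewrite ?lexx ?aa ?(le_trans (ltW ab') bb).
have v2 : ccont_on c d (fun y => F (b' +i* y)).
  by apply: CV; rewrite ?lexx ?bb ?orbT ?(le_trans aa (ltW ab')).
have S (h : R -> R[i]) x x1 x2 x3 : x <= x1 -> x1 <= x2 -> x2 <= x3 -> ccont_on x x3 h ->
    cint x x3 h = cint x x1 h + cint x1 x2 h + cint x2 x3 h.
  move=> l1 l2 l3 hc; rewrite (cint_split l1 (le_trans l2 l3) hc) -addrA.
  by rewrite (cint_split l2 l3)//; exact: ccont_onW hc.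
rewrite -[RHS]addr0 -{1}Z1 -[RHS]addr0 -{1}Z2 -[RHS]addr0 -{1}Z3 -[RHS]addr0 -{1}Z4.
rewrite /rect (S _ _ _ _ _ aa (ltW ab') bb h1) (S _ _ _ _ _ aa (ltW ab') bb h2).
rewrite (S _ _ _ _ _ cc (ltW cd') dd v1) (S _ _ _ _ _ cc (ltW cd') dd v2).
ring.
Qed.

Lemma cdiff_invB w z : z != w -> has_cderiv (fun v => (v - w)^-1) z (- 1 / (z - w) ^+ 2).
Proof.
move=> zw; apply: has_cderiv_inv; last by rewrite subr_eq0.
by have := has_cderiv_affine z 1 (- w); apply: (@has_cderiv_near _ _ _ _ _ 1) => // v _; rewrite mul1r.
Qed.

Lemma cdiff_onM A F G : cdiff_on A F -> cdiff_on A G -> cdiff_on A (fun z => F z * G z).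
Proof.
move=> HF HG z Az; have [d1 H1] := HF z Az; have [d2 H2] := HG z Az.
by exists (d1 * G z + F z * d2); exact: has_cderivM.
Qed.

Lemma cdiff_onB A F G : cdiff_on A F -> cdiff_on A G -> cdiff_on A (fun z => F z - G z).
Proof.
move=> HF HG z Az; have [d1 H1] := HF z Az; have [d2 H2] := HG z Az.
by exists (d1 - d2); exact: has_cderivB.
Qed.

Lemma cdiff_on_cst A (u : R[i]) : cdiff_on A (fun=> u).
Proof. by move=> z _; exists 0; exact: has_cderiv_cst. Qed.

Lemma cdiff_on_invB A w : ~ A w -> cdiff_on A (fun z => (z - w)^-1).
Proof.
by move=> Aw z Az; eexists; apply: cdiff_invB; apply: contra_notN Aw => /eqP <-.
Qed.

(** Opposite sides are combined: the sum of the two integrands has the primitive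
    [2 atan ((t - x) / e)], whose increment over [x - e, x + e] is [pi]. *)
Lemma rect_invB w (e : R) : 0 < e ->
  rect (fun z => (z - w)^-1) (complex.Re w - e) (complex.Re w + e)
    (complex.Im w - e) (complex.Im w + e) = (2 * pi)%:C * 'i.
Proof.
move=> e0; case: w => x y /=.
have pos (t : R) : 0 < t ^+ 2 + e ^+ 2 by rewrite ltr_wpDl ?sqr_ge0// exprn_gt0.

have inv (s t : R) : 0 < s ^+ 2 + t ^+ 2 -> (s +i* t : R[i])^-1 =
    (s / (s ^+ 2 + t ^+ 2)) +i* (- t / (s ^+ 2 + t ^+ 2)).
  move=> st; have st0 : s ^+ 2 + t ^+ 2 != 0 by rewrite gt_eqF.
  apply: (mulfI (_ : (s +i* t) != 0)).
    apply: contraNneq st0; case=> -> ->; by rewrite expr0n addr0.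
  rewrite divff; last first.
    apply: contraNneq st0; case=> -> ->; by rewrite expr0n addr0.
  apply: complexP; rewrite ?ReMc ?ImMc /=; field; exact: st0.
have sub (s t : R) : (s +i* t) - (x +i* y) = (s - x) +i* (t - y) by [].
have D (u t : R) : is_derive t 1 (fun s : R => 2 * atan ((s - u) / e)) (2 * e / ((t - u) ^+ 2 + e ^+ 2)).
  have A : is_derive t 1 (fun s : R => (s - u) / e) e^-1.
    rewrite (_ : (fun s : R => (s - u) / e) = (fun s : R => e^-1 *: (s - u))).
      by apply: is_derive_eq; rewrite subr0 /GRing.scale /= mulr1.
    by apply/funext => s; rewrite mulrC.
  have B := is_derive1_atan ((t - u) / e).
  rewrite (_ : (fun s : R => _) = (fun s : R => (2 : R) *: (atan \o (fun s : R => (s - u) / e)) s))//.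
  have C := @is_derive1_comp R atan (fun s : R => (s - u) / e) t _ _ B A.
  apply: is_derive_eq.
  have := lt0r_neq0 (pos (t - u)) => P.
  have ee : (1 + ((t - u) / e) ^+ 2)^-1 = e ^+ 2 / ((t - u) ^+ 2 + e ^+ 2).
    rewrite -[LHS]invrK -[RHS]invrK invrK invf_div; congr (_^-1).
    by field; rewrite gt_eqF.
  rewrite ee; set q := ((t - u) ^+ 2 + e ^+ 2)^-1.
  by rewrite /GRing.scale /=; field; rewrite gt_eqF.
have at1 : 2 * atan (e / e) - 2 * atan (- e / e) = pi :> R.
  by rewrite mulNr divff ?gt_eqF// atanN atan1; field.
set w := x +i* y.
have CF : cdiff_on (cbdry (x - e) (x + e) (y - e) (y + e)) (fun z => (z - w)^-1).
  apply: cdiff_on_invB => -[_] /=; case; lra.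
have le_e (u : R) : u - e <= u + e by lra.
have [c1 c2] := bdryH (le_e y) CF.
have [c3 c4] := bdryV (le_e x) CF.
have he : 0 < e ^+ 2 by rewrite exprn_gt0.
rewrite /rect -!cintB//.
rewrite (@cint_FTC _ _ _ (fun t : R => 0 +i* (2 * atan ((t - x) / e)))); [|exact: le_e| |]; last 2 first.
- by move=> t tI; apply: ccontB; [exact: c1|exact: c2].
- move=> t _; rewrite !sub !inv; [|rewrite ?sqrrN; have := pos (t - x); lra..].
  have E1 : y - e - y = - e by ring.
  have E2 : y + e - y = e by ring.
  rewrite /= E1 E2 sqrrN opprK; split.
    by rewrite subrr; exact: is_derive_cst.
  have := D x t; congr (is_derive _ _ _ _).
  by rewrite mulNr opprK -mulrDl -mulr2n mulr_natl.
rewrite (@cint_FTC _ _ _ (fun t : R => (2 * atan ((t - y) / e)) +i* 0)); [|exact: le_e| |]; last 2 first.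
- by move=> t tI; apply: ccontB; [exact: c4|exact: c3].
- move=> t _; rewrite !sub !inv; [|rewrite ?sqrrN; have := pos (t - y); lra..].
  have E1 : x - e - x = - e by ring.
  have E2 : x + e - x = e by ring.
  rewrite /= E1 E2 sqrrN (addrC (e ^+ 2)); split; last first.
    by rewrite subrr; exact: is_derive_cst.
  have := D y t; congr (is_derive _ _ _ _).
  by rewrite mulNr opprK -mulrDl -mulr2n mulr_natl.
have K (u : R) : u + e - u = e by ring.
have K' (u : R) : u - e - u = - e by ring.
apply: complexP; rewrite ?(ReMc, ImMc, ReDc, ImDc, ReNc, ImNc) /= !(K, K').
  by rewrite !subrr; ring.
by rewrite !(mul0r, mul1r, mulr0, mulr1, subr0, addr0, add0r) at1; ring.
Qed.

(** By [rect_deform] the rectangle may be replaced with a square of half-side [e]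
    about [w], on which [(F z - F w) / (z - w)] is bounded, so that its integral
    is of order [e]; [rect_invB] evaluates the rest. *)
Lemma cauchy_formula F a b c d w : a < complex.Re w < b -> c < complex.Im w < d ->
  cdiff_on (cbox a b c d) F ->
  rect (fun z => F z * (z - w)^-1) a b c d = (2 * pi)%:C * 'i * F w.
Proof.
case: w => x y /= /andP[ax xb] /andP[cy yd]; set w := x +i* y => HF.
have Fw : cbox a b c d w by split => /=; rewrite !ltW.
have [d0 Hd0] := HF w Fw; have [r r0 Hr] := Hd0 1 ltr01.
set I := rect _ _ _ _ _; set L := _ * F w.
pose M := normc d0 + 1; have M0 : 0 < M by rewrite ltr_pwDr ?normc_ge0.
pose m := Num.min (r / 4) (Num.min (Num.min (x - a) (b - x)) (Num.min (y - c) (d - y))).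
have m0 : 0 < m by rewrite !lt_min !subr_gt0 ax xb cy yd; lra.
suff A e : 0 < e -> e < m -> normc (I - L) <= 16 * M * e.
  apply/eqP; rewrite -subr_eq0 -normc_eq0 eq_le normc_ge0 andbT leNgt; apply/negP => N.
  pose e := Num.min (m / 2) (normc (I - L) / (32 * M)).
  have e0 : 0 < e by rewrite lt_min !divr_gt0// mulr_gt0.
  have em : e < m by rewrite gt_min (_ : m / 2 < m)//; lra.
  have := A e e0 em.
  have : e <= normc (I - L) / (32 * M) by rewrite ge_min lexx orbT.
  rewrite ler_pdivlMr ?mulr_gt0//; lra.
move=> e0; rewrite !lt_min => /and3P[er /andP[e1 e2] /andP[e3 e4]].
have sub (A : set R[i]) : A `<=` cbox a b c d -> ~ A w ->
    cdiff_on A (fun z => F z * (z - w)^-1).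
  by move=> AB Aw; apply: cdiff_onM; [exact: cdiff_onW HF|exact: cdiff_on_invB].
have -> : I = rect (fun z => F z * (z - w)^-1) (x - e) (x + e) (y - e) (y + e).
  apply: rect_deform; [split; lra|split; lra|].
  by apply: sub => [z []//|[_]] /=; apply; split; lra.
have nw : ~ cbdry (x - e) (x + e) (y - e) (y + e) w by move=> [_] /=; case; lra.
have bsub : cbdry (x - e) (x + e) (y - e) (y + e) `<=` cbox a b c d.
  by move=> z /cbdry_sub [/andP[? ?] /andP[? ?]]; split; lra.
have -> : L = rect (fun z => F w * (z - w)^-1) (x - e) (x + e) (y - e) (y + e).
  rewrite (@rectZ _ (fun z => (z - w)^-1)); [|lra|lra|exact: cdiff_on_invB].
  by rewrite /L mulrC -(rect_invB w e0).
rewrite -rectB; [|lra|lra|exact: sub|]; last first.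
  by apply: cdiff_onM; [exact: cdiff_on_cst|exact: cdiff_on_invB].
have -> : 16 * M * e = 4 * M * ((x + e - (x - e)) + (y + e - (y - e))) by ring.
apply: normc_rect_sup; [lra|lra| |].
  apply: cdiff_onB; first exact: sub.
  by apply: cdiff_onM; [exact: cdiff_on_cst|exact: cdiff_on_invB].
move=> z Bz; rewrite -mulrBl normcM normcV.
have zw : z != w by apply: contra_not_neq nw => <-.
rewrite ler_pdivrMr ?normc_gt0 ?subr_eq0//.
have zr : normc (z - w) < r.
  have [/andP[? ?] /andP[? ?]] := cbdry_sub Bz.
  rewrite (le_lt_trans (normc_le_ReIm _))// ReDc ImDc ReNc ImNc /=.
  have : `|complex.Re z - x| <= e by rewrite ler_norml; lra.
  have : `|complex.Im z - y| <= e by rewrite ler_norml; lra.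
  lra.
have := Hr _ zr; rewrite [w + _]addrC subrK mul1r => B.
rewrite -(subrK (d0 * (z - w)) (F z - F w)) (le_trans (le_normcD _ _))// normcM /M; lra.
Qed.

(** Taylor remainders of the kernels of Cauchy's formula, for differentiating it
    under the integral sign. *)
Lemma inv_taylor1 u h (s : R) : 0 < s -> s <= normc u -> s <= normc (u - h) ->
  normc ((u - h)^-1 - u^-1 - h * u ^- 2) <= s ^- 3 * normc h ^+ 2.
Proof.
move=> s0 su suh; have u0 : u != 0 by rewrite -normc_gt0 (lt_le_trans s0).
have uh0 : u - h != 0 by rewrite -normc_gt0 (lt_le_trans s0).
have -> : (u - h)^-1 - u^-1 - h * u ^- 2 = u ^- 2 * (u - h)^-1 * h ^+ 2.
  by field; rewrite u0 uh0.
have nX z n : normc (z ^+ n) = normc z ^+ n.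
  by elim: n => [|n IH]; rewrite ?expr0 ?normc1// !exprS normcM IH.
rewrite normcM nX ler_wpM2r ?exprn_ge0 ?normc_ge0// normcM !normcV nX.
rewrite [s ^+ 3]exprSr [(s ^+ 2 * s)^-1]invfM ler_pM ?invr_ge0 ?exprn_ge0 ?normc_ge0//.
  rewrite lef_pV2 ?posrE ?exprn_gt0 ?(lt_le_trans s0)//.
  by rewrite lerXn2r ?nnegrE ?normc_ge0 ?(ltW s0).
by rewrite lef_pV2 ?posrE ?(lt_le_trans s0).
Qed.

Lemma inv2_taylor1 u h (s : R) : 0 < s -> s <= normc u -> s <= normc (u - h) ->
  normc ((u - h) ^- 2 - u ^- 2 - h * (2 * u ^- 3)) <= 3 * s ^- 4 * normc h ^+ 2.
Proof.
move=> s0 su suh; have u0 : u != 0 by rewrite -normc_gt0 (lt_le_trans s0).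
have uh0 : u - h != 0 by rewrite -normc_gt0 (lt_le_trans s0).
have -> : (u - h) ^- 2 - u ^- 2 - h * (2 * u ^- 3) =
    (u ^- 2 * (u - h) ^- 2 + 2 * (u ^- 3 * (u - h)^-1)) * h ^+ 2.
  by field; rewrite u0 uh0.
have nX z n : normc (z ^+ n) = normc z ^+ n.
  by elim: n => [|n IH]; rewrite ?expr0 ?normc1// !exprS normcM IH.
have V n z : s <= normc z -> normc (z ^- n) <= s ^- n.
  move=> sz; rewrite normcV nX lef_pV2 ?posrE ?exprn_gt0 ?(lt_le_trans s0)//.
  by rewrite lerXn2r ?nnegrE ?normc_ge0 ?(ltW s0).
rewrite normcM nX ler_wpM2r ?exprn_ge0 ?normc_ge0//.
rewrite (le_trans (le_normcD _ _))// !normcM.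
have s4 : s ^- 4 = s ^- 2 * s ^- 2 by rewrite -invfM -exprD.
have s4' : s ^- 4 = s ^- 3 * s ^- 1 by rewrite -invfM -exprD.
have : normc (u ^- 2) * normc ((u - h) ^- 2) <= s ^- 4.
  by rewrite s4 ler_pM ?normc_ge0 ?V.
have : normc (u ^- 3) * normc ((u - h)^-1) <= s ^- 4.
  by rewrite s4' ler_pM ?normc_ge0 ?V// -(expr1 (u - h)) V.
have -> : normc (2 : R[i]) = 2 by rewrite (_ : 2 = (2 : R)%:C) ?normcR ?ger0_norm// rmorph_nat.
have : 0 <= s ^- 4 by rewrite invr_ge0 exprn_ge0 ?ltW.
lra.
Qed.

End Cauchy.

Section CauchyEstimates.
Context {R : realType}.
Implicit Types (F G : R[i] -> R[i]) (a b c d r : R) (z w u : R[i]).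
Notation mu := (@lebesgue_measure R).

(** The integral of [normc F] over the boundary with respect to arc length. *)
Definition side_sum F a b c d : R :=
  \int[mu]_(x in `[a, b]) normc (F (x +i* c)) +
  \int[mu]_(x in `[a, b]) normc (F (x +i* d)) +
  \int[mu]_(y in `[c, d]) normc (F (a +i* y)) +
  \int[mu]_(y in `[c, d]) normc (F (b +i* y)).

Lemma normc_rectM F G a b c d (K : R) : a <= b -> c <= d ->
  cdiff_on (cbdry a b c d) F -> cdiff_on (cbdry a b c d) G ->
  (forall z, cbdry a b c d z -> normc (G z) <= K) ->
  normc (rect (fun z => F z * G z) a b c d) <= 2 * K * side_sum F a b c d.
Proof.
move=> ab cd HF HG HK; have [C1 C2] := bdryH cd HF; have [C3 C4] := bdryV ab HF.
have [D1 D2] := bdryH cd (cdiff_onM HF HG); have [D3 D4] := bdryV ab (cdiff_onM HF HG).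
have key (f g : R -> R[i]) (u v : R) : ccont_on u v f -> ccont_on u v (fun t => f t * g t) ->
    (forall t, u <= t <= v -> normc (g t) <= K) ->
    normc (cint u v (fun t => f t * g t)) <= 2 * K * \int[mu]_(t in `[u, v]) normc (f t).
  move=> cf cfg gK; rewrite (le_trans (normc_cint_le cfg))// -mulrA ler_wpM2l//.
  rewrite -RintegralZl//; last exact: integrable_normc.
  apply: le_Rintegral => //; [exact: integrable_normc|
    by apply: integrableZlR; exact: integrable_normc|].
  by move=> t /=; rewrite in_itv /= normcM mulrC => /gK ?; rewrite ler_wpM2r ?normc_ge0.
have A1 := key _ _ _ _ C1 D1; have A2 := key _ _ _ _ C2 D2.
have A3 := key _ _ _ _ C3 D3; have A4 := key _ _ _ _ C4 D4.
have {}A1 : normc (cint a b (fun x => F (x +i* c) * G (x +i* c))) <= 2 * K * \int[mu]_(x in `[a, b]) normc (F (x +i* c)).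
  by apply: A1 => t tab; apply: HK; split; [split; rewrite //= lexx|apply: Or43].
have {}A2 : normc (cint a b (fun x => F (x +i* d) * G (x +i* d))) <= 2 * K * \int[mu]_(x in `[a, b]) normc (F (x +i* d)).
  by apply: A2 => t tab; apply: HK; split; [split; rewrite //= lexx andbT|apply: Or44].
have {}A3 : normc (cint c d (fun y => F (a +i* y) * G (a +i* y))) <= 2 * K * \int[mu]_(y in `[c, d]) normc (F (a +i* y)).
  by apply: A3 => t tab; apply: HK; split; [split; rewrite //= lexx|apply: Or41].
have {}A4 : normc (cint c d (fun y => F (b +i* y) * G (b +i* y))) <= 2 * K * \int[mu]_(y in `[c, d]) normc (F (b +i* y)).
  by apply: A4 => t tab; apply: HK; split; [split; rewrite //= lexx andbT|apply: Or42].
rewrite /rect (le_trans (le_normcD _ _))// normcM normc_i mul1r /side_sum.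
have := le_normcD (cint a b (fun x => F (x +i* c) * G (x +i* c))) (- cint a b (fun x => F (x +i* d) * G (x +i* d))).
have := le_normcD (cint c d (fun y => F (b +i* y) * G (b +i* y))) (- cint c d (fun y => F (a +i* y) * G (a +i* y))).
rewrite !normcN; lra.
Qed.

Lemma side_sum_le F a b c d (M : R) : a <= b -> c <= d ->
  cdiff_on (cbdry a b c d) F -> (forall z, cbdry a b c d z -> normc (F z) <= M) ->
  side_sum F a b c d <= 2 * M * ((b - a) + (d - c)).
Proof.
move=> ab cd HF HM; have [C1 C2] := bdryH cd HF; have [C3 C4] := bdryV ab HF.
have key (f : R -> R[i]) (u v : R) : u <= v -> ccont_on u v f ->
    (forall t, u <= t <= v -> normc (f t) <= M) ->
    \int[mu]_(t in `[u, v]) normc (f t) <= M * (v - u).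
  move=> uv cf fM.
  have -> : M * (v - u) = \int[mu]_(t in `[u, v]) (cst M t).
    rewrite Rintegral_cst//; congr (M * _).
    by rewrite -[LHS]/(fine (v - u)%:E) -(lebesgue_segment uv).
  apply: le_Rintegral => //; first exact: integrable_normc.
  by apply: continuous_compact_integrable; [exact: segment_compact|exact: cst_continuous].
have A1 : \int[mu]_(x in `[a, b]) normc (F (x +i* c)) <= M * (b - a).
  by apply: (key (fun x => F (x +i* c))) => // t tab; apply: HM; split;
    [split; rewrite //= lexx|apply: Or43].
have A2 : \int[mu]_(x in `[a, b]) normc (F (x +i* d)) <= M * (b - a).
  by apply: (key (fun x => F (x +i* d))) => // t tab; apply: HM; split;
    [split; rewrite //= lexx andbT|apply: Or44].
have A3 : \int[mu]_(y in `[c, d]) normc (F (a +i* y)) <= M * (d - c).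
  by apply: (key (fun y => F (a +i* y))) => // t tab; apply: HM; split;
    [split; rewrite //= lexx|apply: Or41].
have A4 : \int[mu]_(y in `[c, d]) normc (F (b +i* y)) <= M * (d - c).
  by apply: (key (fun y => F (b +i* y))) => // t tab; apply: HM; split;
    [split; rewrite //= lexx andbT|apply: Or42].
rewrite /side_sum; lra.
Qed.

Lemma normc_2pii : 1 <= normc ((2 * pi)%:C * 'i : R[i]).
Proof.
rewrite normcM normc_i mulr1 normcR ger0_norm; last by rewrite mulr_ge0// pi_ge0.
have := pi_ge2 R; lra.
Qed.

Lemma twopii_neq0 : (2 * pi)%:C * 'i != 0 :> R[i].
Proof. by rewrite -normc_gt0 (lt_le_trans ltr01 normc_2pii). Qed.

(** The closed square with centre [z] and half-side [r]; squares replace discs in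
    the estimates, as Cauchy's formula is at hand for rectangles. *)
Definition csq z r := cbox (complex.Re z - r) (complex.Re z + r)
  (complex.Im z - r) (complex.Im z + r).

Lemma csq_bdry_dist z0 r (s : R) z w : csq z0 (r - s) w ->
  cbdry (complex.Re z0 - r) (complex.Re z0 + r) (complex.Im z0 - r) (complex.Im z0 + r) z ->
  s <= normc (z - w).
Proof.
move=> [/andP[w1 w2] /andP[w3 w4]] [_].
have := normc_Re (z - w); have := normc_Im (z - w).
rewrite ReDc ImDc ReNc ImNc => I1 R1.
have := ler_norm (complex.Re z - complex.Re w).
have := ler_norm (- (complex.Re z - complex.Re w)).
have := ler_norm (complex.Im z - complex.Im w).
have := ler_norm (- (complex.Im z - complex.Im w)).
by rewrite !normrN => ? ? ? ?; case=> ?; lra.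
Qed.

(** Cauchy's formula with the kernel estimated by [s^-1]. *)
Lemma normc_center_le F a b c d w (s : R) : a < complex.Re w < b -> c < complex.Im w < d ->
  cdiff_on (cbox a b c d) F -> 0 < s ->
  (forall z, cbdry a b c d z -> s <= normc (z - w)) ->
  normc (F w) <= 2 / s * side_sum F a b c d.
Proof.
move=> wab wcd HF s0 Hs.
have ab : a <= b by case/andP: wab => /ltW/le_trans + /ltW; apply.
have cd : c <= d by case/andP: wcd => /ltW/le_trans + /ltW; apply.
have nw : ~ cbdry a b c d w by move=> /Hs; rewrite subrr normc0 leNgt s0.
rewrite (le_trans (_ : _ <= normc ((2 * pi)%:C * 'i * F w)))//.
  by rewrite normcM ler_peMl ?normc_ge0// normc_2pii.
rewrite -(cauchy_formula wab wcd HF) normc_rectM//.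
- by apply: cdiff_onW HF; exact: cbdry_sub.
- exact: cdiff_on_invB.
- move=> z Bz; rewrite normcV lef_pV2 ?posrE//; first exact: Hs.
  exact: lt_le_trans (Hs _ Bz).
Qed.

Definition cauchy_op F z0 r (k : R[i] -> R[i]) := ((2 * pi)%:C * 'i)^-1 *
  rect (fun z => F z * k z) (complex.Re z0 - r) (complex.Re z0 + r)
    (complex.Im z0 - r) (complex.Im z0 + r).

Definition cauchy_d1 F z0 r w := cauchy_op F z0 r (fun z => (z - w) ^- 2).

Definition cauchy_d2 F z0 r w := cauchy_op F z0 r (fun z => 2 * (z - w) ^- 3).
Definition sq_sum F z0 r := side_sum F (complex.Re z0 - r) (complex.Re z0 + r)
    (complex.Im z0 - r) (complex.Im z0 + r).

Lemma cdiff_onX A F n : cdiff_on A F -> cdiff_on A (fun z => F z ^+ n).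
Proof.
move=> HF; elim: n => [|n IH]; first exact: cdiff_on_cst.
have := cdiff_onM HF IH; congr cdiff_on; by apply/funext => z; rewrite exprS.
Qed.

Lemma cdiff_on_invBX A w n : ~ A w -> cdiff_on A (fun z => (z - w) ^- n).
Proof.
move=> Aw; have := cdiff_onX n (cdiff_on_invB Aw); congr cdiff_on.
by apply/funext => z; rewrite exprVn.
Qed.

(** A first order expansion of the kernel, uniform on the boundary, becomes one of
    the function that the kernel represents. *)
Lemma cauchy_kernel F z0 r (s : R) (k1 k2 k3 : R[i] -> R[i]) h (K : R) :
  0 < r -> cdiff_on (csq z0 r) F ->
  let B := cbdry (complex.Re z0 - r) (complex.Re z0 + r)
    (complex.Im z0 - r) (complex.Im z0 + r) in
  cdiff_on B k1 -> cdiff_on B k2 -> cdiff_on B k3 ->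
  (forall z, B z -> normc (k1 z - k2 z - h * k3 z) <= K) ->
  normc (cauchy_op F z0 r k1 - cauchy_op F z0 r k2 - h * cauchy_op F z0 r k3) <=
    2 * K * sq_sum F z0 r.
Proof.
move=> r0 HF B H1 H2 H3 HK.
have {}HF : cdiff_on B F by apply: cdiff_onW HF; exact: cbdry_sub.
have le_e (u : R) : u - r <= u + r by lra.
have Hh : cdiff_on B (fun z => h * k3 z) by apply: cdiff_onM => //; exact: cdiff_on_cst.
have -> : cauchy_op F z0 r k1 - cauchy_op F z0 r k2 - h * cauchy_op F z0 r k3 =
    cauchy_op F z0 r (fun z => k1 z - k2 z - h * k3 z).
  rewrite /cauchy_op [h * _]mulrCA -!mulrBr; congr (_ * _).
  rewrite -(rectB (le_e _) (le_e _))//; [|exact: cdiff_onM..].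
  rewrite -(rectZ _ (le_e _) (le_e _)); last exact: cdiff_onM.
  rewrite -(rectB (le_e _) (le_e _)); last 2 first.
  - by apply: cdiff_onB; exact: cdiff_onM.
  - by apply: cdiff_onM; [exact: cdiff_on_cst|exact: cdiff_onM].
  rewrite (_ : (fun z => F z * k1 z - F z * k2 z - h * (F z * k3 z)) =
    (fun z => F z * (k1 z - k2 z - h * k3 z)))//.
  by apply/funext => z; ring.
rewrite /cauchy_op normcM normcV.
have A : normc (rect (fun z => F z * (k1 z - k2 z - h * k3 z)) (complex.Re z0 - r)
    (complex.Re z0 + r) (complex.Im z0 - r) (complex.Im z0 + r)) <= 2 * K * sq_sum F z0 r.
  by apply: normc_rectM => //; apply: cdiff_onB => //; exact: cdiff_onB.
rewrite (le_trans _ A)// ler_piMl ?normc_ge0// invf_le1 ?normc_2pii//.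
exact: lt_le_trans normc_2pii.
Qed.

Lemma csq_bdryN z0 r (s : R) w : 0 < s -> csq z0 (r - s) w ->
  ~ cbdry (complex.Re z0 - r) (complex.Re z0 + r) (complex.Im z0 - r) (complex.Im z0 + r) w.
Proof. by move=> s0 Hw /(csq_bdry_dist Hw); rewrite subrr normc0 leNgt s0. Qed.

Lemma csq_inside z0 r (s : R) w : 0 < s -> csq z0 (r - s) w ->
  complex.Re z0 - r < complex.Re w < complex.Re z0 + r /\
  complex.Im z0 - r < complex.Im w < complex.Im z0 + r.
Proof. by move=> s0 [/andP[? ?] /andP[? ?]]; lra. Qed.

Lemma cauchy_quad1 F z0 r (s : R) w w' : 0 < s -> 0 < r -> cdiff_on (csq z0 r) F ->
  csq z0 (r - s) w -> csq z0 (r - s) w' ->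
  normc (F w' - F w - cauchy_d1 F z0 r w * (w' - w)) <=
    2 * (s ^- 3 * normc (w' - w) ^+ 2) * sq_sum F z0 r.
Proof.
move=> s0 r0 HF Hw Hw'.
have E v : csq z0 (r - s) v -> F v = cauchy_op F z0 r (fun z => (z - v)^-1).
  move=> /(csq_inside s0)[A B].
  by rewrite /cauchy_op (cauchy_formula A B HF) mulrA mulVf ?mul1r// twopii_neq0.
rewrite (E w')// (E w)// [_ * (w' - w)]mulrC.
apply: cauchy_kernel => //.
- by apply: cdiff_on_invB; exact: csq_bdryN Hw'.
- by apply: cdiff_on_invB; exact: csq_bdryN Hw.
- by apply: cdiff_on_invBX; exact: csq_bdryN Hw.
- move=> z Bz; have := @inv_taylor1 _ (z - w) (w' - w) s s0.
  rewrite (_ : z - w - (w' - w) = z - w'); last by ring.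
  by apply; [exact: csq_bdry_dist Bz|exact: csq_bdry_dist Bz].
Qed.

Lemma cauchy_quad2 F z0 r (s : R) w w' : 0 < s -> 0 < r -> cdiff_on (csq z0 r) F ->
  csq z0 (r - s) w -> csq z0 (r - s) w' ->
  normc (cauchy_d1 F z0 r w' - cauchy_d1 F z0 r w - cauchy_d2 F z0 r w * (w' - w)) <=
    2 * (3 * s ^- 4 * normc (w' - w) ^+ 2) * sq_sum F z0 r.
Proof.
move=> s0 r0 HF Hw Hw'; rewrite [_ * (w' - w)]mulrC.
apply: cauchy_kernel => //.
- by apply: cdiff_on_invBX; exact: csq_bdryN Hw'.
- by apply: cdiff_on_invBX; exact: csq_bdryN Hw.
- by apply: cdiff_onM; [exact: cdiff_on_cst|apply: cdiff_on_invBX; exact: csq_bdryN Hw].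
- move=> z Bz; have := @inv2_taylor1 _ (z - w) (w' - w) s s0.
  rewrite (_ : z - w - (w' - w) = z - w'); last by ring.
  by apply; [exact: csq_bdry_dist Bz|exact: csq_bdry_dist Bz].
Qed.

(** A quadratic remainder is smaller than any linear one. *)
Lemma has_cderiv_quad F z (d0 : R[i]) (r K : R) : 0 < r ->
  (forall h, normc h < r -> normc (F (z + h) - F z - d0 * h) <= K * normc h ^+ 2) ->
  has_cderiv F z d0.
Proof.
move=> r0 H e e0; have K0 : 0 < `|K| + 1 by rewrite ltr_wpDl.
exists (Num.min r (e / (`|K| + 1))); first by rewrite lt_min r0 divr_gt0.
move=> h; rewrite lt_min ltr_pdivlMr// => /andP[hr he].
rewrite (le_trans (H h hr))// expr2 mulrA ler_wpM2r ?normc_ge0//.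
rewrite (le_trans _ (ltW he))// mulrC ler_wpM2l ?normc_ge0//.
by have := ler_norm K; lra.
Qed.

Lemma csq_nbhs z0 r (s : R) w h : csq z0 (r - s) w -> normc h <= s -> csq z0 r (w + h).
Proof.
move=> [/andP[? ?] /andP[? ?]] hs; have := normc_Re h; have := normc_Im h.
rewrite /csq /cbox /= ReDc ImDc !ler_norml; lra.
Qed.

Lemma csqW z0 r (s : R) w : 0 <= s -> csq z0 (r - s) w -> csq z0 r w.
Proof. by move=> s0 [/andP[? ?] /andP[? ?]]; rewrite /csq /cbox /=; lra. Qed.

Lemma cauchy_has_cderiv F z0 r w : 0 < r -> cdiff_on (csq z0 r) F ->
  csq z0 (r / 2) w -> has_cderiv F w (cauchy_d1 F z0 r w).
Proof.
move=> r0 HF Hw; have s0 : 0 < r / 4 by lra.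
have Hw' : csq z0 (r - r / 4 - r / 4) w by rewrite (_ : _ - _ = r / 2)//; lra.
apply: (@has_cderiv_quad _ _ _ (r / 4) (2 * (r / 4) ^- 3 * sq_sum F z0 r)) => // h hr.
have := cauchy_quad1 s0 r0 HF (csqW (ltW s0) Hw') (csq_nbhs Hw' (ltW hr)).
rewrite [w + h]addrC addrK => /le_trans; apply.
by rewrite le_eqVlt; apply/orP; left; apply/eqP; ring.
Qed.

Lemma csq_center z0 r : 0 <= r -> csq z0 r z0.
Proof. by move=> r0; rewrite /csq /cbox /=; lra. Qed.

(** Near the centre the derivative is itself represented by a kernel, so the same
    argument differentiates it once more. *)
Lemma cderiv_derivable F z0 r : 0 < r -> cdiff_on (csq z0 r) F ->
  exists d0 : R[i], has_cderiv (cderiv F) z0 d0.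
Proof.
move=> r0 HF; exists (cauchy_d2 F z0 r z0).
have s0 : 0 < r / 4 by lra.
have C (s : R) : 0 <= s -> s <= r -> csq z0 (r - s) z0.
  by move=> ? ?; apply: csq_center; lra.
apply: (@has_cderiv_near _ (cauchy_d1 F z0 r) _ _ _ (r / 2)); first lra.
  move=> w wz; rewrite (cderivE (cauchy_has_cderiv r0 HF _))//.
  have -> : w = z0 + (w - z0) by rewrite addrC subrK.
  by apply: (@csq_nbhs _ _ (r / 2)); [apply: csq_center; lra|lra].
apply: (@has_cderiv_quad _ _ _ (r / 4) (6 * (r / 4) ^- 4 * sq_sum F z0 r)) => // h hr.
have C1 : csq z0 (r - r / 4) z0 by apply: C; lra.
have C2 : csq z0 (r - r / 4) (z0 + h).
  by apply: (@csq_nbhs _ _ (r / 4)) => //; [apply: csq_center; lra|lra].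
have := cauchy_quad2 s0 r0 HF C1 C2.
rewrite [z0 + h]addrC addrK => /le_trans; apply.
by rewrite le_eqVlt; apply/orP; left; apply/eqP; ring.
Qed.

(** The constant depends on [F] only through the bound [M]. This is the
    equicontinuity of locally bounded families of holomorphic functions, in a form
    that survives pointwise limits. *)
Lemma taylor_quad F z0 r (M : R) w w' : 0 < r -> cdiff_on (csq z0 r) F ->
  (forall z, csq z0 r z -> normc (F z) <= M) ->
  csq z0 (r / 2) w -> csq z0 (r / 2) w' ->
  normc (F w' - F w - cderiv F w * (w' - w)) <= 128 * M / r ^+ 2 * normc (w' - w) ^+ 2.
Proof.
move=> r0 HF HM Hw Hw'; have s0 : 0 < r / 2 by lra.
have E : r / 2 = r - r / 2 by lra.
rewrite (cderivE (cauchy_has_cderiv r0 HF Hw)); rewrite E in Hw Hw'.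
apply: (le_trans (cauchy_quad1 s0 r0 HF Hw Hw')).
have S : sq_sum F z0 r <= 8 * M * r.
  have := @side_sum_le F (complex.Re z0 - r) (complex.Re z0 + r) (complex.Im z0 - r) (complex.Im z0 + r) M.
  rewrite -/(sq_sum F z0 r) => /(_ _ _ _ _) K; apply: (le_trans (K _ _ _ _)); [lra|lra| | |lra].
  - by apply: cdiff_onW HF; exact: cbdry_sub.
  - by move=> z /cbdry_sub; exact: HM.
set k := normc _ ^+ 2.
have k0 : 0 <= k by rewrite exprn_ge0 ?normc_ge0.
have -> : 128 * M / r ^+ 2 * k = 2 * ((r / 2) ^- 3 * k) * (8 * M * r).
  by field; rewrite gt_eqF.
apply: ler_wpM2l S; rewrite mulr_ge0// mulr_ge0//.
by rewrite invr_ge0 exprn_ge0// ltW.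
Qed.

End CauchyEstimates.

(** * Area integrals and the sub-mean value property *)

Section PlaneMeasure.
Context {R : realType}.
Implicit Types (f g : R[i] -> R[i]) (z : R[i]) (w : R * R).
Notation mu := (@lebesgue_measure R).
Notation mu2 := (mu \x mu)%E.

(** Lebesgue measure lives on [R * R]; [pt] reads its points as complex numbers. *)
Definition pt (w : R * R) : R[i] := w.1 +i* w.2.

Lemma normc_pt_sub w w' : normc (pt w - pt w') <= `|w.1 - w'.1| + `|w.2 - w'.2|.
Proof. exact: (normc_le_ReIm (pt w - pt w')). Qed.

(** An open set is the union of the countably many boxes with rational centre and
    radius [n.+1%:R^-1] that it contains. *)
Lemma measurable_open2 (U : set (R * R)) :
  (forall w, U w -> exists2 e : R, 0 < e &
    forall w', `|w'.1 - w.1| < e -> `|w'.2 - w.2| < e -> U w') ->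
  measurable U.
Proof.
move=> oU.
pose box (a b : rat) (n : nat) : set (R * R) :=
  `]ratr a - n.+1%:R^-1, ratr a + n.+1%:R^-1[ `*` `]ratr b - n.+1%:R^-1, ratr b + n.+1%:R^-1[.
have -> : U = \bigcup_a \bigcup_b \bigcup_n
    (if `[< box a b n `<=` U >] then box a b n else set0).
  apply/seteqP; split=> [w Uw|w]; last first.
    by move=> [a _ [b _ [n _]]]; case: ifPn => // /asboolP; apply.
  have [e e0 He] := oU w Uw.
  have e20 : 0 < e / 2 by lra.
  have [n Hn] : exists n : nat, n.+1%:R^-1 < e / 2.
    exists (Num.truncn (e / 2)^-1); rewrite invf_plt ?posrE//.
    exact: truncnS_gt.
  have [m Em] : exists m : R, m = n.+1%:R^-1 by eexists.
  have m0 : 0 < m by rewrite Em invr_gt0.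
  rewrite -Em in Hn.
  have lt_n (x : R) : x - m < x + m by move: m0; lra.
  have [a] := rat_in_itvoo (lt_n w.1); have [b] := rat_in_itvoo (lt_n w.2).
  rewrite !in_itv /= => /andP[b1 b2] /andP[a1 a2].
  exists a => //; exists b => //; exists n => //; rewrite /box -Em.
  rewrite asboolT; last first.
    move=> w' [/=]; rewrite !in_itv /= => /andP[? ?] /andP[? ?].
    by apply: He; rewrite ltr_norml; lra.
  by split; rewrite /= in_itv /=; apply/andP; split; lra.
apply: bigcupT_measurable_rat => a; apply: bigcupT_measurable_rat => b.
apply: bigcupT_measurable => n; case: ifP => // _.
exact: measurableX.
Qed.

Lemma measurable_fun_cont2 (A : set (R * R)) (h : R[i] -> R) : measurable A ->
  (forall w, A w -> forall e : R, 0 < e -> exists2 r : R, 0 < r &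
     forall z, normc (z - pt w) < r -> `|h z - h (pt w)| <= e) ->
  measurable_fun A (h \o pt).
Proof.
move=> mA H mA'; apply: (measurability _ (RGenOInfty.measurableE R)) => //.
move=> _ [_ [a ->] <-].
pose U := [set w : R * R | exists2 e : R, 0 < e &
    forall w', `|w'.1 - w.1| < e -> `|w'.2 - w.2| < e -> a < h (pt w')].
have -> : A `&` (h \o pt) @^-1` `]a, +oo[ = A `&` U.
  apply/seteqP; split=> [w [Aw]|w [Aw [e e0 He]]]; last first.
    by split=> //=; rewrite in_itv /= andbT; apply: He; rewrite subrr normr0.
  rewrite /= in_itv /= andbT => aw; split => //.
  have e0 : 0 < (h (pt w) - a) / 2 by rewrite divr_gt0 ?subr_gt0.
  have [r r0 Hr] := H w Aw _ e0; exists (r / 2); first by rewrite divr_gt0.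
  move=> w' w1 w2; have : normc (pt w' - pt w) < r.
    rewrite (le_lt_trans (normc_le_ReIm _))// ReDc ImDc ReNc ImNc /=; lra.
  by move=> /Hr; rewrite ler_norml => /andP[? ?]; lra.
apply: measurableI => //; apply: measurable_open2 => w [e e0 He].
exists (e / 2); first by rewrite divr_gt0.
move=> w' w1 w2; exists (e / 2); first by rewrite divr_gt0.
move=> v v1 v2; apply: He.
  have := ler_normD (v.1 - w'.1) (w'.1 - w.1); rewrite addrA subrK; lra.
have := ler_normD (v.2 - w'.2) (w'.2 - w.2); rewrite addrA subrK; lra.
Qed.

Lemma measurable_fun_cdiff2 (A : set (R * R)) (g : R[i] -> R[i]) (q : R[i] -> R) :
  measurable A -> cdiff_on (pt @` A) g ->
  (forall z z', `|q z - q z'| <= normc (z - z')) ->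
  measurable_fun A (fun w => q (g (pt w))).
Proof.
move=> mA Hg qB; apply: (@measurable_fun_cont2 A (q \o g)) => // w Aw e e0.
have [|d0 Hd] := Hg (pt w); first by exists w.
have [r r0 Hr] := has_cderiv_continuous Hd e0; exists r => // z /Hr.
by apply: le_trans; exact: qB.
Qed.

Definition disc2 : set (R * R) := [set w | disc R (w.1 +i* w.2)].

Lemma measurable_disc2 : measurable disc2.
Proof.
apply: measurable_open2 => w w1; have {}w1 : normc (pt w) < 1 := w1.
exists ((1 - normc (pt w)) / 2); first by rewrite divr_gt0 ?subr_gt0.
move=> w' h1 h2; suff : normc (pt w') < 1 by [].
rewrite -(subrK (pt w) (pt w')).
rewrite (le_lt_trans (le_normcD _ _))//.
have := normc_pt_sub w' w; lra.
Qed.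

Lemma measurable_csq2 z (r : R) : measurable [set w | csq z r (pt w)].
Proof.
have -> : [set w | csq z r (pt w)] =
    `[complex.Re z - r, complex.Re z + r] `*` `[complex.Im z - r, complex.Im z + r].
  by apply/seteqP; split => w; rewrite /csq /cbox /= !in_itv.
exact: measurableX.
Qed.

Definition plane_int (A : set (R * R)) (h : R[i] -> R) : \bar R :=
  (\int[mu2]_(w in A) (h (pt w))%:E)%E.

Lemma plane_tonelli (f : R * R -> \bar R) : measurable_fun setT f ->
  (forall w, (0 <= f w)%E) ->
  (\int[mu2]_w f w = \int[mu]_x \int[mu]_y f (x, y))%E /\
  (\int[mu2]_w f w = \int[mu]_y \int[mu]_x f (x, y))%E.
Proof.
move=> mf f0.
have E : (\int[mu2]_w f w = \int[mu]_x \int[mu]_y f (x, y))%E.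
  exact: (@fubini_tonelli1 _ _ _ _ R mu mu f mf f0).
split=> //; rewrite E; exact: (@fubini_tonelli _ _ _ _ R mu mu f mf f0).
Qed.

(** A function cannot exceed its average everywhere. This selects, among parallel
    segments, one along which a line integral is controlled by an area integral. *)
Lemma exists_le_average (rho : R -> \bar R) (u v I : R) : u < v ->
  measurable_fun `[u, v] rho -> (forall x, u <= x <= v -> (0 <= rho x)%E) ->
  (\int[mu]_(x in `[u, v]) rho x <= I%:E)%E ->
  forall e : R, 0 < e -> exists2 x, u <= x <= v & (rho x <= ((I + e) / (v - u))%:E)%E.
Proof.
move=> uv mrho rho0 HI e e0; apply: contrapT => N.
have vu : 0 < v - u by rewrite subr_gt0.
have I0 : 0 <= I.
  rewrite -lee_fin (le_trans _ HI)//; apply: integral_ge0 => x.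
  by rewrite /= in_itv; exact: rho0.
have : (\int[mu]_(x in `[u, v]) (cst ((I + e) / (v - u))%:E x) <= \int[mu]_(x in `[u, v]) rho x)%E.
  apply: ge0_le_integral => //.
  - move=> x _; rewrite lee_fin; apply: divr_ge0; last exact: ltW.
    by apply: addr_ge0 => //; exact: ltW.
  - move=> x; rewrite /= in_itv /= => xuv; rewrite leNgt; apply/negP => /ltW H.
    by apply: N; exists x.
rewrite integral_cst// => H; have := le_trans H HI.
rewrite [X in (_ * X)%E](_ : _ = (v - u)%:E); last by apply: lebesgue_segment; exact: ltW.
by rewrite -EFinM lee_fin divfK ?gt_eqF//; lra.
Qed.

Lemma EFin_Rintegral_segment (u v : R) (h : R -> R) : mu.-integrable `[u, v] (EFin \o h) ->
  (\int[mu]_(x in `[u, v]) h x)%:E = (\int[mu]_(x in `[u, v]) (h x)%:E)%E.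
Proof. by move=> H; rewrite /Rintegral fineK//; exact: integrable_fin_num. Qed.

Lemma cbdry_dist (a b c d s : R) z z' : a + s <= complex.Re z <= b - s ->
  c + s <= complex.Im z <= d - s -> cbdry a b c d z' -> s <= normc (z' - z).
Proof.
move=> /andP[w1 w2] /andP[w3 w4] [_].
have := normc_Re (z' - z); have := normc_Im (z' - z).
rewrite ReDc ImDc ReNc ImNc => I1 R1.
have := ler_norm (complex.Re z' - complex.Re z).
have := ler_norm (- (complex.Re z' - complex.Re z)).
have := ler_norm (complex.Im z' - complex.Im z).
have := ler_norm (- (complex.Im z' - complex.Im z)).
by rewrite !normrN => ? ? ? ?; case=> ?; lra.
Qed.

Lemma measurable_EFin2 (A : set (R * R)) (h : R * R -> R) :
  measurable_fun A h -> measurable_fun A (fun w => (h w)%:E).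
Proof. by move=> mh; exact: measurableT_comp. Qed.

Lemma measurable_powR2 (A : set (R * R)) (h : R * R -> R) (p : R) :
  measurable_fun A h -> measurable_fun A (fun w => h w `^ p).
Proof. by move=> mh; exact: (measurableT_comp (measurable_powR p)). Qed.

(** Each side of a rectangle about [z] is chosen by [exists_le_average] among the
    lines at distance between [r / 2] and [r] from [z]; the estimate from Cauchy's
    formula on that rectangle then only involves the area integral. *)
Lemma area_submean g z (r : R) : 0 < r -> cdiff_on (csq z r) g ->
  ((normc (g z))%:E <= (32 / r ^+ 2)%:E *
     plane_int [set w | csq z r (pt w)] (fun v => normc (g v))%R)%E.
Proof.
move=> r0 Hg; set Q := [set w | csq z r (pt w)]; set J := plane_int _ _.
have mQ : measurable Q := measurable_csq2 z r.
have mg : measurable_fun Q (fun w => normc (g (pt w))).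
  apply: measurable_fun_cdiff2 => //; last exact: normc_dist.
  by apply: cdiff_onW Hg => _ [w Qw <-].
pose f2 : R * R -> \bar R := (fun w => (normc (g (pt w)))%:E) \_ Q.
have mf2 : measurable_fun setT f2.
  by apply/(measurable_restrictT _ mQ); exact: measurable_EFin2.
have f20 w : (0 <= f2 w)%E by rewrite /f2 patchE; case: ifP => // _; rewrite lee_fin normc_ge0.
have JE : J = (\int[mu2]_w f2 w)%E by rewrite /J /plane_int integral_mkcond.
have J0 : (0 <= J)%E by rewrite JE; apply: integral_ge0.
have c0 : 0 < 32 / r ^+ 2 by rewrite divr_gt0// exprn_gt0.
have [->|Jfin] := eqVneq J +oo%E; first by rewrite gt0_muley ?lte_fin// leey.
have [j Ej] : exists j : R, J = j%:E.
  by exists (fine J); rewrite fineK// ge0_fin_numE// lt_neqAle Jfin leey.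
rewrite Ej -EFinM lee_fin.
(* integrals of |g| along vertical and horizontal lines *)
pose rho x := (\int[mu]_y f2 (x, y))%E; pose sig y := (\int[mu]_x f2 (x, y))%E.
have mrho : measurable_fun setT rho by exact: measurable_fun_fubini_tonelli_F.
have msig : measurable_fun setT sig by exact: measurable_fun_fubini_tonelli_G.
have rho0 x : (0 <= rho x)%E by apply: integral_ge0.
have sig0 x : (0 <= sig x)%E by apply: integral_ge0.
have Irho u v : (\int[mu]_(x in `[u, v]) rho x <= j%:E)%E.
  rewrite -Ej JE (plane_tonelli mf2 f20).1.
  by apply: ge0_subset_integral => //; exact: measurableT.
have Isig u v : (\int[mu]_(x in `[u, v]) sig x <= j%:E)%E.
  rewrite -Ej JE (plane_tonelli mf2 f20).2.
  by apply: ge0_subset_integral => //; exact: measurableT.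
apply/ler_addgt0Pr => e e0.
have e'0 : 0 < e * r ^+ 2 / 32 by rewrite divr_gt0// mulr_gt0// exprn_gt0.
have [a /andP[a1 a2] ra] := @exists_le_average rho (complex.Re z - r) (complex.Re z - r / 2) j
  ltac:(lra) (measurable_funTS mrho) (fun x _ => rho0 x) (Irho _ _) _ e'0.
have [b /andP[b1 b2] rb] := @exists_le_average rho (complex.Re z + r / 2) (complex.Re z + r) j
  ltac:(lra) (measurable_funTS mrho) (fun x _ => rho0 x) (Irho _ _) _ e'0.
have [c /andP[c1 c2] sc] := @exists_le_average sig (complex.Im z - r) (complex.Im z - r / 2) j
  ltac:(lra) (measurable_funTS msig) (fun x _ => sig0 x) (Isig _ _) _ e'0.
have [d /andP[d1 d2] sd] := @exists_le_average sig (complex.Im z + r / 2) (complex.Im z + r) j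
  ltac:(lra) (measurable_funTS msig) (fun x _ => sig0 x) (Isig _ _) _ e'0.
have sub : cbox a b c d `<=` csq z r.
  move=> v [/andP[v1 v2] /andP[v3 v4]]; split; apply/andP; split.
  - exact: le_trans v1.
  - exact: le_trans v2 _.
  - exact: le_trans v3.
  - exact: le_trans v4 _.
have HF := cdiff_onW sub Hg.
have s0 : 0 < r / 2 by rewrite divr_gt0.
have zab : a < complex.Re z < b by move: a2 b1 r0; clear; lra.
have zcd : c < complex.Im z < d by move: c2 d1 r0; clear; lra.
have dist v : cbdry a b c d v -> r / 2 <= normc (v - z).
  apply: cbdry_dist; first by move: a2 b1; clear; lra.
  by move: c2 d1; clear; lra.
have A := normc_center_le zab zcd HF s0 dist.
have ab : a <= b by move: a2 b1 r0; clear; lra.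
have cd : c <= d by move: c2 d1 r0; clear; lra.
have [C1 C2] := bdryH cd (cdiff_onW (@cbdry_sub _ _ _ _ _) HF).
have [C3 C4] := bdryV ab (cdiff_onW (@cbdry_sub _ _ _ _ _) HF).
set k := (j + e * r ^+ 2 / 32) / (r / 2).
have E1 : complex.Re z - r / 2 - (complex.Re z - r) = r / 2 by clear; lra.
have E2 : complex.Re z + r - (complex.Re z + r / 2) = r / 2 by clear; lra.
have E3 : complex.Im z - r / 2 - (complex.Im z - r) = r / 2 by clear; lra.
have E4 : complex.Im z + r - (complex.Im z + r / 2) = r / 2 by clear; lra.
rewrite E1 in ra; rewrite E2 in rb; rewrite E3 in sc; rewrite E4 in sd.
have V x : a <= x <= b -> ccont_on c d (fun y => g (x +i* y)) ->
    (rho x <= k%:E)%E -> \int[mu]_(y in `[c, d]) normc (g (x +i* y)) <= k.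
  move=> xab Cx rx; rewrite -lee_fin EFin_Rintegral_segment; last exact: integrable_normc.
  apply: le_trans rx; rewrite integral_mkcond; apply: ge0_le_integral => //.
  - by move=> y _; rewrite patchE; case: ifP => // _; rewrite lee_fin normc_ge0.
  - apply/(measurable_restrictT _ _).1 => //.
    by have /integrableP[] := integrable_normc Cx.
  - by apply: measurableT_comp => //; exact: pair1_measurable.
  - move=> y _; rewrite patchE; case: ifPn => [|_]; last exact: f20.
    rewrite inE /= in_itv /= => /andP[y1 y2]; rewrite /f2 patchE mem_set//.
    by apply: sub; split => //=; rewrite y1.
have H y : c <= y <= d -> ccont_on a b (fun x => g (x +i* y)) ->
    (sig y <= k%:E)%E -> \int[mu]_(x in `[a, b]) normc (g (x +i* y)) <= k.
  move=> ycd Cy ry; rewrite -lee_fin EFin_Rintegral_segment; last exact: integrable_normc.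
  apply: le_trans ry; rewrite integral_mkcond; apply: ge0_le_integral => //.
  - by move=> x _; rewrite patchE; case: ifP => // _; rewrite lee_fin normc_ge0.
  - apply/(measurable_restrictT _ _).1 => //.
    by have /integrableP[] := integrable_normc Cy.
  - by apply: measurableT_comp => //; exact: pair2_measurable.
  - move=> x _; rewrite patchE; case: ifPn => [|_]; last exact: f20.
    rewrite inE /= in_itv /= => /andP[x1 x2]; rewrite /f2 patchE mem_set//.
    by apply: sub; split => //=; rewrite x1.
have S : side_sum g a b c d <= 4 * k.
  have := H c _ C1 sc; have := H d _ C2 sd; have := V a _ C3 ra; have := V b _ C4 rb.
  rewrite !lexx ab cd => /(_ isT) S1 /(_ isT) S2 /(_ isT) S3 /(_ isT) S4.
  by rewrite /side_sum; move: S1 S2 S3 S4; clear; lra.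
apply: (le_trans A).
have -> : 32 / r ^+ 2 * j + e = 2 / (r / 2) * (4 * k).
  by rewrite /k; field; rewrite gt_eqF.
by apply: ler_wpM2l S; rewrite divr_ge0// ltW.
Qed.

(** Either [t <= A], or [t / A <= (t / A) `^ p]. *)
Lemma le_add_powR (p A t : R) : 1 <= p -> 0 < A -> 0 <= t ->
  t <= A + A `^ (1 - p) * t `^ p.
Proof.
move=> p1 A0 t0; have [tA|At] := leP t A.
  by rewrite (le_trans tA)// lerDl mulr_ge0 ?powR_ge0.
have tp : 0 < t by exact: lt_trans At.
apply: (@le_trans _ _ (A `^ (1 - p) * t `^ p)); last by rewrite lerDr ltW.
have -> : t `^ p = t `^ (p - 1) * t.
  by rewrite -{3}(powRr1 (ltW tp)) -powRD ?subrK// (gt_eqF tp) implybT.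
rewrite mulrA ler_peMl// (_ : A `^ (1 - p) = (A `^ (p - 1))^-1); last first.
  by rewrite -powRN opprB.
rewrite mulrC ler_pdivlMr ?powR_gt0// mul1r.
by apply: ge0_ler_powR; [rewrite subr_ge0|rewrite nnegrE ltW|rewrite nnegrE|exact: ltW].
Qed.

Lemma lebesgue_csq2 z (r : R) : 0 <= r ->
  mu2 [set w | csq z r (pt w)] = ((2 * r) ^+ 2)%:E.
Proof.
move=> r0; have -> : [set w | csq z r (pt w)] =
    `[complex.Re z - r, complex.Re z + r] `*` `[complex.Im z - r, complex.Im z + r].
  by apply/seteqP; split => w; rewrite /csq /cbox /= !in_itv.
rewrite product_measure1E//.
have E (x : R) : mu `[x - r, x + r] = (2 * r)%:E.
  by rewrite lebesgue_segment; [congr EFin; ring|lra].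
by rewrite [X in (X * _)%E]E [X in (_ * X)%E]E -EFinM expr2.
Qed.

(** [le_add_powR] is integrated with [A] so small a multiple of [normc (g z)] that
    the additive term is absorbed by the left-hand side. *)
Lemma submean_powR g z (r p : R) : 1 <= p -> 0 < r -> cdiff_on (csq z r) g ->
  ((normc (g z) `^ p)%:E <= (256 `^ p / r ^+ 2)%:E *
     plane_int [set w | csq z r (pt w)] (fun v => normc (g v) `^ p)%R)%E.
Proof.
move=> p1 r0 Hg; have p0 : 0 < p by exact: lt_le_trans p1.
(* an opaque name for the numeral keeps conversion from unfolding it *)
have [k kE] : exists k : R, k = 256 by exists 256.
have k0 : 0 < k by rewrite kE ltr0n.
rewrite -kE; set Q := [set w | csq z r (pt w)]; set t := normc (g z).
have [t0|tn0] := eqVneq t 0.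
  rewrite t0 powR0 ?gt_eqF// mule_ge0// ?lee_fin ?divr_ge0 ?powR_ge0 ?exprn_ge0 ?(ltW r0)//.
  by apply: integral_ge0 => w _; rewrite lee_fin powR_ge0.
have tp : 0 < t by rewrite lt_neqAle eq_sym tn0 normc_ge0.
pose A := t / k; have A0 : 0 < A by rewrite divr_gt0.
have := area_submean r0 Hg; rewrite -/t -/Q.
have mQ : measurable Q := measurable_csq2 z r.
have mg : measurable_fun Q (fun w => normc (g (pt w))).
  apply: measurable_fun_cdiff2 => //; last exact: normc_dist.
  by apply: cdiff_onW Hg => _ [w Qw <-].
have mgp : measurable_fun Q (fun w => normc (g (pt w)) `^ p).
  exact: measurable_powR2.
set J := plane_int Q (fun v => normc (g v) `^ p).
have J0 : (0 <= J)%E by apply: integral_ge0 => w _; rewrite lee_fin powR_ge0.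
have L : (plane_int Q (fun v => normc (g v)) <= (A * (2 * r) ^+ 2)%:E + (A `^ (1 - p))%:E * J)%E.
  apply: (@le_trans _ _ (\int[mu2]_(w in Q) (A%:E + (A `^ (1 - p))%:E * (normc (g (pt w)) `^ p)%:E))%E).
    apply: ge0_le_integral => //.
    - by move=> w _; rewrite lee_fin normc_ge0.
    - exact: measurable_EFin2.
    - apply: emeasurable_funD; first exact: measurable_cst.
      by apply: emeasurable_funM; [exact: measurable_cst|exact: measurable_EFin2].
    - by move=> w _; rewrite -EFinM -EFinD lee_fin le_add_powR// normc_ge0.
  rewrite ge0_integralD//; last 3 first.
  - by move=> w _; rewrite lee_fin ltW.
  - by move=> w _; rewrite -EFinM lee_fin mulr_ge0 ?powR_ge0.
  - by apply: emeasurable_funM; [exact: measurable_cst|exact: measurable_EFin2].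
  rewrite integral_cst// [X in (_ * X + _)%E](_ : _ = ((2 * r) ^+ 2)%:E); last first.
    by apply: lebesgue_csq2; exact: ltW.
  rewrite -EFinM leeD2l//.
  rewrite ge0_integralZl//; first exact: measurable_EFin2.
  - by move=> w _; rewrite lee_fin powR_ge0.
  - by rewrite lee_fin powR_ge0.
have c0 : 0 < 32 / r ^+ 2 by rewrite divr_gt0// exprn_gt0.
move=> /le_trans /(_ (lee_wpmul2l _ L)); rewrite lee_fin (ltW c0) => /(_ isT).
have [->|Jfin] := eqVneq J +oo%E.
  by move=> _; rewrite gt0_muley ?leey// lte_fin divr_gt0 ?powR_gt0 ?exprn_gt0.
have [j Ej] : exists j : R, J = j%:E.
  by exists (fine J); rewrite fineK// ge0_fin_numE// lt_neqAle Jfin leey.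
rewrite Ej -[((A `^ (1 - p))%:E * _)%E]EFinM -EFinD -!EFinM !lee_fin => B.
have j0 : 0 <= j by rewrite -lee_fin -Ej.
have tE : t = A * k by rewrite /A divfK// gt_eqF.
have AE : A `^ (1 - p) = A / A `^ p.
  by rewrite powRB ?(gt_eqF A0) ?implybT// powRr1 ?ltW.
have X0 : 0 < A `^ p by rewrite powR_gt0.
have {}B : 4 * A `^ p <= j / r ^+ 2.
  have E : 32 / r ^+ 2 * (A * (2 * r) ^+ 2 + A `^ (1 - p) * j) =
      128 * A + 32 * A / A `^ p * (j / r ^+ 2).
    by rewrite AE; field; rewrite !gt_eqF.
  have {}B : 128 * A <= 32 * A / A `^ p * (j / r ^+ 2).
    by move: B; rewrite E tE kE; clear; lra.
  rewrite -(ler_pM2l (_ : 0 < 32 * A / A `^ p)); last by rewrite divr_gt0// mulr_gt0.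
  by rewrite (_ : _ * (4 * _) = 128 * A)//; field; rewrite gt_eqF.
rewrite tE powRM ?(ltW A0) ?(ltW k0)// mulrC.
have -> : k `^ p / r ^+ 2 * j = k `^ p * (j / r ^+ 2) by rewrite mulrAC mulrA.
rewrite ler_wpM2l ?powR_ge0//.
by apply: le_trans B; rewrite ler_peMl ?(ltW X0)//; clear; lra.
Qed.

End PlaneMeasure.

(** * The reproducing estimate, and complex powers *)

Section Reproducing.
Context {R : realType}.
Implicit Types (g : R[i] -> R[i]) (z : R[i]).

Definition kernelq (q : R) (w z : R[i]) : R :=
  (1 - normc w ^+ 2) `^ (q - 2) / normc (1 - w^*%C * z) `^ q.

Lemma normc1B_ge z (w : R[i]) : normc w < 1 -> 1 - normc z <= normc (1 - w^*%C * z).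
Proof.
move=> w1; have := ler_normcB 1 (w^*%C * z); rewrite normc1 normcM normc_conj.
by apply: le_trans; rewrite lerD2l lerN2 ler_piMl ?normc_ge0// ltW.
Qed.

Lemma normc1B_gt0 z (w : R[i]) : normc w < 1 -> normc z < 1 -> 0 < normc (1 - w^*%C * z).
Proof. by move=> w1 z1; rewrite (lt_le_trans _ (normc1B_ge _ w1))// subr_gt0. Qed.

Lemma kernelq_ge0 q w z : 0 <= kernelq q w z.
Proof. by rewrite divr_ge0 ?powR_ge0. Qed.

Lemma conjc_normc2 (w : R[i]) : w^*%C * w = (normc w ^+ 2)%:C.
Proof. by case: w => a b; apply: complexP; rewrite ?ReMc ?ImMc normc_sqr /=; ring. Qed.

Lemma csq_normc z (r : R) w : csq z r w -> normc (w - z) <= 2 * r.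
Proof.
move=> [/andP[? ?] /andP[? ?]]; rewrite (le_trans (normc_le_ReIm _))// ReDc ImDc ReNc ImNc.
have : `|complex.Re w - complex.Re z| <= r by rewrite ler_norml; apply/andP; split; lra.
have : `|complex.Im w - complex.Im z| <= r by rewrite ler_norml; apply/andP; split; lra.
lra.
Qed.

Lemma holomorphic_on g (A : set R[i]) : holomorphic g -> A `<=` disc R -> cdiff_on A g.
Proof. by move=> /holomorphicP Hg sub z /sub/Hg; exists (cderiv g z). Qed.

Lemma csq_disc z (r : R) : r <= (1 - normc z) / 4 -> normc z < 1 -> csq z r `<=` disc R.
Proof.
move=> rz z1 w /csq_normc wz; rewrite /disc /= -(subrK z w).
by rewrite (le_lt_trans (le_normcD _ _))//; lra.
Qed.

(** On a square about [z] whose side is comparable with [1 - |z|], the quantities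
    [1 - |w|^2], [1 - |z|] and [|1 - conj w z|] are all comparable. *)
Lemma kernelq_ge q z w : 2 <= q -> normc z < 1 ->
  csq z ((1 - normc z) / 4) w ->
  (10 `^ q)^-1 / ((1 - normc z) / 4) ^+ 2 <= kernelq q w z.
Proof.
move=> q2 z1 Hw; set r := (1 - normc z) / 4.
have r0 : 0 < r by rewrite divr_gt0 ?subr_gt0.
have wz := csq_normc Hw; rewrite -/r in wz.
have q0 : 0 <= q by exact: le_trans q2.
have w1 : r <= 1 - normc w ^+ 2.
  have : normc w <= normc z + 2 * r.
    by rewrite -(subrK z w) (le_trans (le_normcD _ _))//; lra.
  have := normc_ge0 w; rewrite /r => ? ?; nra.
have zw : normc (1 - w^*%C * z) <= 10 * r.
  have -> : 1 - w^*%C * z = (1 - normc z ^+ 2)%:C + (z^*%C * z - w^*%C * z).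
    by rewrite conjc_normc2 rmorphB /= addrA subrK.
  rewrite (le_trans (le_normcD _ _))// normcR -mulrBl -rmorphB normcM normc_conj.
  rewrite normc_distC ger0_norm; last by have := normc_ge0 z; nra.
  have : normc (w - z) * normc z <= 2 * r.
    by rewrite (le_trans _ wz)// ler_piMr ?normc_ge0// ltW.
  have : 1 - normc z ^+ 2 <= 8 * r by rewrite /r; have := normc_ge0 z; nra.
  lra.
have zw0 : 0 < normc (1 - w^*%C * z).
  by apply: normc1B_gt0 => //; apply: (csq_disc (r := r)) Hw.
rewrite /kernelq -invfM.
have -> : (10 `^ q * r ^+ 2)^-1 = r `^ (q - 2) / (10 * r) `^ q.
  rewrite [(10 * r) `^ q]powRM ?(ltW r0)// [r `^ (q - 2)]powRB ?(gt_eqF r0) ?implybT//.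
  rewrite (powR_mulrn 2 (ltW r0)).
  have P1 : 10 `^ q != 0 :> R by rewrite gt_eqF ?powR_gt0.
  have P2 : r `^ q != 0 by rewrite gt_eqF ?powR_gt0.
  by field; rewrite P1 P2 gt_eqF.
apply: ler_pM; rewrite ?powR_ge0 ?invr_ge0 ?powR_ge0//.
  have w0 : 0 <= 1 - normc w ^+ 2 := le_trans (ltW r0) w1.
  by apply: ge0_ler_powR; [rewrite subr_ge0|rewrite nnegrE (ltW r0)|rewrite nnegrE|].
have r10 : 0 < 10 * r by rewrite mulr_gt0.
rewrite lef_pV2 ?posrE ?powR_gt0 ?r10//.
by apply: ge0_ler_powR; rewrite ?nnegrE ?normc_ge0// (ltW r10).
Qed.

Lemma measurable_normc_disc g (q : R[i] -> R) : holomorphic g ->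
  (forall z z', `|q z - q z'| <= normc (z - z')) ->
  measurable_fun (@disc2 R) (fun w => q (g (pt w))).
Proof.
move=> Hg qB; apply: (@measurable_fun_cdiff2 _ (@disc2 R) g q) => //.
  exact: measurable_disc2.
by apply: holomorphic_on => // _ [w Dw <-].
Qed.

Lemma holomorphic_id : holomorphic (id : R[i] -> R[i]).
Proof. by apply/holomorphicP => z _; rewrite (cderivE (has_cderiv_id z)); exact: has_cderiv_id. Qed.

Lemma holomorphic_kernel z : holomorphic (fun w => 1 - z * w).
Proof.
move=> w _; have : has_cderiv (fun w => 1 - z * w) w (- z).
  have := has_cderiv_affine w (- z) 1; apply: (@has_cderiv_near _ _ _ _ _ 1) => // v _.
  by rewrite mulNr addrC.
by move=> /has_cderiv_derive[].
Qed.

Lemma measurable_kernelq q z : measurable_fun (@disc2 R) (fun w => kernelq q (pt w) z).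
Proof.
rewrite /kernelq (_ : (fun w => _) = (fun w => (1 - normc (pt w) ^+ 2) `^ (q - 2) *
    normc (1 - (pt w)^*%C * z) `^ (- q))); last by apply/funext => w; rewrite powRN.
apply: measurable_funM.
  apply: measurable_powR2; apply: measurable_funB => //.
  by apply: measurable_funX; apply: measurable_normc_disc holomorphic_id _; exact: normc_dist.
apply: measurable_powR2.
rewrite (_ : (fun w => _) = (fun w => normc (1 - z^*%C * pt w))).
  exact: (measurable_normc_disc (@holomorphic_kernel z^*%C) normc_dist).
apply/funext => w; rewrite -[LHS]normc_conj; congr normc.
by case: (pt w) z => a b [c d]; apply: complexP; rewrite /= ?oppr0 ?opprK /=; ring.
Qed.

(** The sub-mean value property on a square whose side is comparable with
    [1 - |z|]: there the kernel exceeds a multiple of the inverse of the area, by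
    [kernelq_ge], and the integral may be enlarged to the disc. The kernel is what
    the test functions of the criteria produce, which is why it is preferred to
    the indicator of the square. *)
Lemma reproducing_estimate g (p q : R) z : 1 <= p -> 2 <= q -> holomorphic g -> disc R z ->
  ((normc (g z) `^ p)%:E <= (256 `^ p * 10 `^ q)%:E *
    plane_int (@disc2 R) (fun w => (kernelq q w z * normc (g w) `^ p)%R))%E.
Proof.
move=> p1 q2 Hg z1; have {}z1 : normc z < 1 := z1.
pose r := (1 - normc z) / 4; have r0 : 0 < r by rewrite divr_gt0 ?subr_gt0.
have sub : csq z r `<=` disc R by apply: csq_disc.
apply: (le_trans (submean_powR p1 r0 (holomorphic_on Hg sub))).
rewrite [X in (X%:E * _)%E](_ : _ = 256 `^ p * 10 `^ q * ((10 `^ q)^-1 / r ^+ 2)); last first.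
  have P : 10 `^ q != 0 :> R by rewrite gt_eqF ?powR_gt0.
  by field; rewrite P gt_eqF.
rewrite EFinM -muleA lee_wpmul2l ?lee_fin ?mulr_ge0 ?powR_ge0//.
have mp : measurable_fun (@disc2 R) (fun w => normc (g (pt w)) `^ p).
  by apply: measurable_powR2; apply: measurable_normc_disc Hg _; exact: normc_dist.
have mkp : measurable_fun (@disc2 R) (fun w => kernelq q (pt w) z * normc (g (pt w)) `^ p).
  by apply: measurable_funM mp; exact: measurable_kernelq.
have mQ := measurable_csq2 z r.
have mD := @measurable_disc2 R.
have subD : [set w | csq z r (pt w)] `<=` @disc2 R by move=> w /sub.
have c0 : 0 <= (10 `^ q)^-1 / r ^+ 2 by rewrite mulr_ge0 ?invr_ge0 ?powR_ge0 ?exprn_ge0 ?(ltW r0).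
rewrite -ge0_integralZl_EFin//; last 2 first.
- by move=> w _; rewrite lee_fin powR_ge0.
- by apply: measurable_EFin2; exact: measurable_funS mp.
apply: (@le_trans _ _ (plane_int [set w | csq z r (pt w)] (fun w => (kernelq q w z * normc (g w) `^ p)%R))).
  apply: ge0_le_integral => //.
  - by move=> w _; rewrite -EFinM lee_fin mulr_ge0 ?powR_ge0.
  - apply: emeasurable_funM => //; apply: measurable_EFin2; exact: measurable_funS mp.
  - by apply: measurable_EFin2; exact: measurable_funS mkp.
  - move=> w Qw; rewrite -EFinM lee_fin ler_wpM2r ?powR_ge0//.
    exact: kernelq_ge.
apply: ge0_subset_integral => //; first exact: measurable_EFin2.
by move=> w _; rewrite lee_fin mulr_ge0 ?powR_ge0// kernelq_ge0.
Qed.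

End Reproducing.

Section ComplexPower.
Context {R : realType}.
Implicit Types (F : R[i] -> R[i]) (z w : R[i]).

Lemma mvt_bound (f f' : R -> R) (a h k M : R) :
  (forall t, `|t - a| <= `|h| -> is_derive t 1 f (f' t)) ->
  (forall t, `|t - a| <= `|h| -> `|f' t - k| <= M) ->
  `|f (a + h) - f a - k * h| <= M * `|h|.
Proof.
move=> D B.
have key x y : x < y -> (forall t, x <= t <= y -> `|t - a| <= `|h|) ->
    `|f y - f x - k * (y - x)| <= M * (y - x).
  move=> xy I; have [||c cxy ->] := @MVT R f f' x y xy.
  - by move=> t; rewrite in_itv /= => /andP[/ltW ? /ltW ?]; apply: D; apply: I; apply/andP.
  - apply: derivable_within_continuous => t; rewrite in_itv /= => txy.
    by have [] := D t (I t txy).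
  rewrite -mulrBl normrM (@ger0_norm _ (y - x)) ?subr_ge0 ?(ltW xy)//.
  rewrite ler_wpM2r ?subr_ge0 ?(ltW xy)// B// I//.
  by move: cxy; rewrite in_itv /= => /andP[/ltW -> /ltW ->].
have [h0|h0|->] := ltgtP h 0; last by rewrite addr0 mulr0 subr0 subrr normr0 mulr0.
- rewrite (ltr0_norm h0) in key *; have lt : a + h < a by move: h0; clear; lra.
  have := key _ _ lt; rewrite opprD addrA subrr add0r mulrN opprK => H.
  rewrite -normrN [X in `|X|](_ : _ = f a - f (a + h) + k * h); last by ring.
  apply: H => t /andP[t1 t2].
  by rewrite ler_norml; apply/andP; split; move: t1 t2 h0; clear; lra.
- rewrite (gtr0_norm h0) in key *; have lt : a < a + h by move: h0; clear; lra.
  have := key _ _ lt; rewrite [a + h]addrC addrK => H.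
  apply: H => t /andP[t1 t2].
  by rewrite ler_norml; apply/andP; split; move: t1 t2 h0; clear; lra.
Qed.

(** Continuous partial derivatives subject to the Cauchy-Riemann equations: one
    moves from [z] first horizontally and then vertically, with the mean value
    theorem on each leg. *)
Lemma has_cderiv_partial F (D : R[i] -> R[i]) z (r : R) : 0 < r ->
  (forall x y : R, normc (x +i* y - z) < r ->
     [/\ is_derive x 1 (fun s => complex.Re (F (s +i* y))) (complex.Re (D (x +i* y))),
         is_derive x 1 (fun s => complex.Im (F (s +i* y))) (complex.Im (D (x +i* y))),
         is_derive y 1 (fun s => complex.Re (F (x +i* s))) (- complex.Im (D (x +i* y))) &
         is_derive y 1 (fun s => complex.Im (F (x +i* s))) (complex.Re (D (x +i* y)))]) ->
  (forall e : R, 0 < e -> exists2 r : R, 0 < r &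
     forall w, normc (w - z) < r -> normc (D w - D z) <= e) ->
  has_cderiv F z (D z).
Proof.
move=> r0 HD HC e e0; have e4 : 0 < e / 4 by lra.
have [s s0 Hs] := HC _ e4.
exists (Num.min (r / 2) (s / 2)); first by rewrite lt_min !divr_gt0.
case: z r0 HD HC s0 Hs => x y r0 HD HC s0 Hs [h k]; set n := normc (h +i* k).
rewrite lt_min => /andP[nr ns].
have hn : `|h| <= n by exact: (normc_Re (h +i* k)).
have kn : `|k| <= n by exact: (normc_Im (h +i* k)).
have near (u v : R) : `|u - x| <= `|h| -> `|v - y| <= `|k| ->
    normc (u +i* v - (x +i* y)) < r /\ normc (D (u +i* v) - D (x +i* y)) <= e / 4.
  move=> ux vy.
  have A : normc (u +i* v - (x +i* y)) <= n + n.
    by rewrite (le_trans (normc_le_ReIm _))//= lerD//; apply: le_trans hn + apply: le_trans kn.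
  by split; [lra|apply: Hs; lra].
rewrite -[x +i* y + (h +i* k)]/((x + h) +i* (y + k)).
set d := D (x +i* y) in near *.
have H1 : `|complex.Re (F ((x + h) +i* y)) - complex.Re (F (x +i* y)) - complex.Re d * h| <= e / 4 * `|h|.
  apply: (@mvt_bound (fun s => complex.Re (F (s +i* y))) (fun s => complex.Re (D (s +i* y)))).
    by move=> t th; have [A _] := near t y th ltac:(by rewrite subrr normr0); have [] := HD _ _ A.
  move=> t th; have [_ B] := near t y th ltac:(by rewrite subrr normr0).
  exact: le_trans (Re_dist _ _) B.
have H2 : `|complex.Im (F ((x + h) +i* y)) - complex.Im (F (x +i* y)) - complex.Im d * h| <= e / 4 * `|h|.
  apply: (@mvt_bound (fun s => complex.Im (F (s +i* y))) (fun s => complex.Im (D (s +i* y)))).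
    by move=> t th; have [A _] := near t y th ltac:(by rewrite subrr normr0); have [] := HD _ _ A.
  move=> t th; have [_ B] := near t y th ltac:(by rewrite subrr normr0).
  exact: le_trans (Im_dist _ _) B.
have xh : `|x + h - x| <= `|h| by rewrite [x + h]addrC addrK.
have H3 : `|complex.Re (F ((x + h) +i* (y + k))) - complex.Re (F ((x + h) +i* y)) - (- complex.Im d) * k| <= e / 4 * `|k|.
  apply: (@mvt_bound (fun s => complex.Re (F ((x + h) +i* s))) (fun s => - complex.Im (D ((x + h) +i* s)))).
    by move=> t th; have [A _] := near (x + h) t xh th; have [] := HD _ _ A.
  move=> t th; have [_ B] := near (x + h) t xh th.
  by rewrite -opprD normrN; exact: le_trans (Im_dist _ _) B.
have H4 : `|complex.Im (F ((x + h) +i* (y + k))) - complex.Im (F ((x + h) +i* y)) - complex.Re d * k| <= e / 4 * `|k|.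
  apply: (@mvt_bound (fun s => complex.Im (F ((x + h) +i* s))) (fun s => complex.Re (D ((x + h) +i* s)))).
    by move=> t th; have [A _] := near (x + h) t xh th; have [] := HD _ _ A.
  move=> t th; have [_ B] := near (x + h) t xh th.
  exact: le_trans (Re_dist _ _) B.
apply: (le_trans (normc_le_ReIm _)).
have hn' := ler_wpM2l (ltW e4) hn; have kn' := ler_wpM2l (ltW e4) kn.
have -> : complex.Re (F ((x + h) +i* (y + k)) - F (x +i* y) - d * (h +i* k)) =
    complex.Re (F ((x + h) +i* (y + k))) - complex.Re (F (x +i* y)) -
    (complex.Re d * h - complex.Im d * k).
  by rewrite !ReDc !ReNc (ReMc d).
have -> : complex.Im (F ((x + h) +i* (y + k)) - F (x +i* y) - d * (h +i* k)) =
    complex.Im (F ((x + h) +i* (y + k))) - complex.Im (F (x +i* y)) -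
    (complex.Re d * k + complex.Im d * h).
  by rewrite !ImDc !ImNc (ImMc d).
have -> : complex.Re (F ((x + h) +i* (y + k))) - complex.Re (F (x +i* y)) - (complex.Re d * h - complex.Im d * k) =
  (complex.Re (F ((x + h) +i* y)) - complex.Re (F (x +i* y)) - complex.Re d * h) +
  (complex.Re (F ((x + h) +i* (y + k))) - complex.Re (F ((x + h) +i* y)) - (- complex.Im d) * k) by ring.
have -> : complex.Im (F ((x + h) +i* (y + k))) - complex.Im (F (x +i* y)) - (complex.Re d * k + complex.Im d * h) =
  (complex.Im (F ((x + h) +i* y)) - complex.Im (F (x +i* y)) - complex.Im d * h) +
  (complex.Im (F ((x + h) +i* (y + k))) - complex.Im (F ((x + h) +i* y)) - complex.Re d * k) by ring.
apply: (le_trans (lerD (ler_normD _ _) (ler_normD _ _))); lra.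
Qed.

Definition cexp z : R[i] := (expR (complex.Re z))%:C * (cos (complex.Im z) +i* sin (complex.Im z)).

Lemma cexpE (x y : R) : cexp (x +i* y) = (expR x * cos y) +i* (expR x * sin y).
Proof. by apply: complexP; rewrite /cexp ?(ReMc, ImMc) /= mul0r ?subr0 ?addr0. Qed.

Lemma normc_cexp z : normc (cexp z) = expR (complex.Re z).
Proof.
case: z => x y; rewrite /cexp normcM normcR ger0_norm ?expR_ge0//=.
by rewrite cos2Dsin2 sqrtr1 mulr1.
Qed.

Lemma Re_cexp z : complex.Re (cexp z) = expR (complex.Re z) * cos (complex.Im z).
Proof. by case: z => x y; rewrite cexpE. Qed.

Lemma Im_cexp z : complex.Im (cexp z) = expR (complex.Re z) * sin (complex.Im z).
Proof. by case: z => x y; rewrite cexpE. Qed.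

Lemma continuous_ReIm (f : R[i] -> R[i]) z :
  (forall e : R, 0 < e -> exists2 r : R, 0 < r & forall w, normc (w - z) < r ->
     `|complex.Re (f w) - complex.Re (f z)| <= e /\ `|complex.Im (f w) - complex.Im (f z)| <= e) ->
  forall e : R, 0 < e -> exists2 r : R, 0 < r & forall w, normc (w - z) < r ->
     normc (f w - f z) <= e.
Proof.
move=> H e e0; have [|r r0 Hr] := H (e / 2); first by rewrite divr_gt0.
exists r => // w /Hr[A B]; rewrite (le_trans (normc_le_ReIm _))// !(ReDc, ImDc, ReNc, ImNc); lra.
Qed.

Lemma continuous_ebound (f : R -> R) (a : R) : {for a, continuous f} ->
  forall e : R, 0 < e -> exists2 r : R, 0 < r & forall b, `|b - a| < r -> `|f b - f a| <= e.
Proof.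
move=> /cvgrPdist_le cf e e0; have /nbhs_normP[r /= r0 Hr] := cf e e0.
exists r => // b ba; rewrite distrC; apply: Hr.
by rewrite /ball_ /= distrC.
Qed.

Lemma has_cderiv_cexp z : has_cderiv cexp z (cexp z).
Proof.
apply: (@has_cderiv_partial cexp cexp z 1 ltr01) => [x y _|].
  rewrite !cexpE /=.
  have E1 : (fun s : R => complex.Re (cexp (s +i* y))) = (fun s => expR s * cos y).
    by apply/funext => s; rewrite Re_cexp.
  have E2 : (fun s : R => complex.Im (cexp (s +i* y))) = (fun s => expR s * sin y).
    by apply/funext => s; rewrite Im_cexp.
  have E3 : (fun s : R => complex.Re (cexp (x +i* s))) = (fun s => expR x * cos s).
    by apply/funext => s; rewrite Re_cexp.
  have E4 : (fun s : R => complex.Im (cexp (x +i* s))) = (fun s => expR x * sin s).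
    by apply/funext => s; rewrite Im_cexp.
  rewrite E1 E2 E3 E4; split; apply: is_derive_eq; rewrite /GRing.scale /=; ring.
have bd : exists2 r : R, 0 < r & forall w, normc (w - z) < r -> normc (cexp w) <= expR (complex.Re z + 1).
  exists 1 => // w wz; rewrite normc_cexp ler_expR.
  have := normc_Re (w - z); rewrite ReDc ReNc ler_norml => /andP[_]; lra.
apply: continuous_ReIm => e e0.
have c0 : 0 < e / 2 / (expR (complex.Re z) + 1).
  by rewrite !divr_gt0// addr_gt0// expR_gt0.
have d0 : 0 < Num.min (e / 2) 1 by rewrite lt_min ltr01 andbT divr_gt0.
have [r1 r10 H1] := continuous_ebound (@continuous_expR R (complex.Re z)) d0.
have [r2 r20 H2] := continuous_ebound (@continuous_cos R (complex.Im z)) c0.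
have [r3 r30 H3] := continuous_ebound (@continuous_sin R (complex.Im z)) c0.
exists (Num.min r1 (Num.min r2 r3)); first by rewrite !lt_min r10 r20.
move=> w; rewrite !lt_min => /and3P[w1 w2 w3].
have dR : `|complex.Re w - complex.Re z| <= normc (w - z) by exact: Re_dist.
have dI : `|complex.Im w - complex.Im z| <= normc (w - z) by exact: Im_dist.
have A := H1 _ (le_lt_trans dR w1); have B := H2 _ (le_lt_trans dI w2).
have C := H3 _ (le_lt_trans dI w3).
move: A; rewrite le_min => /andP[A _].
have key (u v u' v' : R) : `|u| <= 1 -> `|v' - v| <= e / 2 -> 0 <= v ->
    `|u - u'| <= e / 2 / (v + 1) -> `|v' * u - v * u'| <= e.
  move=> u1 vv v0 uu.
  have -> : v' * u - v * u' = (v' - v) * u + v * (u - u') by ring.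
  rewrite (le_trans (ler_normD _ _))// !normrM (ger0_norm v0).
  have X : `|v' - v| * `|u| <= e / 2.
    by rewrite (le_trans _ vv)// ler_piMr.
  have v1 : 0 < v + 1 by move: v0; clear; lra.
  have Y : v * `|u - u'| <= e / 2.
    rewrite (le_trans (ler_wpM2l v0 uu))// mulrCA ler_piMr ?ltW ?divr_gt0//.
    by rewrite ltr_pdivrMr// mul1r ltrDl.
  by move: X Y; clear; lra.
have cos1 (t : R) : `|cos t| <= 1 by rewrite ler_norml cos_geN1 cos_le1.
have sin1 (t : R) : `|sin t| <= 1 by rewrite ler_norml sin_geN1 sin_le1.
by rewrite !Re_cexp !Im_cexp; split; apply: key => //; exact: expR_ge0.
Qed.

(** The logarithm of the right half-plane, where the principal argument is an
    arctangent. This half-plane suffices, since [1 - conj lambda z] stays in it. *)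
Definition clog z : R[i] :=
  (2^-1 * ln (complex.Re z ^+ 2 + complex.Im z ^+ 2)) +i* atan (complex.Im z / complex.Re z).

Lemma inv_complexE (s t : R) : 0 < s ^+ 2 + t ^+ 2 -> (s +i* t : R[i])^-1 =
  (s / (s ^+ 2 + t ^+ 2)) +i* (- t / (s ^+ 2 + t ^+ 2)).
Proof.
move=> st; have st0 : s ^+ 2 + t ^+ 2 != 0 by rewrite gt_eqF.
have nz : (s +i* t : R[i]) != 0.
  by apply: contraNneq st0; case=> -> ->; rewrite expr0n addr0.
apply: (mulfI nz); rewrite divff//.
by apply: complexP; rewrite ?ReMc ?ImMc /=; field; exact: st0.
Qed.

Lemma has_cderiv_clog z : 0 < complex.Re z -> has_cderiv clog z z^-1.
Proof.
move=> z0; apply: (@has_cderiv_partial clog GRing.inv z (complex.Re z)) => //.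
  move=> x y zr; have x0 : 0 < x.
    have := normc_Re (x +i* y - z); rewrite ReDc ReNc /= ler_norml => /andP[? _]; lra.
  have n0 : 0 < x ^+ 2 + y ^+ 2 by rewrite ltr_pwDl ?sqr_ge0// exprn_gt0.
  have n00 := lt0r_neq0 n0; have x00 := lt0r_neq0 x0.
  rewrite inv_complexE// /clog /=.
  have D1 : is_derive x 1 (fun s : R => s ^+ 2 + y ^+ 2) (2 * x).
    by apply: is_derive_eq; rewrite /GRing.scale /=; ring.
  have D2 : is_derive y 1 (fun s : R => x ^+ 2 + s ^+ 2) (2 * y).
    by apply: is_derive_eq; rewrite /GRing.scale /=; ring.
  have D3 : is_derive x 1 (fun s : R => y / s) (- y / x ^+ 2).
    have V : is_derive x 1 (fun s : R => s^-1) (- x ^- 2 *: 1) by exact: is_deriveV.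
    rewrite (_ : (fun s : R => y / s) = (fun s : R => y *: (s^-1)))//.
    by apply: is_derive_eq; rewrite /GRing.scale /=; field.
  have D4 : is_derive y 1 (fun s : R => s / x) x^-1.
    rewrite (_ : (fun s : R => s / x) = (fun s : R => x^-1 *: s)).
      by apply: is_derive_eq; rewrite /GRing.scale /= mulr1.
    by apply/funext => s; rewrite mulrC.
  have L := is_derive1_ln n0.
  have T := is_derive1_atan (y / x).
  have TE : (1 + (y / x) ^+ 2)^-1 = x ^+ 2 / (x ^+ 2 + y ^+ 2).
    by rewrite -[LHS]invrK -[RHS]invrK invrK invf_div; congr (_^-1); field.
  rewrite TE in T; split.
  - have C := @is_derive1_comp R (@ln R) (fun s : R => s ^+ 2 + y ^+ 2) x _ _ L D1.
    rewrite (_ : (fun s : R => _) = (fun s : R => 2^-1 *: ((@ln R \o (fun s : R => s ^+ 2 + y ^+ 2)) s)))//.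
    by apply: is_derive_eq; rewrite /GRing.scale /=; field.
  - have C := @is_derive1_comp R (@atan R) (fun s : R => y / s) x _ _ T D3.
    by have := C; congr (is_derive _ _ _ _); field; rewrite n00 x00.
  - have C := @is_derive1_comp R (@ln R) (fun s : R => x ^+ 2 + s ^+ 2) y _ _ L D2.
    rewrite (_ : (fun s : R => _) = (fun s : R => 2^-1 *: ((@ln R \o (fun s : R => x ^+ 2 + s ^+ 2)) s)))//.
    by apply: is_derive_eq; rewrite /GRing.scale /=; field.
  - have C := @is_derive1_comp R (@atan R) (fun s : R => s / x) y _ _ T D4.
    by have := C; congr (is_derive _ _ _ _); field; rewrite n00 x00.
apply: has_cderiv_continuous; apply: has_cderivV.
by apply: contraTneq z0 => ->; rewrite ltxx.
Qed.

Lemma normc_Repos w : 0 < complex.Re w ->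
  normc w = complex.Re w * Num.sqrt (1 + (complex.Im w / complex.Re w) ^+ 2).
Proof.
case: w => x y /= x0.
rewrite -{2}(ger0_norm (ltW x0)) -sqrtr_sqr -sqrtrM ?sqr_ge0//; congr Num.sqrt.
by field; rewrite gt_eqF.
Qed.

Lemma carg_atan w : 0 < complex.Re w -> carg w = atan (complex.Im w / complex.Re w).
Proof.
move=> w0; rewrite /carg; set u := complex.Im w / complex.Re w.
have E : complex.Re w / normc w = cos (atan u).
  rewrite normc_Repos// cos_atan -/u invfM mulrA divff ?mul1r// gt_eqF//.
have p2 : pi / 2 < pi :> R by have := pi_gt0 R; lra.
have [a1 a2] := (atan_gtNpi2 u, atan_ltpi2 u).
case: ifPn => y0.
  rewrite E cosK// in_itv /=; apply/andP; split; last exact: ltW (lt_trans a2 p2).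
  by rewrite -atan0 le_atan// divr_ge0// ltW.
rewrite E cosKN ?opprK//; apply/andP; split; first by move: a1 p2; clear; lra.
by rewrite -atan0 le_atan// mulr_le0_ge0 ?invr_ge0 ?(ltW w0)// ltW// ltNge.
Qed.

Lemma cpow_cexp w (s : R) : 0 < complex.Re w -> cpow w s = cexp (s%:C * clog w).
Proof.
move=> w0; have nw0 : 0 < normc w.
  by rewrite (lt_le_trans w0)// (le_trans (ler_norm _))// normc_Re.
have E : s%:C * clog w = (s * ln (normc w)) +i* (s * carg w).
  rewrite carg_atan//; apply: complexP; rewrite /clog ?ReMc ?ImMc /= mul0r ?subr0 ?addr0//.
  by rewrite -normc_sqr lnXn// mulr2n; congr (_ * _); field.
by rewrite E cexpE /cpow /powR gt_eqF//; apply: complexP; rewrite ?ReMc ?ImMc /= mul0r ?subr0 ?addr0.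
Qed.

Lemma normc_cpow w (s : R) : normc (cpow w s) = normc w `^ s.
Proof.
rewrite /cpow normcM normcR ger0_norm ?powR_ge0//.
by rewrite /= cos2Dsin2 sqrtr1 mulr1.
Qed.

Lemma has_cderiv_cpow w (s : R) : 0 < complex.Re w ->
  has_cderiv (fun v => cpow v s) w (cpow w s * (s%:C / w)).
Proof.
move=> w0; have H := has_cderiv_comp (has_cderivZ s%:C (has_cderiv_clog w0))
  (@has_cderiv_cexp (s%:C * clog w)).
rewrite -cpow_cexp// in H; apply: has_cderiv_near w0 _ H => v vw /=.
rewrite cpow_cexp//; have := normc_Re (v - w); rewrite ReDc ReNc ler_norml => /andP[? _].
by move: vw; lra.
Qed.

Lemma Re_1B z : normc z < 1 -> 0 < complex.Re (1 - z).
Proof.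
move=> z1; rewrite ReDc ReNc /= subr_gt0.
by rewrite (le_lt_trans (ler_norm _))// (le_lt_trans (normc_Re _)).
Qed.

Lemma normc_conjM w z : normc w < 1 -> normc z < 1 -> normc (w^*%C * z) < 1.
Proof.
move=> w1 z1; rewrite normcM normc_conj (le_lt_trans _ z1)// ler_piMl ?normc_ge0//.
exact: ltW.
Qed.

Lemma normc_testF (l z : R[i]) (b : R) :
  normc (testF l b z) = (normc (1 - l^*%C * z) `^ (1 + b))^-1.
Proof. by rewrite /testF normcV normc_cpow. Qed.

Lemma has_cderiv_testF (l z : R[i]) (b : R) : 0 <= b -> normc l < 1 -> normc z < 1 ->
  exists2 d : R[i], has_cderiv (testF l b) z d &
    normc d = (1 + b) * normc l / normc (1 - l^*%C * z) `^ (2 + b).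
Proof.
move=> b0 l1 z1; set u := 1 - l^*%C * z.
have u0 : 0 < complex.Re u by apply: Re_1B; exact: normc_conjM.
have nu0 : 0 < normc u by exact: normc1B_gt0.
have Hu : has_cderiv (fun v => 1 - l^*%C * v) z (- l^*%C).
  have := has_cderiv_affine z (- l^*%C) 1; apply: (@has_cderiv_near _ _ _ _ _ 1) => // v _.
  by rewrite mulNr addrC.
have c0 : cpow u (1 + b) != 0 by rewrite -normc_gt0 normc_cpow powR_gt0.
have H := has_cderiv_inv (has_cderiv_comp Hu (has_cderiv_cpow (1 + b) u0)) c0.
eexists; first exact: H.
rewrite /= -/u expr2 !(normcM, normcN, normcV, normc_cpow) normc_conj normcR -expr2.
have -> : normc u `^ (2 + b) = normc u `^ (1 + b) * normc u.
  rewrite (_ : 2 + b = (1 + b) + 1); last by ring.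
  by rewrite [LHS]powRD ?(gt_eqF nu0) ?implybT// powRr1 ?(ltW nu0).
rewrite ger0_norm ?addr_ge0//.
have c1 : normc u `^ (1 + b) != 0 by rewrite gt_eqF ?powR_gt0.
by field; rewrite c1 gt_eqF.
Qed.

End ComplexPower.

(** * One-dimensional integrals *)

Section OneDimension.
Context {R : realType}.
Notation mu := (@lebesgue_measure R).
Implicit Types (a b c u v x y : R).

(** [h] may be unbounded at the ends of the interval, so the fundamental theorem of
    calculus is applied on compact subintervals that exhaust it. *)
Lemma integral_le_osc (h Psi : R -> R) u v M : u < v ->
  measurable_fun `]u, v[ h ->
  (forall x, u < x < v -> 0 <= h x /\ {for x, continuous h} /\ is_derive x 1 Psi (h x)) ->
  (forall x y, u < x < v -> u < y < v -> Psi y - Psi x <= M) ->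
  (\int[mu]_(x in `[u, v]) (h x)%:E <= M%:E)%E.
Proof.
move=> uv mh H HM.
have mhE : measurable_fun `]u, v[ (fun x => (h x)%:E) by exact: measurableT_comp.
rewrite (integral_itv_bndoo true false mhE).
pose un n := u + (v - u) / n.+3%:R; pose vn n := v - (v - u) / n.+3%:R.
have vu : 0 < v - u by rewrite subr_gt0.
have st n : [/\ u < un n, un n < vn n & vn n < v].
  have n3 : 0 < n.+3%:R :> R by [].
  have k0 : 0 < (v - u) / n.+3%:R by rewrite divr_gt0.
  have k1 : (v - u) / n.+3%:R <= (v - u) / 3.
    by rewrite ler_pM2l// lef_pV2 ?posrE// ler_nat.
  rewrite /un /vn; move: k0 k1; set k := _ / n.+3%:R; clear -uv.
  by move=> k0 k1; split; lra.
pose F n : set R := `[un n, vn n]%classic.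
have FE : `]u, v[%classic = \bigcup_n F n.
  apply/seteqP; split => x /=; last first.
    by move=> [n _]; have [? ? ?] := st n; rewrite /F /= !in_itv /= => /andP[? ?]; apply/andP; split; lra.
  rewrite in_itv /= => /andP[ux xv].
  have m0 : 0 < Num.min (x - u) (v - x) by rewrite lt_min !subr_gt0 ux.
  pose N := Num.truncn ((v - u) / Num.min (x - u) (v - x)).
  exists N => //; rewrite /F /= in_itv /=.
  have n3 : 0 < N.+3%:R :> R by [].
  have : (v - u) / N.+3%:R < Num.min (x - u) (v - x).
    rewrite ltr_pdivrMr// mulrC -ltr_pdivrMr// (lt_le_trans (truncnS_gt _))//.
    by rewrite ler_nat -/N !ltnS -addn2 leq_addr.
  rewrite lt_min /un /vn; set k := _ / N.+3%:R; clear -k.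
  by move=> /andP[? ?]; apply/andP; split; lra.
have FS n : F n `<=` `]u, v[%classic.
  by rewrite FE; exact: bigcup_sup.
rewrite FE.
have mF n : measurable (F n) by exact: measurable_itv.
have mhF n : measurable_fun (F n) (fun x => (h x)%:E).
  by apply: measurable_funS mhE => //; exact: FS.
have nd : nondecreasing_seq F.
  apply/nondecreasing_seqP => n; apply/subsetPset => x; rewrite /F /= !in_itv /=.
  have k1 : (v - u) / n.+4%:R <= (v - u) / n.+3%:R.
    by rewrite ler_pM2l// lef_pV2 ?posrE// ler_nat.
  rewrite /un /vn; move: k1; set k := _ / n.+4%:R; set k' := _ / n.+3%:R; clear -k k'.
  by move=> ? /andP[? ?]; apply/andP; split; lra.
have h0 n x : F n x -> (0 <= (h x)%:E)%E.
  by move=> /FS; rewrite /= in_itv /= => /H[? _]; rewrite lee_fin.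
have nd' : {homo F : n m / (n <= m)%N >-> (n <= m)%O} by move=> m n mn; exact: nd.
have cv := ge0_nondecreasing_set_cvg_integral (mu := mu) nd' mF mhF h0.
rewrite -(cvg_lim _ cv)//; apply: lime_le; first by apply/cvg_ex; eexists; exact: cv.
apply: nearW => n; have [s1 s2 s3] := st n.
have I x : un n <= x <= vn n -> u < x < v by move=> /andP[? ?]; apply/andP; split; lra.
rewrite (@continuous_FTC2 _ h Psi _ _ s2).
- by rewrite -EFinB lee_fin; apply: HM; lra.
- apply: continuous_in_subspaceT => x; rewrite inE /= in_itv /= => /I/H[_ []].
  by [].
- have cP x : u < x < v -> {for x, continuous Psi}.
    by move=> /H[_ [_ [+ _]]]; move=> /derivable1_diffP/differentiable_continuous.
  split.
  + by move=> x; rewrite in_itv /= => /andP[? ?]; have [_ [_ []]] := H x ltac:(lra).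
  + by apply: cvg_at_right_filter; apply: cP; lra.
  + by apply: cvg_at_left_filter; apply: cP; lra.
- move=> x; rewrite in_itv /= => /andP[? ?]; rewrite derive1E.
  by have [_ [_ []]] := H x ltac:(lra).
Qed.

Lemma continuous_powR (a x : R) : 0 < x -> {for x, continuous (fun y : R => y `^ a)}.
Proof.
by move=> x0; have [+ _] := is_derive1_powR a x0; move=> /derivable1_diffP/differentiable_continuous.
Qed.

Lemma continuous_powR_comp (g : R -> R) (a x : R) : 0 < g x ->
  {for x, continuous g} -> g y `^ a @[y --> x] --> g x `^ a.
Proof.
move=> g0 cg; have h : {for g x, continuous (fun y => y `^ a)} := continuous_powR g0.
exact: (@continuous_comp R R R g (fun y => y `^ a) x cg h).
Qed.

(** With [d = e + s * x], the integrand is the derivative of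
    [(d / (A + d)) `^ (al + 1)] up to the factor [(al + 1) * A], and this function
    takes values in [0, 1]. The slope [s] is [1] or [-1] according to the endpoint
    from which [d] measures the distance. *)
Lemma integral_radial_half (al A u v e s : R) : -1 < al -> 0 < A -> u < v ->
  s = 1 \/ s = -1 -> (forall x, u < x < v -> 0 < e + s * x) ->
  (\int[mu]_(x in `[u, v]) ((e + s * x) `^ al * (A + (e + s * x)) `^ (- (al + 2)))%:E
     <= (((al + 1) * A)^-1)%:E)%E.
Proof.
move=> al1 A0 uv s1 He; have al0 : 0 < al + 1 by lra.
have ss : s * s = 1 by case: s1 => ->; lra.
pose rho x := (e + s * x) / (A + (e + s * x)).
pose Psi x := s / ((al + 1) * A) * (rho x) `^ (al + 1).
have M0 : 0 < ((al + 1) * A)^-1 by rewrite invr_gt0 mulr_gt0.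
have rho01 x : u < x < v -> 0 < rho x < 1.
  move=> /He d0; have Ad : 0 < A + (e + s * x) by rewrite addr_gt0.
  by rewrite divr_gt0//= ltr_pdivrMr// mul1r ltrDr.
have md : measurable_fun setT (fun x : R => e + s * x).
  by apply: measurable_funD => //; apply: measurable_funM.
apply: (@integral_le_osc _ Psi) => //.
- apply: (@measurable_funS _ _ _ _ setT) => //; apply: measurable_funM.
    exact: (measurableT_comp (measurable_powR al)).
  apply: (measurableT_comp (measurable_powR (- (al + 2)))).
  exact: measurable_funD.
- move=> x ux; have d0 := He x ux; have Ad : 0 < A + (e + s * x) by rewrite addr_gt0.
  split; first by rewrite mulr_ge0 ?powR_ge0.
  have cd : {for x, continuous (fun x : R => e + s * x)}.
    by apply: cvgD; [exact: cvg_cst|apply: cvgM; [exact: cvg_cst|exact: cvg_id]].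
  split.
    change {for x, continuous (fun y : R => (e + s * y) `^ al * (A + (e + s * y)) `^ (- (al + 2)))}.
    apply: cvgM; apply: continuous_powR_comp => //.
    by apply: cvgD; [exact: cvg_cst|].
  have D1 : is_derive x 1 (fun x : R => e + s * x) s.
    by apply: is_derive_eq; rewrite /GRing.scale /=; ring.
  have D2 : is_derive x 1 (fun x : R => A + (e + s * x)) s.
    by apply: is_derive_eq; rewrite /GRing.scale /=; ring.
  have D3 : is_derive x 1 (fun x : R => (A + (e + s * x))^-1) (- (A + (e + s * x)) ^- 2 *: s).
    by apply: is_deriveV; rewrite gt_eqF.
  have D4 : is_derive x 1 rho (s * A / (A + (e + s * x)) ^+ 2).
    rewrite /rho; apply: is_derive_eq; rewrite /GRing.scale /=.
    by field; rewrite gt_eqF.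
  have [r0 _] := andP (rho01 x ux).
  have D5 := @is_derive1_comp R (fun y : R => y `^ (al + 1)) rho x _ _ (is_derive1_powR (al + 1) r0) D4.
  have := is_deriveZ (s / ((al + 1) * A)) D5.
  rewrite (_ : (fun y : R => _ `^ _) \o rho = (fun x => rho x `^ (al + 1)))//.
  congr (is_derive _ _ _ _).
  rewrite /GRing.scale /= addrK /rho powRM ?invr_ge0 ?(ltW d0) ?(ltW Ad)//.
  have -> : (A + (e + s * x))^-1 `^ al = (A + (e + s * x)) `^ (- al).
    by rewrite -powR_inv1 ?(ltW Ad)// -powRrM mulN1r.
  have -> : (A + (e + s * x)) `^ (- (al + 2)) = (A + (e + s * x)) `^ (- al) / (A + (e + s * x)) ^+ 2.
    by rewrite opprD powRB ?(gt_eqF Ad) ?implybT// (powR_mulrn 2 (ltW Ad)).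
  set D := A + (e + s * x) in Ad *.
  have n1 : D != 0 by rewrite gt_eqF.
  have n2 : al + 1 != 0 by rewrite gt_eqF.
  have n3 : A != 0 by rewrite gt_eqF.
  set P := _ `^ al; set Q := D `^ (- al).
  have -> : s / ((al + 1) * A) * ((al + 1) * (P * Q) * (s * A / D ^+ 2)) =
      (s * s) * (P * (Q / D ^+ 2)) by field; rewrite n1 n2 n3.
  by rewrite ss mul1r.
- move=> x y /rho01/andP[rx0 rx1] /rho01/andP[ry0 ry1].
  have B z : 0 < z -> z < 1 -> 0 <= z `^ (al + 1) <= 1.
    move=> z0 z1; rewrite powR_ge0 /= -[X in _ <= X](powRr0 z).
    by apply: ger_powR; [rewrite z0 ltW|exact: ltW].
  have /andP[a1 a2] := B _ rx0 rx1; have /andP[b1 b2] := B _ ry0 ry1.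
  rewrite /Psi -mulrBr -mulrA mulrCA ler_piMr ?(ltW M0)//.
  by case: s1 => ->; lra.
Qed.

Lemma integral_setU_le (f : R -> \bar R) (a b c : R) : a <= b -> b <= c ->
  measurable_fun `[a, c] f -> (forall x, a <= x <= c -> (0 <= f x)%E) ->
  (\int[mu]_(x in `[a, c]) f x = \int[mu]_(x in `[a, b]) f x + \int[mu]_(x in `[b, c]) f x)%E.
Proof.
move=> ab bc mf f0.
have E : `[a, c]%classic = `[a, b]%classic `|` `]b, c]%classic.
  by rewrite -itv_bndbnd_setU// bnd_simp.
rewrite E ge0_integral_setU//=.
- congr (_ + _)%E; rewrite integral_itv_obnd_cbnd//.
  by apply: measurable_funS mf => //; rewrite E; exact: subsetUr.
- by rewrite -E.
- move=> x xab; apply: f0; have : `[a, c]%classic x by rewrite E; exact: xab.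
  by rewrite /= in_itv.
- apply/disj_setPS => x [] /=; rewrite !in_itv /= => /andP[_ xb] /andP[bx _].
  by move: bx; rewrite ltNge xb.
Qed.

Lemma integral_radial (al A a : R) : -1 < al -> 0 < A -> 0 < a ->
  (\int[mu]_(x in `[(- a)%R, a]) ((a - `|x|) `^ al * (A + (a - `|x|)) `^ (- (al + 2)))%R%:E
     <= (2 / ((al + 1) * A))%R%:E)%E.
Proof.
move=> al1 A0 a0.
have md : measurable_fun setT (fun x : R => a - `|x|) by apply: measurable_funB.
have mk : measurable_fun setT (fun x : R => ((a - `|x|) `^ al * (A + (a - `|x|)) `^ (- (al + 2)))%:E).
  apply: measurableT_comp => //; apply: measurable_funM.
    exact: (measurableT_comp (measurable_powR al)).
  apply: (measurableT_comp (measurable_powR (- (al + 2)))).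
  exact: measurable_funD.
rewrite (@integral_setU_le _ (- a) 0 a) ?oppr_le0 ?(ltW a0)//; last 2 first.
- exact: measurable_funS mk.
- by move=> x _; rewrite lee_fin mulr_ge0 ?powR_ge0.
rewrite mulrDl mul1r EFinD; apply: leeD.
- have := @integral_radial_half al A (- a) 0 a 1 al1 A0; rewrite oppr_lt0 => /(_ a0 (or_introl erefl)) H.
  apply: le_trans (H _); last by move=> x /andP[? ?]; lra.
  rewrite le_eqVlt; apply/orP; left; apply/eqP; apply: eq_integral => x.
  by rewrite inE /= in_itv /= => /andP[_ x0]; rewrite ler0_norm// mul1r opprK.
- have := @integral_radial_half al A 0 a a (-1) al1 A0 a0 (or_intror erefl) => H.
  apply: le_trans (H _); last by move=> x /andP[? ?]; lra.
  rewrite le_eqVlt; apply/orP; left; apply/eqP; apply: eq_integral => x.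
  by rewrite inE /= in_itv /= => /andP[x0 _]; rewrite ger0_norm// mulN1r.
Qed.

Lemma integral_power_half (c s0 u v e s : R) : 0 < c -> 0 < s0 -> u < v ->
  s = 1 \/ s = -1 -> (forall x, u < x < v -> s0 <= e + s * x) ->
  (\int[mu]_(x in `[u, v]) ((e + s * x) `^ (- (1 + c)))%:E <= (s0 `^ (- c) / c)%:E)%E.
Proof.
move=> c0 s00 uv s1 He.
have ss : s * s = 1 by case: s1 => ->; lra.
have He0 x : u < x < v -> 0 < e + s * x by move=> /He; apply: lt_le_trans.
pose Psi x := - s / c * (e + s * x) `^ (- c).
have md : measurable_fun setT (fun x : R => e + s * x).
  by apply: measurable_funD => //; apply: measurable_funM.
apply: (@integral_le_osc _ Psi).
- exact: uv.
- apply: (@measurable_funS _ _ _ _ setT) => //.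
  exact: (measurableT_comp (measurable_powR (- (1 + c)))).
- move=> x ux; have d0 := He0 x ux.
  split; first by rewrite powR_ge0.
  have cd : {for x, continuous (fun x : R => e + s * x)}.
    by apply: cvgD; [exact: cvg_cst|apply: cvgM; [exact: cvg_cst|exact: cvg_id]].
  split; first exact: continuous_powR_comp.
  have D1 : is_derive x 1 (fun x : R => e + s * x) s.
    by apply: is_derive_eq; rewrite /GRing.scale /=; ring.
  have D5 := @is_derive1_comp R (fun y : R => y `^ (- c)) (fun x : R => e + s * x) x _ _ (is_derive1_powR (- c) d0) D1.
  have := is_deriveZ (- s / c) D5.
  rewrite (_ : (fun y : R => _ `^ _) \o _ = (fun x => (e + s * x) `^ (- c)))//.
  congr (is_derive _ _ _ _).
  rewrite /GRing.scale /= -opprD (addrC c).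
  set P := _ `^ _.
  have -> : - s / c * (- c * P * s) = (s * s) * P by field; rewrite gt_eqF.
  by rewrite ss mul1r.
- have B x : u < x < v -> 0 <= (e + s * x) `^ (- c) <= s0 `^ (- c).
    move=> ux; rewrite powR_ge0 !powRN /= lef_pV2 ?posrE ?powR_gt0 ?He0//.
    by apply: ge0_ler_powR; rewrite ?nnegrE ?(ltW c0) ?(ltW s00) ?(ltW (He0 _ ux))// He.
  move=> x y /B/andP[a1 a2] /B/andP[b1 b2].
  rewrite /Psi -mulrBr -mulrA mulrCA mulrC ler_pdivrMr// mulfVK ?gt_eqF//.
  move: a1 a2 b1 b2; move: (_ `^ _) (_ `^ _) (_ `^ _) => S X Y.
  by case: s1 => ->; clear; lra.
Qed.

Lemma integral_power (c s0 v : R) : 0 < c -> 0 < s0 -> -1 < v < 1 ->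
  (\int[mu]_(y in `[(-2)%R, 2%R]) ((s0 + `|y - v|) `^ (- (1 + c)))%R%:E
     <= (2 * s0 `^ (- c) / c)%R%:E)%E.
Proof.
move=> c0 s00 /andP[v1 v2].
have mk : measurable_fun setT (fun y : R => ((s0 + `|y - v|) `^ (- (1 + c)))%:E).
  apply: measurableT_comp => //; apply: (measurableT_comp (measurable_powR (- (1 + c)))).
  by apply: measurable_funD => //; apply: measurableT_comp => //; apply: measurable_funB.
rewrite (@integral_setU_le _ (- 2) v 2); [|lra|lra|exact: measurable_funS mk|]; last first.
  by move=> x _; rewrite lee_fin powR_ge0.
rewrite -mulrA mulrDl mul1r EFinD; apply: leeD.
- have H := @integral_power_half c s0 (- 2) v (s0 + v) (-1) c0 s00 ltac:(lra) (or_intror erefl).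
  apply: le_trans (H _); last by move=> x /andP[? ?]; lra.
  rewrite le_eqVlt; apply/orP; left; apply/eqP; apply: eq_integral => x.
  rewrite inE /= in_itv /= => /andP[_ x0]; rewrite ler0_norm ?subr_le0//.
  by rewrite opprB addrA mulN1r.
- have H := @integral_power_half c s0 v 2 (s0 - v) 1 c0 s00 ltac:(lra) (or_introl erefl).
  apply: le_trans (H _); last by move=> x /andP[? ?]; lra.
  rewrite le_eqVlt; apply/orP; left; apply/eqP; apply: eq_integral => x.
  rewrite inE /= in_itv /= => /andP[x0 _]; rewrite ger0_norm ?subr_ge0//.
  by rewrite mul1r addrAC addrA.
Qed.

Lemma powR_le_pow2 (al e : R) : 2^-1 <= e <= 2 -> e `^ al <= 2 `^ `|al|.
Proof.
move=> /andP[e1 e2]; have e0 : 0 < e by lra.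
have [a0|a0] := leP 0 al; first by rewrite ger0_norm//; apply: ge0_ler_powR; rewrite ?nnegrE// ltW.
rewrite ltr0_norm// -{1}[al]opprK powRN (powRN 2).
rewrite lef_pV2 ?posrE ?powR_gt0//.
have -> : 2 `^ al = (2^-1) `^ (- al) :> R.
  by rewrite -powR_inv1// -powRrM mulN1r opprK.
by apply: ge0_ler_powR; rewrite ?nnegrE// ?oppr_ge0 ltW.
Qed.

End OneDimension.

(** * The Forelli-Rudin estimate *)

Section ForelliRudin.
Context {R : realType}.
Notation mu := (@lebesgue_measure R).
Notation mu2 := ((@lebesgue_measure R) \x (@lebesgue_measure R))%E.

Lemma integral_zero_outside (h : R -> \bar R) (A : set R) :
  (forall x, ~ A x -> h x = 0%E) -> (\int[mu]_x h x = \int[mu]_(x in A) h x)%E.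
Proof.
move=> h0; rewrite [RHS]integral_mkcond; apply: eq_integral => x _.
by rewrite patchE; case: ifPn => // /negP; rewrite inE => /h0.
Qed.

(** The slices in [x] at heights [y] with [y ^+ 2 <= 2^-1] are integrated first:
    [integral_radial] turns [A `^ (- c)] into [A `^ (- (1 + c))], which
    [integral_power] integrates over [y]. *)
Lemma iterated_bound (f : R -> R -> \bar R) (al c K s0 v : R) :
  -1 < al -> 0 < c -> 0 <= K -> 0 < s0 -> -1 < v < 1 ->
  (forall y, measurable_fun setT (f y)) ->
  measurable_fun setT (fun y => \int[mu]_x f y x)%E ->
  (forall y x, (0 <= f y x)%E) ->
  (forall y x, ~ (x ^+ 2 + y ^+ 2 < 1 /\ y ^+ 2 <= 2^-1) -> f y x = 0%E) ->
  (forall y x, x ^+ 2 + y ^+ 2 < 1 -> y ^+ 2 <= 2^-1 ->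
     forall d A, d = Num.sqrt (1 - y ^+ 2) - `|x| -> A = s0 + `|y - v| ->
     (f y x <= (K * A `^ (- c) * (d `^ al * (A + d) `^ (- (al + 2))))%:E)%E) ->
  (\int[mu]_y \int[mu]_x f y x <= (K * 2 / (al + 1) * (2 * s0 `^ (- c) / c))%:E)%E.
Proof.
move=> al1 c0 K0 s00 vI mf mF f0 fz fb.
have al0 : 0 < al + 1 by lra.
have A0 y : 0 < s0 + `|y - v| by rewrite ltr_pwDl.
have inner y : (\int[mu]_x f y x <= (K * 2 / (al + 1) * (s0 + `|y - v|) `^ (- (1 + c)))%:E)%E.
  set A := s0 + `|y - v|.
  have [y2|y2] := leP (y ^+ 2) 2^-1; last first.
    rewrite integral0_eq ?lee_fin ?mulr_ge0 ?powR_ge0 ?invr_ge0 ?(ltW al0)//.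
    by move=> x _; apply: fz => -[_]; rewrite leNgt y2.
  set a := Num.sqrt (1 - y ^+ 2).
  have a2 : a ^+ 2 = 1 - y ^+ 2 by rewrite sqr_sqrtr//; lra.
  have a0 : 0 < a by rewrite sqrtr_gt0; lra.
  have sub x : x ^+ 2 + y ^+ 2 < 1 -> - a <= x <= a.
    move=> xy; rewrite -ler_norml -(@ler_pXn2r _ 2) ?nnegrE ?(ltW a0)// real_normK ?num_real//.
    by rewrite a2; lra.
  rewrite (@integral_zero_outside _ `[- a, a]%classic); last first.
    by move=> x /= nx; apply: fz => -[/sub xa _]; apply: nx; rewrite in_itv.
  have mk : measurable_fun setT (fun x : R => ((a - `|x|) `^ al * (A + (a - `|x|)) `^ (- (al + 2)))%:E).
    have md : measurable_fun setT (fun x : R => a - `|x|) by apply: measurable_funB.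
    apply: measurableT_comp => //; apply: measurable_funM.
      exact: (measurableT_comp (measurable_powR al)).
    apply: (measurableT_comp (measurable_powR (- (al + 2)))).
    exact: measurable_funD.
  have KA : 0 <= K * A `^ (- c) by rewrite mulr_ge0 ?powR_ge0.
  apply: (@le_trans _ _ (\int[mu]_(x in `[(- a)%R, a])
     ((K * A `^ (- c))%:E * ((a - `|x|) `^ al * (A + (a - `|x|)) `^ (- (al + 2)))%R%:E))%E).
    apply: ge0_le_integral => //.
    - exact: measurable_funS (mf y).
    - by apply: emeasurable_funM => //; exact: measurable_funS mk.
    - move=> x _; have [H|H] := pselect (x ^+ 2 + y ^+ 2 < 1 /\ y ^+ 2 <= 2^-1).
        by rewrite -EFinM; have [h1 h2] := H; exact: (fb y x h1 h2 _ _ erefl erefl).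
      by rewrite fz// mule_ge0 ?lee_fin// mulr_ge0 ?powR_ge0.
  rewrite ge0_integralZl ?lee_fin//; last 2 first.
  - exact: measurable_funS mk.
  - by move=> x _; rewrite lee_fin mulr_ge0 ?powR_ge0.
  have := @integral_radial _ al A a al1 (A0 y) a0.
  move=> /(lee_wpmul2l (x := (K * A `^ (- c))%:E)); rewrite lee_fin => /(_ KA) h.
  apply: (le_trans h); rewrite -EFinM lee_fin le_eqVlt; apply/orP; left; apply/eqP.
  have -> : A `^ (- (1 + c)) = A `^ (- c) / A.
    rewrite (_ : - (1 + c) = - c + - 1); last by ring.
    by rewrite powRD ?(gt_eqF (A0 y)) ?implybT// [A `^ (- 1)]powRN (powRr1 (ltW (A0 y))).
  have n1 : al + 1 != 0 by rewrite gt_eqF.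
  have n2 : A != 0 by rewrite gt_eqF// A0.
  by field; rewrite n1 n2.
have c1 : 0 <= K * 2 / (al + 1) by rewrite mulr_ge0 ?invr_ge0 ?(ltW al0)// mulr_ge0.
have mk : measurable_fun setT (fun y : R => ((s0 + `|y - v|) `^ (- (1 + c)))%:E).
  apply: measurableT_comp => //; apply: (measurableT_comp (measurable_powR (- (1 + c)))).
  by apply: measurable_funD => //; apply: measurableT_comp => //; apply: measurable_funB.
rewrite (@integral_zero_outside _ `[-2, 2]%classic); last first.
  move=> y /= ny; rewrite integral0_eq// => x _; apply: fz => -[_ y2]; apply: ny.
  by rewrite in_itv /=; apply/andP; split; nra.
apply: (@le_trans _ _ (\int[mu]_(y in `[(-2)%R, 2%R])
   ((K * 2 / (al + 1))%:E * ((s0 + `|y - v|) `^ (- (1 + c)))%R%:E))%E).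
  apply: ge0_le_integral => //.
  - by move=> y _; apply: integral_ge0.
  - exact: measurable_funS mF.
  - by apply: emeasurable_funM => //; exact: measurable_funS mk.

rewrite ge0_integralZl ?lee_fin//; last 2 first.
- exact: measurable_funS mk.
- by move=> y _; rewrite lee_fin powR_ge0.
by rewrite [leRHS]EFinM lee_wpmul2l ?lee_fin//; exact: integral_power.
Qed.

(** [m] plays the part of [|1 - conj lambda w|]. It dominates [s], [t] and [d], hence
    [A + d], and [(A + d) `^ (- c) <= A `^ (- c)]. The weight is compared with
    [d `^ al] because [1 - |w|^2] is [d] times a factor between [2^-1] and [2]. *)
Lemma kernel_pointwise (al c x y m s t d A : R) : -1 < al -> 0 < c ->
  x ^+ 2 + y ^+ 2 < 1 -> y ^+ 2 <= 2^-1 -> 0 < s -> 0 <= t ->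
  s <= m -> t <= m -> 1 - (x ^+ 2 + y ^+ 2) <= 2 * m ->
  d = Num.sqrt (1 - y ^+ 2) - `|x| -> A = s + t ->
  (1 - (x ^+ 2 + y ^+ 2)) `^ al / m `^ (2 + al + c) <=
   2 `^ `|al| * 6 `^ (2 + al + c) * A `^ (- c) * (d `^ al * (A + d) `^ (- (al + 2))).
Proof.
move=> al1 c0 xy y2 s0 t0 sm tm wm; set a := Num.sqrt (1 - y ^+ 2) => dE AE.
have a2 : a ^+ 2 = 1 - y ^+ 2 by rewrite sqr_sqrtr//; lra.
have a0 : 0 < a by rewrite sqrtr_gt0; lra.
have x0 : 0 <= `|x| by [].
have x2 : `|x| ^+ 2 = x ^+ 2 by rewrite real_normK ?num_real.
have xa : `|x| < a by rewrite -(@ltr_pXn2r _ 2) ?nnegrE ?(ltW a0)// x2 a2; lra.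
have d0 : 0 < d by rewrite dE subr_gt0.
have a1 : 2^-1 <= a by rewrite -(@ler_pXn2r _ 2) ?nnegrE ?(ltW a0)// a2; lra.
have a1' : a <= 1 by rewrite -(@ler_pXn2r _ 2) ?nnegrE ?(ltW a0)// a2; have := sqr_ge0 y; lra.
have e1 : 2^-1 <= a + `|x| <= 2 by apply/andP; split; lra.
have E : 1 - (x ^+ 2 + y ^+ 2) = d * (a + `|x|) by rewrite dE -subr_sqr x2 a2; ring.
have A0 : 0 < A by rewrite AE ltr_pwDl.
have Ad : 0 < A + d by rewrite addr_gt0.
have m0 : 0 < m := lt_le_trans s0 sm.
have Adm : A + d <= 6 * m.
  rewrite E in wm; have : d / 2 <= d * (a + `|x|) by rewrite ler_pM2l//; lra.
  lra.
have q0 : 0 <= 2 + al + c by lra.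
have -> : 2 `^ `|al| * 6 `^ (2 + al + c) * A `^ (- c) * (d `^ al * (A + d) `^ (- (al + 2))) =
  (d `^ al * 2 `^ `|al|) * (6 `^ (2 + al + c) * (A `^ (- c) * (A + d) `^ (- (al + 2)))) by ring.
apply: ler_pM; rewrite ?invr_ge0 ?powR_ge0//.
  rewrite E powRM ?(ltW d0)//; last by lra.
  by rewrite ler_wpM2l ?powR_ge0//; exact: powR_le_pow2.
have h1 : (A + d) `^ (2 + al + c) <= 6 `^ (2 + al + c) * m `^ (2 + al + c).
  rewrite -powRM ?(ltW m0)//; apply: ge0_ler_powR; rewrite ?nnegrE ?(ltW Ad)//.
  by rewrite mulr_ge0// ltW.
have h2 : (A + d) `^ (- c) <= A `^ (- c).
  rewrite !powRN lef_pV2 ?posrE ?powR_gt0//.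
  by apply: ge0_ler_powR; rewrite ?nnegrE ?(ltW A0) ?(ltW Ad) ?(ltW c0)// lerDl ltW.
have h3 : (A + d) `^ (- (2 + al + c)) <= A `^ (- c) * (A + d) `^ (- (al + 2)).
  rewrite (_ : - (2 + al + c) = - c + - (al + 2)); last by ring.
  by rewrite powRD ?(gt_eqF Ad) ?implybT// ler_wpM2r ?powR_ge0.
apply: le_trans (ler_wpM2l (powR_ge0 _ _) h3).
rewrite powRN ler_pdivlMr ?powR_gt0// mulrC ler_pdivrMr ?powR_gt0//.
Qed.

(** [|1 - conj l w|^2 - |w - l|^2 = (1 - |l|^2) (1 - |w|^2)]. *)
Lemma normc_diff_1B (l w : R[i]) : normc l < 1 -> normc w < 1 ->
  normc (w - l) <= normc (1 - l^*%C * w).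
Proof.
move=> l1 w1; rewrite -(@ler_pXn2r _ 2) ?nnegrE ?normc_ge0// -subr_ge0.
have -> : normc (1 - l^*%C * w) ^+ 2 - normc (w - l) ^+ 2 =
    (1 - normc l ^+ 2) * (1 - normc w ^+ 2).
  by case: l l1 => a b _; case: w w1 => u v _; rewrite !normc_sqr /=; ring.
by rewrite mulr_ge0// subr_ge0 expr_le1 ?normc_ge0// ltW.
Qed.

Lemma measurable_forelli al q (l : R[i]) :
  measurable_fun (@disc2 R) (fun w => (1 - normc (pt w) ^+ 2) `^ al / normc (1 - l^*%C * pt w) `^ q).
Proof.
rewrite (_ : (fun w => _) = (fun w => (1 - normc (pt w) ^+ 2) `^ al *
    normc (1 - l^*%C * pt w) `^ (- q))); last by apply/funext => w; rewrite powRN.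
apply: measurable_funM.
  apply: measurable_powR2; apply: measurable_funB => //.
  by apply: measurable_funX; apply: measurable_normc_disc holomorphic_id _; exact: normc_dist.
apply: measurable_powR2.
exact: (measurable_normc_disc (@holomorphic_kernel _ l^*%C) normc_dist).
Qed.

(** The disc is covered by the strips [y ^+ 2 <= 2^-1] and [x ^+ 2 <= 2^-1]; on
    each, [iterated_bound] applies with the appropriate order of integration. *)
Lemma forelli_rudin (al c : R) : -1 < al -> 0 < c ->
  exists2 C : R, 0 <= C & forall l : R[i], normc l < 1 ->
   (plane_int (@disc2 R)
     (fun w => ((1 - normc w ^+ 2) `^ al / normc (1 - l^*%C * w) `^ (2 + al + c))%R)
    <= (C * (1 - normc l) `^ (- c))%:E)%E.
Proof.
move=> al1 c0; have al0 : 0 < al + 1 by lra.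
pose K := 2 `^ `|al| * 6 `^ (2 + al + c) : R; have K0 : 0 <= K by rewrite mulr_ge0 ?powR_ge0.
exists (2 * (K * 2 / (al + 1) * (2 / c))).
  by rewrite !mulr_ge0 ?invr_ge0 ?(ltW al0) ?(ltW c0)//.
move=> l l1; set s := 1 - normc l; have s0 : 0 < s by rewrite subr_gt0.
pose h w := (1 - normc w ^+ 2) `^ al / normc (1 - l^*%C * w) `^ (2 + al + c).
have h0 w : 0 <= h w by rewrite divr_ge0 ?powR_ge0.
have mh : measurable_fun (@disc2 R) (h \o pt) by exact: measurable_forelli.
(* the strips on which the slices in x, respectively in y, are long *)
pose D1 := @disc2 R `&` [set w | w.2 ^+ 2 <= 2^-1].
pose D2 := @disc2 R `&` [set w | w.1 ^+ 2 <= 2^-1].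
have mD1 : measurable D1.
  rewrite /D1 -[X in _ `&` X]setTI; apply: measurableI; first exact: measurable_disc2.
  have m2 : measurable_fun setT (fun w : R * R => w.2 ^+ 2) by apply: measurable_funX.
  rewrite (_ : [set w | _] = (fun w : R * R => w.2 ^+ 2) @^-1` `]-oo, 2^-1]%classic).
    by apply: m2 => //; exact: measurable_itv.
  by apply/seteqP; split=> w /=; rewrite in_itv.
have mD2 : measurable D2.
  rewrite /D2 -[X in _ `&` X]setTI; apply: measurableI; first exact: measurable_disc2.
  have m2 : measurable_fun setT (fun w : R * R => w.1 ^+ 2) by apply: measurable_funX.
  rewrite (_ : [set w | _] = (fun w : R * R => w.1 ^+ 2) @^-1` `]-oo, 2^-1]%classic).
    by apply: m2 => //; exact: measurable_itv.
  by apply/seteqP; split=> w /=; rewrite in_itv.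
have discE w : @disc2 R w <-> w.1 ^+ 2 + w.2 ^+ 2 < 1.
  have -> : @disc2 R w = (normc (pt w) < 1) :> Prop by [].
  by rewrite -(@ltr_pXn2r _ 2) ?nnegrE ?normc_ge0// expr1n normc_sqr.
have facts w : @disc2 R w -> let m := normc (1 - l^*%C * pt w) in
    [/\ s <= m, `|w.1 - complex.Re l| <= m, `|w.2 - complex.Im l| <= m &
      1 - (w.1 ^+ 2 + w.2 ^+ 2) <= 2 * m].
  move=> Dw; have w1 : normc (pt w) < 1 := Dw.
  have h1 := normc1B_ge (pt w) l1; have h2 := normc_diff_1B l1 w1.
  have lw := normcM l^*%C (pt w); rewrite normc_conj in lw.
  have h3 := ler_normcB 1 (l^*%C * pt w); rewrite normc1 lw in h3.
  have l0 := normc_ge0 l; have w0 := normc_ge0 (pt w).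
  split.
  - by apply: le_trans h3; rewrite lerD2l lerN2 ler_piMr// ltW.
  - by apply: le_trans h2; have := normc_Re (pt w - l); rewrite ReDc ReNc.
  - by apply: le_trans h2; have := normc_Im (pt w - l); rewrite ImDc ImNc.
  - have -> : w.1 ^+ 2 + w.2 ^+ 2 = normc (pt w) ^+ 2 by rewrite normc_sqr.
    by move: h1; clear -w0 w1; nra.
pose f1 : R * R -> \bar R := (fun w => (h (pt w))%:E) \_ D1.
pose f2 : R * R -> \bar R := (fun w => (h (pt w))%:E) \_ D2.
have mf1 : measurable_fun setT f1.
  apply/(measurable_restrictT _ mD1); apply: measurable_EFin2; apply: measurable_funS mh => //.
    exact: measurable_disc2.
  exact: subIsetl.
have mf2 : measurable_fun setT f2.
  apply/(measurable_restrictT _ mD2); apply: measurable_EFin2; apply: measurable_funS mh => //.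
    exact: measurable_disc2.
  exact: subIsetl.
have f10 w : (0 <= f1 w)%E by rewrite /f1 patchE; case: ifP => // _; rewrite lee_fin.
have f20 w : (0 <= f2 w)%E by rewrite /f2 patchE; case: ifP => // _; rewrite lee_fin.
have vI (a : R) : `|a| <= normc l -> -1 < a < 1.
  by move=> al'; rewrite -ltr_norml; exact: le_lt_trans l1.
have B1 : (\int[mu2]_w f1 w <= (K * 2 / (al + 1) * (2 * s `^ (- c) / c))%:E)%E.
  rewrite (plane_tonelli mf1 f10).2.
  apply: (@iterated_bound (fun y x => f1 (x, y)) _ _ _ _ (complex.Im l) al1 c0 K0 s0).
  - exact: vI (normc_Im l).
  - by move=> y; apply: (measurableT_comp mf1); exact: pair2_measurable.
  - exact: measurable_fun_fubini_tonelli_G.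
  - by [].
  - by move=> y x H; rewrite /f1 patchE; case: ifPn => //; rewrite inE => -[/discE ? ?]; case: H.
  - move=> y x xy y2 d A dE AE; have Dw : @disc2 R (x, y) by apply/discE.
    rewrite /f1 patchE mem_set// lee_fin /h normc_sqr /=.
    have [h1 h2 h3 h4] := facts _ Dw.
    exact: (@kernel_pointwise al c x y _ s `|y - complex.Im l| d A).
have B2 : (\int[mu2]_w f2 w <= (K * 2 / (al + 1) * (2 * s `^ (- c) / c))%:E)%E.
  rewrite (plane_tonelli mf2 f20).1.
  apply: (@iterated_bound (fun x y => f2 (x, y)) _ _ _ _ (complex.Re l) al1 c0 K0 s0).
  - exact: vI (normc_Re l).
  - by move=> y; apply: (measurableT_comp mf2); exact: pair1_measurable.
  - exact: measurable_fun_fubini_tonelli_F.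
  - by [].
  - move=> y x H; rewrite /f2 patchE; case: ifPn => //; rewrite inE => -[/discE ? ?]; case: H.
    by rewrite addrC.
  - move=> y x xy y2 d A dE AE; rewrite addrC in xy; have Dw : @disc2 R (y, x) by apply/discE.
    rewrite /f2 patchE mem_set// lee_fin /h normc_sqr /=.
    have [h1 h2 h3 h4] := facts _ Dw; rewrite [y ^+ 2 + _]addrC.
    apply: (@kernel_pointwise al c x y _ s `|y - complex.Re l| d A) => //.
      by rewrite addrC.
    by move: h4; rewrite /= [y ^+ 2 + _]addrC.
have -> : plane_int (@disc2 R) h = (\int[mu2]_w ((fun w => (h (pt w))%:E) \_ (@disc2 R)) w)%E.
  by rewrite /plane_int integral_mkcond.
apply: (@le_trans _ _ (\int[mu2]_w (f1 w + f2 w))%E).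
  apply: ge0_le_integral => //.
  - by move=> w _; rewrite patchE; case: ifP => // _; rewrite lee_fin.
  - by apply/(measurable_restrictT _ measurable_disc2); exact: measurable_EFin2.
  - exact: emeasurable_funD.
  - move=> w _; rewrite patchE; case: ifPn; last by rewrite adde_ge0.
    rewrite inE => Dw; have [y2|y2] := leP (w.2 ^+ 2) 2^-1.
      by rewrite {1}/f1 patchE mem_set ?leeDl//; split.
    rewrite /f2 patchE mem_set ?leeDr//; split=> //=.
    by have /discE := Dw; lra.
rewrite ge0_integralD//; apply: (le_trans (leeD B1 B2)); rewrite -EFinD lee_fin.
rewrite le_eqVlt; apply/orP; left; apply/eqP.
by field; rewrite !gt_eqF.
Qed.
End ForelliRudin.

(** * The Dirichlet norm *)

Section HolomorphicDisc.
Context {R : realType}.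
Implicit Types (f g phi : R[i] -> R[i]) (z w : R[i]).

(** The lock keeps conversion from unfolding the limit that defines the
    derivative when two derivatives are compared. *)
Definition cder f : R[i] -> R[i] := locked (@cderiv R) f.

Lemma cderE f : cder f = cderiv f.
Proof. by rewrite /cder -lock. Qed.

Lemma cderP f z (d : R[i]) : has_cderiv f z d -> cder f z = d.
Proof. by rewrite cderE; exact: cderivE. Qed.

Lemma has_cder f z : holomorphic f -> disc R z -> has_cderiv f z (cder f z).
Proof. by rewrite cderE => /holomorphicP; exact. Qed.

Lemma holomorphicI f : (forall z, disc R z -> exists d : R[i], has_cderiv f z d) -> holomorphic f.
Proof. by move=> H z /H[d /has_cderiv_derive[]]. Qed.

Lemma holomorphic_cderiv f : holomorphic f -> holomorphic (cder f).
Proof.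
move=> Hf; apply: holomorphicI => z z1; have {}z1 : normc z < 1 := z1.
have r0 : 0 < (1 - normc z) / 4 by rewrite divr_gt0 ?subr_gt0.
rewrite cderE; apply: (cderiv_derivable r0); apply: holomorphic_on => //.
exact: csq_disc.
Qed.

Lemma has_cder_eq f g : holomorphic f -> (forall z, disc R z -> f z = g z) ->
  forall z, disc R z -> has_cderiv g z (cder f z).
Proof.
move=> Hf fg z z1; have hf := has_cder Hf z1; have {}z1 : normc z < 1 := z1.
apply: (@has_cderiv_near _ f _ _ _ (1 - normc z)); [by rewrite subr_gt0| |exact: hf].
move=> w wz; apply: fg; rewrite /disc /= -(subrK z w).
by rewrite (le_lt_trans (le_normcD _ _))//; lra.
Qed.

Lemma cder_eq f g : holomorphic f -> (forall z, disc R z -> f z = g z) ->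
  forall z, disc R z -> cder g z = cder f z.
Proof. by move=> Hf fg z /(has_cder_eq Hf fg)/cderP. Qed.

Lemma has_cderiv_compD f phi z : holomorphic f -> holomorphic phi -> phi @` disc R `<=` disc R ->
  disc R z -> has_cderiv (f \o phi) z (cder f (phi z) * cder phi z).
Proof.
move=> Hf Hp phiD zD.
by apply: has_cderiv_comp; apply: has_cder => //; apply: phiD; exists z.
Qed.

Lemma holomorphic_comp f phi : holomorphic f -> holomorphic phi -> phi @` disc R `<=` disc R ->
  holomorphic (f \o phi).
Proof. by move=> Hf Hp phiD; apply: holomorphicI => z /(has_cderiv_compD Hf Hp phiD); eexists; eassumption. Qed.

Lemma cder_comp f phi z : holomorphic f -> holomorphic phi -> phi @` disc R `<=` disc R ->
  disc R z -> cder (f \o phi) z = cder f (phi z) * cder phi z.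
Proof. by move=> Hf Hp phiD /(has_cderiv_compD Hf Hp phiD)/cderP. Qed.

Lemma has_cderivBD f g z : holomorphic f -> holomorphic g -> disc R z ->
  has_cderiv (f \- g) z (cder f z - cder g z).
Proof. by move=> Hf Hg zD; apply: has_cderivB; exact: has_cder. Qed.

Lemma holomorphicB f g : holomorphic f -> holomorphic g -> holomorphic (f \- g).
Proof. by move=> Hf Hg; apply: holomorphicI => z /(has_cderivBD Hf Hg); eexists; eassumption. Qed.

Lemma cderB f g z : holomorphic f -> holomorphic g -> disc R z ->
  cder (f \- g) z = cder f z - cder g z.
Proof. by move=> Hf Hg /(has_cderivBD Hf Hg)/cderP. Qed.

Lemma has_cderivZD f a z : holomorphic f -> disc R z ->
  has_cderiv (fun w => a * f w) z (a * cder f z).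
Proof. by move=> Hf zD; apply: has_cderivZ; exact: has_cder. Qed.

Lemma holomorphicZ f a : holomorphic f -> holomorphic (fun w => a * f w).
Proof. by move=> Hf; apply: holomorphicI => z /(has_cderivZD a Hf); eexists; eassumption. Qed.

Lemma cderZ f a z : holomorphic f -> disc R z ->
  cder (fun w => a * f w) z = a * cder f z.
Proof. by move=> Hf /(has_cderivZD a Hf)/cderP. Qed.

Lemma disc0 : disc R 0.
Proof. by have : normc (0 : R[i]) < 1 by rewrite normc0 ltr01. Qed.

End HolomorphicDisc.

Section DiscIntegral.
Context {R : realType}.
Implicit Types (h k : R[i] -> R) (g : R[i] -> R[i]).
Notation mu2 := ((@lebesgue_measure R) \x (@lebesgue_measure R))%E.
Local Notation dint := (plane_int (@disc2 R)).

Definition disc_measurable h := measurable_fun (@disc2 R) (fun w => h (pt w)).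

Lemma disc_measurableM h k : disc_measurable h -> disc_measurable k ->
  disc_measurable (fun z => h z * k z).
Proof. exact: measurable_funM. Qed.

Lemma disc_measurableD h k : disc_measurable h -> disc_measurable k ->
  disc_measurable (fun z => h z + k z).
Proof. exact: measurable_funD. Qed.

Lemma disc_measurable_cst (c : R) : disc_measurable (fun=> c).
Proof. exact: measurable_cst. Qed.

Lemma disc_measurable_powR h (p : R) : disc_measurable h -> disc_measurable (fun z => h z `^ p).
Proof. exact: measurable_powR2. Qed.

Lemma disc_measurable_normc g : holomorphic g -> disc_measurable (fun z => normc (g z)).
Proof. by move=> Hg; apply: measurable_normc_disc Hg _; exact: normc_dist. Qed.

Lemma dint_ge0 h : (forall z, disc R z -> 0 <= h z) -> (0 <= dint h)%E.
Proof. by move=> h0; apply: integral_ge0 => w Dw; rewrite lee_fin; exact: h0. Qed.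

Lemma dint_eq h k : (forall z, disc R z -> h z = k z) -> dint h = dint k.
Proof. by move=> hk; apply: eq_integral => w; rewrite inE => Dw; congr EFin; exact: hk. Qed.

Lemma dint_le h k : disc_measurable h -> disc_measurable k ->
  (forall z, disc R z -> 0 <= h z <= k z) -> (dint h <= dint k)%E.
Proof.
move=> mh mk hk; apply: ge0_le_integral.
- exact: measurable_disc2.
- by move=> w Dw; rewrite lee_fin; have /andP[] := hk _ Dw.
- exact: measurable_EFin2.
- exact: measurable_EFin2.
- by move=> w Dw; rewrite lee_fin; have /andP[] := hk _ Dw.
Qed.

Lemma dintZ (a : R) h : disc_measurable h -> 0 <= a -> (forall z, disc R z -> 0 <= h z) ->
  dint (fun z => a * h z) = (a%:E * dint h)%E.
Proof.
move=> mh a0 h0; rewrite /plane_int -ge0_integralZl//.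
- exact: measurable_disc2.
- exact: measurable_EFin2.
- by move=> w Dw; rewrite lee_fin; exact: h0.
Qed.

Lemma dintD h k : disc_measurable h -> disc_measurable k -> (forall z, disc R z -> 0 <= h z) ->
  (forall z, disc R z -> 0 <= k z) -> dint (fun z => h z + k z) = (dint h + dint k)%E.
Proof.
move=> mh mk h0 k0; rewrite /plane_int -ge0_integralD//.
- exact: measurable_disc2.
- by move=> w Dw; rewrite lee_fin; exact: h0.
- exact: measurable_EFin2.
- by move=> w Dw; rewrite lee_fin; exact: k0.
- exact: measurable_EFin2.
Qed.

(** The density of [dA_alpha] with respect to Lebesgue measure. *)
Definition weight (al : R) (z : R[i]) : R := (1 + al) * (1 - normc z ^+ 2) `^ al / pi.

Lemma weight_ge0 al z : -1 < al -> 0 <= weight al z.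
Proof.
move=> al1; rewrite /weight !mulr_ge0 ?powR_ge0 ?invr_ge0 ?pi_ge0//; lra.
Qed.

Lemma disc_measurable_weight al : disc_measurable (weight al).
Proof.
rewrite /weight; apply: disc_measurableM; last exact: disc_measurable_cst.
apply: disc_measurableM; first exact: disc_measurable_cst.
apply: disc_measurable_powR; apply: measurable_funB => //.
by apply: measurable_funX; exact: (disc_measurable_normc holomorphic_id).
Qed.

Lemma disc_integralE al h : disc_integral al h = dint (fun z => h z * weight al z).
Proof. by []. Qed.

Lemma disc_integral_le al h k : -1 < al -> disc_measurable h -> disc_measurable k ->
  (forall z, disc R z -> 0 <= h z <= k z) -> (disc_integral al h <= disc_integral al k)%E.
Proof.
move=> al1 mh mk hk; rewrite !disc_integralE; apply: dint_le.
- by apply: disc_measurableM => //; exact: disc_measurable_weight.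
- by apply: disc_measurableM => //; exact: disc_measurable_weight.
- move=> z /hk/andP[h1 h2]; rewrite mulr_ge0 ?weight_ge0//=.
  by rewrite ler_wpM2r ?weight_ge0.
Qed.

Lemma disc_integralZ al (a : R) h : -1 < al -> disc_measurable h -> 0 <= a ->
  (forall z, disc R z -> 0 <= h z) ->
  disc_integral al (fun z => (a * h z)%R) = (a%:E * disc_integral al h)%E.
Proof.
move=> al1 mh a0 h0; rewrite !disc_integralE -dintZ//.
- by apply: dint_eq => z _; rewrite mulrA.
- by apply: disc_measurableM => //; exact: disc_measurable_weight.
- by move=> z /h0 hz; rewrite mulr_ge0 ?weight_ge0.
Qed.

Lemma disc_integralD al h k : -1 < al -> disc_measurable h -> disc_measurable k ->
  (forall z, disc R z -> 0 <= h z) -> (forall z, disc R z -> 0 <= k z) ->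
  disc_integral al (fun z => (h z + k z)%R) = (disc_integral al h + disc_integral al k)%E.
Proof.
move=> al1 mh mk h0 k0; rewrite !disc_integralE -dintD//.
- by apply: dint_eq => z _; rewrite mulrDl.
- by apply: disc_measurableM => //; exact: disc_measurable_weight.
- by apply: disc_measurableM => //; exact: disc_measurable_weight.
- by move=> z /h0 hz; rewrite mulr_ge0 ?weight_ge0.
- by move=> z /k0 hz; rewrite mulr_ge0 ?weight_ge0.
Qed.

Lemma disc_integral_ge0 al h : -1 < al -> (forall z, disc R z -> 0 <= h z) ->
  (0 <= disc_integral al h)%E.
Proof.
move=> al1 h0; rewrite disc_integralE; apply: dint_ge0 => z /h0 hz.
by rewrite mulr_ge0 ?weight_ge0.
Qed.

End DiscIntegral.

Section Energy.
Context {R : realType}.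
Implicit Types (f g : R[i] -> R[i]) (z : R[i]) (p al : R).

(** The part of the [p]-th power of the Dirichlet norm that comes from the
    derivative; locked for the same reason as [cder]. *)
Definition denergy p al f : \bar R :=
  locked (fun h => disc_integral al h) (fun z => normc (cder f z) `^ p).

(** The [p]-th power of the Dirichlet norm. Estimates are additive in it. *)
Definition energy p al f : \bar R := ((normc (f 0%R) `^ p)%:E + denergy p al f)%E.

Lemma denergyE p al f : denergy p al f = disc_integral al (fun z => (normc (cder f z) `^ p)%R).
Proof. by rewrite /denergy -lock. Qed.

(** Locked for the same reason as [cder]. *)
Definition dnorm p al f : \bar R := locked (@dirichlet_norm R) p al f.

Lemma dnormE p al f : dnorm p al f = dirichlet_norm p al f.
Proof. by rewrite /dnorm -lock. Qed.

Lemma denergy_ge0 p al f : -1 < al -> (0 <= denergy p al f)%E.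
Proof. by move=> al1; rewrite denergyE; apply: disc_integral_ge0 => // z _; exact: powR_ge0. Qed.

Lemma energy_ge0 p al f : -1 < al -> (0 <= energy p al f)%E.
Proof. by move=> al1; rewrite adde_ge0 ?denergy_ge0// lee_fin powR_ge0. Qed.

Lemma poweRK p (x : \bar R) : p != 0 -> (0 <= x)%E -> ((x `^ p^-1) `^ p = x)%E.
Proof. by move=> p0 x0; rewrite -poweRrM mulVf// poweRe1. Qed.

Lemma dnorm_energy p al f : p != 0 -> -1 < al ->
  dnorm p al f = (energy p al f `^ p^-1)%E.
Proof.
by move=> p0 al1; rewrite dnormE /dirichlet_norm /bergman_norm -cderE -denergyE poweRK//; exact: denergy_ge0.
Qed.

Lemma dnorm_nneg p al f : (0 <= dnorm p al f)%E.
Proof. by rewrite dnormE; exact: poweR_ge0. Qed.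

Lemma energyE p al f : energy p al f = ((normc (f 0%R) `^ p)%:E + denergy p al f)%E.
Proof. by []. Qed.

Lemma dnorm_le p al f (M : R) : 0 < p -> -1 < al -> 0 <= M ->
  (dnorm p al f <= M%:E)%E = (energy p al f <= (M `^ p)%:E)%E.
Proof.
move=> p0 al1 M0; rewrite dnorm_energy ?gt_eqF//.
have inI (x : \bar R) : (0 <= x)%E -> x \in `[0%E, +oo%E] by move=> x0; rewrite in_itv /= x0 leey.
apply/idP/idP => H.
- have := @gt0_ler_poweR R p (ltW p0) _ _ (inI _ (poweR_ge0 _ _)) (inI M%:E _) H.
  by rewrite lee_fin poweRK ?gt_eqF ?energy_ge0//; exact.
- have p0' : 0 <= p^-1 by rewrite invr_ge0 ltW.
  have := @gt0_ler_poweR R p^-1 p0' _ _ (inI _ (energy_ge0 p f al1)) (inI (M `^ p)%:E _) H.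
  rewrite lee_fin powR_ge0 => /(_ isT); rewrite -[X in (_ <= X)%E]/((M `^ p) `^ p^-1)%:E.
  by rewrite -powRrM divff ?gt_eqF// powRr1.
Qed.

Lemma denergy_eq p al f g : holomorphic f -> (forall z, disc R z -> f z = g z) ->
  denergy p al g = denergy p al f.
Proof.
move=> Hf fg; rewrite !denergyE !disc_integralE; apply: dint_eq => z zD.
by rewrite (cder_eq Hf fg).
Qed.

Lemma energy_eq p al f g : holomorphic f -> (forall z, disc R z -> f z = g z) ->
  energy p al g = energy p al f.
Proof.
by move=> Hf fg; rewrite !energyE (denergy_eq p al Hf fg) (fg _ disc0).
Qed.

Lemma dnorm_eq p al f g : 0 < p -> -1 < al -> holomorphic f -> (forall z, disc R z -> f z = g z) ->
  dnorm p al g = dnorm p al f.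
Proof.
by move=> p0 al1 Hf fg; rewrite !dnorm_energy ?gt_eqF// (energy_eq p al Hf fg).
Qed.

Lemma normcB_powR p (a b : R[i]) : 0 < p ->
  normc (a - b) `^ p <= 2 `^ p * (normc a `^ p + normc b `^ p).
Proof.
move=> p0; have ab : normc (a - b) <= normc a + normc b.
  by rewrite -(normcN b); exact: le_normcD.
have a0 := normc_ge0 a; have b0 := normc_ge0 b; have p0' := ltW p0.
have [h|h] := leP (normc a) (normc b).
- apply: (@le_trans _ _ ((2 * normc b) `^ p)).
    by apply: ge0_ler_powR; rewrite ?nnegrE ?normc_ge0//; lra.
  by rewrite powRM// ler_wpM2l ?powR_ge0// lerDr powR_ge0.
- apply: (@le_trans _ _ ((2 * normc a) `^ p)).
    by apply: ge0_ler_powR; rewrite ?nnegrE ?normc_ge0//; lra.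
  by rewrite powRM// ler_wpM2l ?powR_ge0// lerDl powR_ge0.
Qed.

Lemma disc_measurable_cderiv f p : holomorphic f ->
  disc_measurable (fun z => normc (cder f z) `^ p).
Proof.
by move=> Hf; apply: disc_measurable_powR; apply: disc_measurable_normc; exact: holomorphic_cderiv.
Qed.

Lemma denergyB p al f g : 0 < p -> -1 < al -> holomorphic f -> holomorphic g ->
  (denergy p al (f \- g)%R <= (2 `^ p)%:E * (denergy p al f + denergy p al g))%E.
Proof.
move=> p0 al1 Hf Hg; have mf := disc_measurable_cderiv p Hf; have mg := disc_measurable_cderiv p Hg.
rewrite !denergyE -disc_integralD//; try by move=> z _; exact: powR_ge0.
rewrite -disc_integralZ ?powR_ge0//; last 2 first.
- exact: disc_measurableD.
- by move=> z _; rewrite addr_ge0 ?powR_ge0.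
apply: disc_integral_le => //.
- by apply: disc_measurable_cderiv; exact: holomorphicB.
- by apply: disc_measurableM; [exact: disc_measurable_cst|exact: disc_measurableD].
- by move=> z zD; rewrite powR_ge0/= cderB// normcB_powR.
Qed.

Lemma energyB p al f g : 0 < p -> -1 < al -> holomorphic f -> holomorphic g ->
  (energy p al (f \- g)%R <= (2 `^ p)%:E * (energy p al f + energy p al g))%E.
Proof.
move=> p0 al1 Hf Hg.
apply: (@le_trans _ _ ((2 `^ p)%:E * ((normc (f 0) `^ p)%:E + (normc (g 0) `^ p)%:E) +
   (2 `^ p)%:E * (denergy p al f + denergy p al g))%E).
  rewrite energyE; apply: leeD; [by rewrite -EFinD -EFinM lee_fin normcB_powR|exact: denergyB].
rewrite -ge0_muleDr ?adde_ge0 ?denergy_ge0 ?lee_fin ?powR_ge0//.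
by rewrite !energyE addeACA.
Qed.

(** A quasi-triangle inequality, from the one for [t `^ p]; for the topology the
    constant does not matter. *)
Lemma dnorm_sub p al f g (e : R) : 1 <= p -> -1 < al -> 0 <= e ->
  holomorphic f -> holomorphic g ->
  (dnorm p al f <= e%:E)%E -> (dnorm p al g <= e%:E)%E ->
  (dnorm p al (f \- g)%R <= (4 * e)%:E)%E.
Proof.
move=> p1 al1 e0 Hf Hg; have p0 : 0 < p by lra.
rewrite !dnorm_le ?mulr_ge0// => Ef Eg.
apply: (le_trans (energyB p0 al1 Hf Hg)).
apply: (@le_trans _ _ ((2 `^ p)%:E * (e `^ p + e `^ p)%:E)%E).
  by rewrite lee_wpmul2l ?lee_fin ?powR_ge0// EFinD leeD.
rewrite -EFinM lee_fin (_ : 4 * e = 2 * (2 * e)) ?powRM ?mulr_ge0//; last by ring.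
rewrite ler_wpM2l ?powR_ge0// -mulr2n -[_ *+ 2]mulr_natl ler_wpM2r ?powR_ge0//.
by rewrite -[X in X <= _]powRr1//; apply: ler_powR => //; lra.
Qed.

End Energy.

(** * Point evaluations and a Carleson-type inequality *)

Section PointEvaluation.
Context {R : realType}.
Implicit Types (f g : R[i] -> R[i]) (z : R[i]) (p al : R).

Lemma le_of_powR p (a b : R) : 0 < p -> 0 <= b -> a `^ p <= b `^ p -> a <= b.
Proof.
move=> p0 b0; apply: contraTT; rewrite -!ltNge => ba.
by apply: gt0_ltr_powR; rewrite ?nnegrE//; lra.
Qed.

(** The exponent of the kernel is so large that its weight is at most
    [(1 - |w|^2) `^ al]. *)
Lemma area_point_estimate p al : 1 <= p -> -1 < al ->
  exists2 K : R, 0 <= K & forall g z, holomorphic g -> disc R z ->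
  ((normc (g z) `^ p)%:E <= (K * (1 - normc z) `^ (- (2 + `|al|)))%:E *
     disc_integral al (fun w => (normc (g w) `^ p)%R))%E.
Proof.
move=> p1 al1; set q := 2 + `|al|; have q2 : 2 <= q by rewrite lerDl.
have al0 : 0 < 1 + al by lra.
have piP := pi_gt0 R.
pose K0 := 256 `^ p * 10 `^ q : R; have K00 : 0 <= K0 by rewrite mulr_ge0 ?powR_ge0.
have c0 : 0 <= pi / (1 + al) by rewrite divr_ge0 ?pi_ge0// ltW.
exists (K0 * (pi / (1 + al))); first by rewrite mulr_ge0.
move=> g z Hg zD; have z1 : normc z < 1 := zD.
have s0 : 0 < 1 - normc z by rewrite subr_gt0.
apply: (le_trans (reproducing_estimate p1 q2 Hg zD)).
rewrite -/K0 -(mulrA K0) (EFinM K0) -muleA; apply: lee_wpmul2l; first by rewrite lee_fin.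
have mg : disc_measurable (fun w => normc (g w) `^ p).
  by apply: disc_measurable_powR; exact: disc_measurable_normc.
rewrite disc_integralE -dintZ; last 3 first.
- by apply: disc_measurableM => //; exact: disc_measurable_weight.
- by rewrite mulr_ge0 ?powR_ge0.
- by move=> w _; rewrite mulr_ge0 ?powR_ge0 ?weight_ge0.
apply: dint_le.
- by apply: disc_measurableM => //; exact: measurable_kernelq.
- apply: disc_measurableM; first exact: disc_measurable_cst.
  by apply: disc_measurableM => //; exact: disc_measurable_weight.
- move=> w wD; have w1 : normc w < 1 := wD.
  rewrite mulr_ge0 ?kernelq_ge0 ?powR_ge0//=.
  have -> : pi / (1 + al) * (1 - normc z) `^ (- q) * (normc (g w) `^ p * weight al w) =
     (1 - normc w ^+ 2) `^ al * (1 - normc z) `^ (- q) * normc (g w) `^ p.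
    have n1 : 1 + al != 0 by rewrite gt_eqF.
    have n2 : pi != 0 :> R by rewrite gt_eqF.
    rewrite /weight; move: (pi : R) n2 => P n2.
    by field; rewrite n1 n2.
  rewrite ler_wpM2r ?powR_ge0// /kernelq.
  have w0 : 0 < 1 - normc w ^+ 2 <= 1.
    by have := normc_ge0 w; have := w1; clear; move=> ? ?; apply/andP; split; nra.
  apply: ler_pM; rewrite ?invr_ge0 ?powR_ge0//.
    by apply: ger_powR => //; rewrite /q addrC addKr ler_norm.
  rewrite powRN lef_pV2 ?posrE ?powR_gt0// ?normc1B_gt0//.
  apply: ge0_ler_powR; rewrite ?nnegrE ?normc_ge0 ?(ltW s0)//; first by lra.
  exact: normc1B_ge.
Qed.

(** The derivative is estimated by [area_point_estimate] and then integrated along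
    the segment from 0. *)
Lemma point_eval p al (r : R) : 1 <= p -> -1 < al -> r < 1 ->
  exists2 C : R, 0 <= C & forall f (e : R) z, holomorphic f -> 0 <= e ->
    (dnorm p al f <= e%:E)%E -> normc z <= r ->
    normc (f z) <= C * e /\ normc (cder f z) <= C * e.
Proof.
move=> p1 al1 r1; have p0 : 0 < p by lra.
have [K K0 HK] := area_point_estimate p1 al1.
set q := 2 + `|al| in HK; have q0 : 0 <= q by rewrite addr_ge0.
have r0 : 0 < 1 - r by lra.
pose C1 := (K * (1 - r) `^ (- q)) `^ p^-1.
have C10 : 0 <= C1 by exact: powR_ge0.
exists (1 + 2 * C1); first by rewrite addr_ge0// mulr_ge0.
move=> f e z Hf e0 He zr.
rewrite dnorm_le// energyE in He.
have D w : normc w <= r -> normc (cder f w) <= C1 * e.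
  move=> wr; have w1 : normc w < 1 by lra.
  apply: (@le_of_powR p) => //; first by rewrite mulr_ge0.
  rewrite powRM// -powRrM mulVf ?gt_eqF// powRr1 ?mulr_ge0 ?powR_ge0//.
  rewrite -lee_fin; apply: (le_trans (HK _ _ (holomorphic_cderiv Hf) w1)).
  rewrite -denergyE [leRHS]EFinM; apply: lee_pmul.
  - by rewrite lee_fin mulr_ge0 ?powR_ge0.
  - exact: denergy_ge0.
  - rewrite lee_fin ler_wpM2l// !powRN lef_pV2 ?posrE ?powR_gt0//; last lra.
    by apply: ge0_ler_powR; rewrite ?nnegrE//; lra.
  - by apply: le_trans He; rewrite leeDr// lee_fin powR_ge0.
split; last first.
  by apply: (le_trans (D z zr)); rewrite ler_wpM2r//; lra.
have f0 : normc (f 0) <= e.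
  apply: (@le_of_powR p) => //; rewrite -lee_fin; apply: le_trans He.
  by rewrite leeDl// denergy_ge0.
have M : normc (f z - f 0) <= 2 * (C1 * e) * normc (z - 0).
  have tz (t : R) : 0 <= t <= 1 -> normc (0 + t%:C * (z - 0)) <= r.
    move=> /andP[t0 t1]; rewrite add0r subr0 normcM normcR ger0_norm//.
    by apply: le_trans zr; rewrite ler_piMl ?normc_ge0.
  apply: (@cmean_value _ f (cder f)) => t t01; last by apply: D; exact: tz.
  by apply: has_cder => //; have : normc (0 + t%:C * (z - 0)) < 1 by rewrite (le_lt_trans (tz t t01)).
rewrite -(subrK (f 0) (f z)) (le_trans (le_normcD _ _))// mulrDl mul1r addrC lerD//.
rewrite (le_trans M)// subr0 -[2 * C1 * e]mulrA ler_piMr ?mulr_ge0//; lra.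
Qed.

End PointEvaluation.

Section PlaneMeasureSigmaFinite.
Context {R : realType}.
Notation mu := (@lebesgue_measure R).
Notation mu2 := ((@lebesgue_measure R) \x (@lebesgue_measure R))%E.

(** Lebesgue measure of the plane under a name of its own, so that it can
    carry the structure of a sigma-finite measure. *)
Definition plane_measure : set (measurableTypeR R * measurableTypeR R) -> \bar R := mu2.

HB.instance Definition _ := Measure.copy plane_measure mu2.

Lemma plane_measure_sigma_finite : sigma_finite setT plane_measure.
Proof.
exists (fun n : nat => `[(- n%:R)%R, n%:R]%classic `*` `[(- n%:R)%R, n%:R]%classic).
  apply/seteqP; split=> // x _; pose n := (Num.truncn (`|x.1| + `|x.2|)).+1.
  have xn : `|x.1| + `|x.2| < n%:R by exact: truncnS_gt.
  have x1 : `|x.1| <= n%:R by have := normr_ge0 x.2; lra.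
  have x2 : `|x.2| <= n%:R by have := normr_ge0 x.1; lra.
  by exists n => //; split; rewrite /= in_itv /= -ler_norml.
move=> n; split; first by apply: measurableX; exact: measurable_itv.
rewrite /plane_measure product_measure1E; [|exact: measurable_itv|exact: measurable_itv].
have nn : - n%:R <= n%:R :> R by rewrite -subr_ge0 opprK addr_ge0.
rewrite [X in (X * _)%E](_ : _ = (n%:R - - n%:R)%:E); last exact: lebesgue_segment.
rewrite [X in (_ * X)%E](_ : _ = (n%:R - - n%:R)%:E); last exact: lebesgue_segment.
by rewrite -EFinM ltry.
Qed.

HB.instance Definition _ := Measure_isSigmaFinite.Build _ _ _ plane_measure
  plane_measure_sigma_finite.

Lemma plane_integralZl (k : R) (I : R * R -> \bar R) : 0 <= k ->
  measurable_fun setT I -> (forall z, (0 <= I z)%E) ->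
  (\int[mu2]_z (k%:E * I z) = k%:E * \int[mu2]_z I z)%E.
Proof. by move=> k0 mI I0; rewrite ge0_integralZl// lee_fin. Qed.

Lemma plane_integral_leZ (k : R) (I J : R * R -> \bar R) : 0 <= k ->
  (forall z, (0 <= I z)%E) -> (forall z, (0 <= J z)%E) ->
  measurable_fun setT I -> measurable_fun setT J -> (forall z, (I z <= k%:E * J z)%E) ->
  (\int[mu2]_z I z <= k%:E * \int[mu2]_z J z)%E.
Proof.
move=> k0 I0 J0 mI mJ IJ; rewrite -plane_integralZl//.
by apply: ge0_le_integral => //; exact: emeasurable_funM.
Qed.

Lemma plane_integral_le (I J : R * R -> \bar R) : (forall z, (0 <= I z)%E) ->
  measurable_fun setT I -> measurable_fun setT J -> (forall z, (I z <= J z)%E) ->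
  (\int[mu2]_z I z <= \int[mu2]_z J z)%E.
Proof. by move=> I0 mI mJ IJ; apply: ge0_le_integral. Qed.

Lemma plane_tonelli2 (F : (R * R) * (R * R) -> \bar R) : measurable_fun setT F ->
  (forall x, (0 <= F x)%E) ->
  [/\ measurable_fun setT (fun z => \int[mu2]_w F (z, w))%E,
      measurable_fun setT (fun w => \int[mu2]_z F (z, w))%E &
      (\int[mu2]_z \int[mu2]_w F (z, w) = \int[mu2]_w \int[mu2]_z F (z, w))%E].
Proof.
move=> mF F0; split.
- exact: (@measurable_fun_fubini_tonelli_F _ _ _ _ R plane_measure F mF F0).
- exact: (@measurable_fun_fubini_tonelli_G _ _ _ _ R plane_measure F mF F0).
- exact: (@fubini_tonelli _ _ _ _ R plane_measure plane_measure F mF F0).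
Qed.

End PlaneMeasureSigmaFinite.

Section Carleson.
Context {R : realType}.
Implicit Types (f g : R[i] -> R[i]) (z w : R[i]).
Notation mu2 := ((@lebesgue_measure R) \x (@lebesgue_measure R))%E.

(** This form shows measurability jointly in several real coordinates. *)
Lemma normc_powR z (s : R) :
  normc z `^ s = (complex.Re z ^+ 2 + complex.Im z ^+ 2) `^ (s / 2).
Proof.
rewrite -normc_sqr -(powR_mulrn 2 (normc_ge0 z)) -powRrM mulrCA.
by rewrite divff ?mulr1.
Qed.

(** Up to the factor [((1 + be) * normc w) `^ p], the energy of
    [testF w be \o phi] when [q = (2 + be) * p]; see [denergy_testF]. *)
Definition carleson_mass (p al q : R) (phi : R[i] -> R[i]) (w : R[i]) : \bar R :=
  disc_integral al (fun z => (normc (1 - w^*%C * phi z) `^ (- q) * normc (cder phi z) `^ p)%R).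

(** Extension by zero, so that Tonelli's theorem can be used on the whole plane. *)
Definition patch0 (h : R[i] -> R) (w : R * R) : R := if w \in @disc2 R then h (pt w) else 0.

Lemma patch0_in h (w : R * R) : @disc2 R w -> patch0 h w = h (pt w).
Proof. by move=> wD; rewrite /patch0 mem_set. Qed.

Lemma patch0_out h (w : R * R) : ~ @disc2 R w -> patch0 h w = 0.
Proof. by move=> wD; rewrite /patch0 memNset. Qed.

Lemma measurable_patch0 h : disc_measurable h -> measurable_fun setT (patch0 h).
Proof.
move=> mh; have : measurable_fun setT ((h \o pt) \_ (@disc2 R)).
  by apply/(measurable_restrictT _ measurable_disc2).
by apply: eq_measurable_fun => w _; rewrite patchE.
Qed.

Lemma measurable_EFin_patch0 h :
  disc_measurable h -> measurable_fun setT (fun w : R * R => (patch0 h w)%:E).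
Proof. by move=> mh; apply: measurableT_comp => //; exact: measurable_patch0. Qed.

Lemma plane_int_patch0 h : plane_int (@disc2 R) h = (\int[mu2]_w (patch0 h w)%:E)%E.
Proof.
rewrite /plane_int integral_mkcond; apply: eq_integral => w _.
by rewrite patchE /patch0; case: ifP.
Qed.

Lemma disc_measurable_Re g : holomorphic g -> disc_measurable (fun z => complex.Re (g z)).
Proof. by move=> Hg; apply: measurable_normc_disc Hg _ => z z'; exact: Re_dist. Qed.

Lemma disc_measurable_Im g : holomorphic g -> disc_measurable (fun z => complex.Im (g z)).
Proof. by move=> Hg; apply: measurable_normc_disc Hg _ => z z'; exact: Im_dist. Qed.

(** [reproducing_estimate] is applied to [g] at the points [phi z] and integrated
    against [|phi'|^p dA_alpha]. After exchanging the integrals, the inner one is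
    [carleson_mass] and the weight [(1 - |w|^2) `^ (al + c)] splits into the density
    of [dA_alpha] and the factor in the hypothesis on [h]. *)
Lemma carleson (p al c : R) phi : 1 <= p -> -1 < al -> 0 < c -> 0 <= al + c ->
  holomorphic phi -> phi @` disc R `<=` disc R ->
  exists2 K : R, 0 <= K & forall g (h : R[i] -> R), holomorphic g -> disc_measurable h ->
    (forall w, disc R w -> ((normc (g w) `^ p * (1 - normc w ^+ 2) `^ c)%:E *
        carleson_mass p al (2 + al + c) phi w <= (h w)%:E)%E) ->
    (disc_integral al (fun z => (normc (g (phi z)) `^ p * normc (cder phi z) `^ p)%R)
      <= K%:E * disc_integral al h)%E.
Proof.
move=> p1 al1 c0 alc Hphi phiD; set q := 2 + al + c.
have q2 : 2 <= q by rewrite /q; lra.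
have al0 : 0 < 1 + al by lra.
pose K0 := 256 `^ p * 10 `^ q : R; have K00 : 0 <= K0 by rewrite mulr_ge0 ?powR_ge0.
have [kap kapE c00] : exists2 kap : R, kap = pi / (1 + al) & 0 <= kap.
  by exists (pi / (1 + al)); rewrite ?divr_ge0 ?pi_ge0// ltW.
exists (K0 * kap); first by rewrite mulr_ge0.
move=> g h Hg mh Hh.
pose a z := normc (cder phi z) `^ p * weight al z.
have a0 z : 0 <= a z by rewrite mulr_ge0 ?powR_ge0 ?weight_ge0.
pose b w := (1 - normc w ^+ 2) `^ (q - 2) * normc (g w) `^ p.
have b0 w : 0 <= b w by rewrite mulr_ge0 ?powR_ge0.
have mp : disc_measurable (fun z => normc (cder phi z) `^ p) by exact: disc_measurable_cderiv.
have ma : disc_measurable a by apply: disc_measurableM => //; exact: disc_measurable_weight.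
have mg : disc_measurable (fun w => normc (g w) `^ p).
  by apply: disc_measurable_powR; exact: disc_measurable_normc.
have mb : disc_measurable b.
  apply: disc_measurableM => //; apply: disc_measurable_powR; apply: measurable_funB => //.
  by apply: measurable_funX; exact: (disc_measurable_normc holomorphic_id).
pose Z (z : R * R) : R[i] := patch0 (fun z => complex.Re (phi z)) z +i* patch0 (fun z => complex.Im (phi z)) z.
have ZE (z : R * R) : @disc2 R z -> Z z = phi (pt z).
  by move=> zD; rewrite /Z !patch0_in//; case: (phi (pt z)).
pose F (x : (R * R) * (R * R)) : \bar R :=
  (patch0 a x.1 * patch0 b x.2 * normc (1 - (pt x.2)^*%C * Z x.1) `^ (- q))%:E.
have pa0 (x : R * R) : 0 <= patch0 a x by rewrite /patch0; case: ifP.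
have pb0 (x : R * R) : 0 <= patch0 b x by rewrite /patch0; case: ifP.
have F0 x : (0 <= F x)%E by rewrite lee_fin !mulr_ge0 ?powR_ge0.
have mF : measurable_fun setT F.
  apply: measurableT_comp => //; apply: measurable_funM.
    apply: measurable_funM.
      by apply: measurableT_comp; [exact: measurable_patch0|exact: measurable_fst].
    by apply: measurableT_comp; [exact: measurable_patch0|exact: measurable_snd].
  rewrite (_ : (fun x => _) = (fun x : (R * R) * (R * R) =>
     ((1 - (x.2.1 * complex.Re (Z x.1) + x.2.2 * complex.Im (Z x.1))) ^+ 2 +
      (x.2.2 * complex.Re (Z x.1) - x.2.1 * complex.Im (Z x.1)) ^+ 2) `^ (- q / 2))); last first.
    apply/funext => x; rewrite normc_powR; congr (_ `^ _).
    by case: x => x [w1 w2] /=; case: (Z x) => u v /=; ring.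
  have m1 : measurable_fun setT (fun x : (R * R) * (R * R) => x.2.1).
    by apply: measurableT_comp => //; exact: measurable_snd.
  have m2 : measurable_fun setT (fun x : (R * R) * (R * R) => x.2.2).
    by apply: measurableT_comp => //; exact: measurable_snd.
  have m3 : measurable_fun setT (fun x : (R * R) * (R * R) => complex.Re (Z x.1)).
    apply: (@measurableT_comp _ _ _ _ _ _ (patch0 (fun z => complex.Re (phi z)))).
      by apply: measurable_patch0; exact: disc_measurable_Re.
    exact: measurable_fst.
  have m4 : measurable_fun setT (fun x : (R * R) * (R * R) => complex.Im (Z x.1)).
    apply: (@measurableT_comp _ _ _ _ _ _ (patch0 (fun z => complex.Im (phi z)))).
      by apply: measurable_patch0; exact: disc_measurable_Im.
    exact: measurable_fst.
  apply: (measurableT_comp (measurable_powR (- q / 2))); apply: measurable_funD.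
    apply: measurable_funX; apply: measurable_funB => //.
    by apply: measurable_funD; apply: measurable_funM.
  by apply: measurable_funX; apply: measurable_funB; apply: measurable_funM.
have [mI mJ tonelli] := plane_tonelli2 mF F0.
have S1 : (disc_integral al (fun z => (normc (g (phi z)) `^ p * normc (cder phi z) `^ p)%R) <=
    K0%:E * \int[mu2]_z \int[mu2]_w F (z, w))%E.

  have I0 (z : R * R) : (0 <= \int[mu2]_w F (z, w))%E by apply: integral_ge0.
  rewrite disc_integralE plane_int_patch0; apply: (plane_integral_leZ K00 _ I0 _ mI).
  - move=> z; rewrite lee_fin /patch0; case: ifP => _; last exact: lexx.
    by apply: mulr_ge0; [apply: mulr_ge0; exact: powR_ge0|exact: weight_ge0].
  - apply: measurable_EFin_patch0.
    apply: disc_measurableM; last exact: disc_measurable_weight.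
    apply: disc_measurableM; last exact: mp; apply: disc_measurable_powR.
    by apply: (disc_measurable_normc (g := g \o phi)); exact: holomorphic_comp.
  - move=> z; have [zD|zD] := pselect (@disc2 R z); last first.
      rewrite (patch0_out _ zD); apply: mule_ge0; last exact: I0.
      by rewrite lee_fin; exact: K00.
    have phz : disc R (phi (pt z)) by apply: phiD; exists (pt z).
    have E : (\int[mu2]_w F (z, w))%E = ((a (pt z))%:E *
        plane_int (@disc2 R) (fun w => (kernelq q w (phi (pt z)) * normc (g w) `^ p)%R))%E.
      rewrite -dintZ; last 3 first.
      - by apply: disc_measurableM; [exact: measurable_kernelq|exact: mg].
      - exact: a0.
      - by move=> w _; apply: mulr_ge0; [exact: kernelq_ge0|exact: powR_ge0].
      rewrite plane_int_patch0; apply: eq_integral => w _; congr EFin.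
      have [wD|wD] := pselect (@disc2 R w); last by rewrite /= !(patch0_out _ wD) mulr0 mul0r.
      rewrite -[LHS]/(patch0 a z * patch0 b w * normc (1 - (pt w)^*%C * Z z) `^ (- q)).
      rewrite (ZE _ zD) !(patch0_in _ wD) (patch0_in _ zD) /b /kernelq powRN.
      by clear; ring.
    rewrite E (patch0_in _ zD) muleCA.
    have := reproducing_estimate p1 q2 Hg phz; rewrite -/K0.
    move=> /(lee_wpmul2l (x := (a (pt z))%:E)); rewrite lee_fin => /(_ (a0 _)).
    apply: le_trans; rewrite -EFinM lee_fin /a.
    by rewrite -mulrA mulrC.
apply: (le_trans S1); rewrite tonelli (EFinM K0 kap) -(muleA K0%:E).
apply: lee_wpmul2l; first by rewrite lee_fin; exact: K00.
clear S1 tonelli mI mF.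
have mhw : disc_measurable (fun w => h w * weight al w).
  by apply: disc_measurableM; [exact: mh|exact: disc_measurable_weight].
have J0 w : (0 <= carleson_mass p al q phi w)%E.
  by apply: disc_integral_ge0 => // z _; rewrite mulr_ge0 ?powR_ge0.
have h0 w : disc R w -> 0 <= h w.
  move=> wD; rewrite -lee_fin; apply: le_trans (Hh w wD).
  by rewrite mule_ge0// lee_fin mulr_ge0 ?powR_ge0.
rewrite disc_integralE -dintZ; last 3 first.
- exact: mhw.
- exact: c00.
- by move=> w wD; apply: mulr_ge0; [exact: h0|exact: weight_ge0].
rewrite plane_int_patch0; apply: plane_integral_le.
- by move=> w; apply: integral_ge0.
- exact: mJ.
- apply: measurable_EFin_patch0.
  by apply: disc_measurableM; [exact: disc_measurable_cst|exact: mhw].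
move=> w; have [wD|wD] := pselect (@disc2 R w); last first.
  rewrite (patch0_out _ wD) integral0_eq; first exact: lexx.
  by move=> z _; rewrite /F /= [patch0 b w](patch0_out _ wD) mulr0 mul0r.
have mk : disc_measurable (fun z => normc (1 - (pt w)^*%C * phi z) `^ (- q)).
  apply: disc_measurable_powR.
  exact: (disc_measurable_normc (holomorphic_comp (@holomorphic_kernel _ (pt w)^*%C) Hphi phiD)).
have E : (\int[mu2]_z F (z, w))%E = ((b (pt w))%:E * carleson_mass p al q phi (pt w))%E.
  rewrite /carleson_mass disc_integralE -dintZ; last 3 first.
  - apply: disc_measurableM; last exact: disc_measurable_weight.
    by apply: disc_measurableM; [exact: mk|exact: mp].
  - exact: b0.
  - by move=> z _; apply: mulr_ge0; [apply: mulr_ge0; exact: powR_ge0|exact: weight_ge0].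
  rewrite plane_int_patch0; apply: eq_integral => z _; congr EFin.
  have [zD|zD] := pselect (@disc2 R z); last by rewrite /= !(patch0_out _ zD) !mul0r.
  rewrite -[LHS]/(patch0 a z * patch0 b w * normc (1 - (pt w)^*%C * Z z) `^ (- q)).
  rewrite (ZE _ zD) !(patch0_in _ zD) (patch0_in _ wD) /a.
  by clear; ring.
rewrite E (patch0_in _ wD).
have w1 : normc (pt w) < 1 := wD.
have w0 : 0 < 1 - normc (pt w) ^+ 2.
  by have := normc_ge0 (pt w); have := w1; clear; move=> ? ?; nra.
have bE : b (pt w) = (1 - normc (pt w) ^+ 2) `^ al *
    (normc (g (pt w)) `^ p * (1 - normc (pt w) ^+ 2) `^ c).
  rewrite /b (_ : q - 2 = al + c); last by rewrite /q; ring.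
  by rewrite powRD ?(gt_eqF w0) ?implybT//; ring.
rewrite bE EFinM -muleA.
apply: (@le_trans _ _ (((1 - normc (pt w) ^+ 2) `^ al)%:E * (h (pt w))%:E)%E).
  by rewrite lee_wpmul2l ?lee_fin ?powR_ge0//; exact: Hh.
have n1 : 1 + al != 0 by rewrite gt_eqF.
have n2 : pi != 0 :> R by rewrite gt_eqF ?pi_gt0.
rewrite -EFinM lee_fin /weight le_eqVlt; apply/orP; left; apply/eqP.
rewrite kapE; move: (pi : R) n2 => P n2.
by field; rewrite n1 n2.
Qed.

End Carleson.

(** * Test functions and bounded composition operators *)

Section TestFunctions.
Context {R : realType}.
Implicit Types (f g phi : R[i] -> R[i]) (z w l : R[i]) (p al be c : R).

(** The density that controls the pull-back of [|f'|^p] by [phi], as in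
    [denergy_comp]; boundedness and compactness of [C_phi] are read off from its
    being bounded, respectively vanishing at the circle. *)
Definition carleson_fun p al c phi w : \bar R :=
  (((1 - normc w ^+ 2) `^ c)%:E * carleson_mass p al (2 + al + c) phi w)%E.

Lemma carleson_mass_ge0 p al q phi w : -1 < al -> (0 <= carleson_mass p al q phi w)%E.
Proof.
move=> al1; apply: disc_integral_ge0 => // z _.
by apply: mulr_ge0; exact: powR_ge0.
Qed.

Lemma carleson_fun_ge0 p al c phi w : -1 < al -> (0 <= carleson_fun p al c phi w)%E.
Proof.
move=> al1; apply: mule_ge0; last exact: carleson_mass_ge0.
by rewrite lee_fin powR_ge0.
Qed.

Lemma one_sub_sqr l : normc l < 1 -> 0 < 1 - normc l ^+ 2 <= 1.
Proof. by move=> l1; have := normc_ge0 l; move=> ?; apply/andP; split; nra. Qed.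

Lemma holomorphic_testF l be : 0 <= be -> normc l < 1 -> holomorphic (testF l be).
Proof.
move=> be0 l1; apply: holomorphicI => z z1.
by have [d Hd _] := has_cderiv_testF be0 l1 z1; exists d.
Qed.

Lemma normc_cder_testF l be z : 0 <= be -> normc l < 1 -> normc z < 1 ->
  normc (cder (testF l be) z) = (1 + be) * normc l / normc (1 - l^*%C * z) `^ (2 + be).
Proof. by move=> be0 l1 z1; have [d /cderP -> ->] := has_cderiv_testF be0 l1 z1. Qed.

Lemma disc_measurable_mass p q phi l : holomorphic phi -> phi @` disc R `<=` disc R ->
  disc_measurable (fun z => normc (1 - l^*%C * phi z) `^ (- q) * normc (cder phi z) `^ p).
Proof.
move=> Hphi phiD; apply: disc_measurableM; last exact: disc_measurable_cderiv.
apply: disc_measurable_powR.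
exact: (disc_measurable_normc (holomorphic_comp (@holomorphic_kernel _ l^*%C) Hphi phiD)).
Qed.

(** [|F'| = (1 + be) |l| / |1 - conj l z| `^ (2 + be)] for [F = testF l be]. *)
Lemma denergy_testF p al be phi l : 0 < p -> -1 < al -> 0 <= be ->
  holomorphic phi -> phi @` disc R `<=` disc R -> normc l < 1 ->
  denergy p al (testF l be \o phi) =
    ((((1 + be) * normc l) `^ p)%:E * carleson_mass p al ((2 + be) * p) phi l)%E.
Proof.
move=> p0 al1 be0 Hphi phiD l1; rewrite denergyE /carleson_mass.
rewrite -disc_integralZ ?powR_ge0//; last 2 first.
- exact: disc_measurable_mass.
- by move=> z _; apply: mulr_ge0; exact: powR_ge0.
rewrite !disc_integralE; apply: dint_eq => z zD; congr (_ * _).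
have pz : normc (phi z) < 1 by apply: phiD; exists z.
have be1 : 0 <= 1 + be by lra.
rewrite (cder_comp (holomorphic_testF be0 l1) Hphi phiD zD).
rewrite normcM (normc_cder_testF be0 l1 pz); move: (normc_ge0 (cder phi z)).
move: (normc (cder phi z)) => d d0.
have l0 := normc_ge0 l; have bl : 0 <= (1 + be) * normc l by exact: mulr_ge0.
have i0 : 0 <= (normc (1 - l^*%C * phi z) `^ (2 + be))^-1 by rewrite invr_ge0 powR_ge0.
by rewrite (powRM _ (mulr_ge0 bl i0) d0) (powRM _ bl i0) -mulrA -powRN -powRrM mulNr.
Qed.

(** [|1 - conj l phi| >= 1 - |l|]. *)
Lemma carleson_mass_le p al q phi l r : -1 < al -> 0 <= q ->
  holomorphic phi -> phi @` disc R `<=` disc R -> r < 1 -> normc l <= r ->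
  (carleson_mass p al q phi l <= ((1 - r) `^ (- q))%:E * denergy p al phi)%E.
Proof.
move=> al1 q0 Hphi phiD r1 lr; have l1 : normc l < 1 by lra.
rewrite denergyE -(disc_integralZ al1 (disc_measurable_cderiv p Hphi) (powR_ge0 _ _)); last first.
  by move=> z _; exact: powR_ge0.
apply: disc_integral_le => //.
- exact: disc_measurable_mass.
- by apply: disc_measurableM; [exact: disc_measurable_cst|exact: disc_measurable_cderiv].
- move=> z zD; rewrite mulr_ge0 ?powR_ge0//=.
  have pz : normc (phi z) < 1 by apply: phiD; exists z.
  rewrite ler_wpM2r ?powR_ge0// !powRN lef_pV2 ?posrE ?powR_gt0 ?subr_gt0// ?normc1B_gt0//.
  apply: ge0_ler_powR; rewrite ?nnegrE ?normc_ge0 ?subr_ge0 ?(ltW r1)//.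
  have := ler_normcB 1 (l^*%C * phi z); rewrite normc1 normcM normc_conj.
  apply: le_trans; rewrite lerD2l lerN2.
  by rewrite (le_trans _ lr)// ler_piMr ?normc_ge0// ltW.
Qed.

Lemma cder_id z : cder (id : R[i] -> R[i]) z = 1.
Proof. exact: (cderP (has_cderiv_id z)). Qed.

(** [denergy_testF] for the identity map, where [carleson_mass] is the integral of
    [forelli_rudin]. *)
Lemma energy_testF_le p al be c : 1 <= p -> -1 < al -> 0 <= be -> 0 < c ->
  2 + al + c = (2 + be) * p ->
  exists2 C : R, 0 <= C & forall l, normc l < 1 ->
    (((1 - normc l ^+ 2) `^ c)%:E * energy p al (testF l be) <= C%:E)%E.
Proof.
move=> p1 al1 be0 c0 qE; have p0 : 0 < p by lra.
have [C C0 HC] := forelli_rudin al1 c0.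
have al0 : 0 <= 1 + al by lra.
have k0 : 0 <= (1 + al) / pi by rewrite divr_ge0 ?pi_ge0.
exists (1 + 2 `^ c * ((1 + be) `^ p * ((1 + al) / pi * C))).
  apply: addr_ge0 => //; apply: mulr_ge0; first exact: powR_ge0.
  by apply: mulr_ge0; [exact: powR_ge0|exact: mulr_ge0].
move=> l l1; have /andP[s0 s1] := one_sub_sqr l1; have l0 := normc_ge0 l.
have t0 : 0 < 1 - normc l by lra.
have idD : id @` disc R `<=` disc R by move=> _ [z ? <-].
have M : (carleson_mass p al ((2 + be) * p) id l <=
    ((1 + al) / pi * (C * (1 - normc l) `^ (- c)))%:E)%E.
  have mh : disc_measurable (fun w => (1 - normc w ^+ 2) `^ al / normc (1 - l^*%C * w) `^ (2 + al + c)).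
    exact: measurable_forelli.
  have -> : carleson_mass p al ((2 + be) * p) id l = (((1 + al) / pi)%:E * plane_int (@disc2 R)
     (fun w => ((1 - normc w ^+ 2) `^ al / normc (1 - l^*%C * w) `^ (2 + al + c))%R))%E.
    rewrite -dintZ//; last by move=> z _; rewrite mulr_ge0 ?invr_ge0 ?powR_ge0.
    rewrite /carleson_mass disc_integralE; apply: dint_eq => z _.
    rewrite cder_id normc1 powR1 mulr1 /weight qE powRN.
    by move: (pi : R) => P; ring.
  rewrite (EFinM ((1 + al) / pi)); apply: lee_wpmul2l; first by rewrite lee_fin.
  exact: HC.
rewrite energyE ge0_muleDr ?lee_fin ?powR_ge0 ?denergy_ge0// EFinD; apply: leeD.
  rewrite -EFinM lee_fin normc_testF mulr0 subr0 normc1 powR1 invr1 powR1 mulr1.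
  by rewrite -[leRHS](powRr0 (1 - normc l ^+ 2)); apply: ger_powR; rewrite ?s0// ltW.
have -> : denergy p al (testF l be) = denergy p al (testF l be \o id) by [].
rewrite (denergy_testF p0 al1 be0 (@holomorphic_id R) idD l1).
apply: (@le_trans _ _ ((2 `^ c * (1 - normc l) `^ c)%:E *
    (((1 + be) `^ p)%:E * ((1 + al) / pi * (C * (1 - normc l) `^ (- c)))%:E))%E).
  apply: lee_pmul.
  - by rewrite lee_fin powR_ge0.
  - by apply: mule_ge0; [rewrite lee_fin powR_ge0|exact: carleson_mass_ge0].
  - rewrite lee_fin -powRM ?(ltW t0)//; apply: ge0_ler_powR; rewrite ?nnegrE ?(ltW c0) ?(ltW s0)//.
      by rewrite mulr_ge0 ?(ltW t0).
    nra.
  - apply: lee_pmul => //; rewrite ?lee_fin ?powR_ge0//; first exact: carleson_mass_ge0.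
    apply: ge0_ler_powR; rewrite ?nnegrE ?mulr_ge0 ?(ltW p0)//; try lra.
    by rewrite ler_piMr ?(ltW l1)//; lra.
rewrite -!EFinM lee_fin le_eqVlt; apply/orP; left; apply/eqP.
have e1 : (1 - normc l) `^ c * (1 - normc l) `^ (- c) = 1.
  by rewrite powRN divff// gt_eqF ?powR_gt0.
transitivity (2 `^ c * ((1 + be) `^ p * ((1 + al) / pi * C)) *
   ((1 - normc l) `^ c * (1 - normc l) `^ (- c))); last by rewrite e1 mulr1.
by move: ((1 + al) / pi : R) => P; ring.
Qed.

Lemma scaled_dnorm_le p al f (a M : R) : 0 < p -> -1 < al -> 0 < a -> 0 <= M ->
  (a%:E * dnorm p al f <= M%:E)%E = ((a `^ p)%:E * energy p al f <= (M `^ p)%:E)%E.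
Proof.
move=> p0 al1 a0 M0.
rewrite -(lee_pdivlMl _ _ a0) -EFinM dnorm_le// ?mulr_ge0 ?invr_ge0 ?(ltW a0)//.
rewrite -(lee_pdivlMl _ _ (powR_gt0 p a0)) -EFinM powRM ?invr_ge0 ?(ltW a0)//.
by rewrite -(powR_inv1 (ltW a0)) -powRrM mulN1r powRN.
Qed.

(** The energy of [testF l be \o phi] contains
    [((1 + be) * normc l) `^ p * carleson_mass], where [1 + be >= 1] and
    [normc l >= 2^-1]. *)
Lemma carleson_fun_test p al be c phi l (M : R) : 0 < p -> -1 < al -> 0 <= be ->
  2 + al + c = (2 + be) * p ->
  holomorphic phi -> phi @` disc R `<=` disc R -> 2^-1 <= normc l -> normc l < 1 ->
  0 <= M ->
  (((1 - normc l ^+ 2) `^ (c / p))%:E * dnorm p al (testF l be \o phi) <= M%:E)%E ->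
  (carleson_fun p al c phi l <= ((2 * M) `^ p)%:E)%E.
Proof.
move=> p0 al1 be0 qE Hphi phiD l2 l1 M0; have /andP[s0 s1] := one_sub_sqr l1.
rewrite scaled_dnorm_le ?powR_gt0// -powRrM mulfVK ?gt_eqF// => H.
rewrite /carleson_fun qE powRM// EFinM -lee_pdivrMl ?powR_gt0//.
apply: le_trans H; rewrite muleCA lee_wpmul2l ?lee_fin ?powR_ge0//.
rewrite energyE denergy_testF//.
apply: (@le_trans _ _ ((((1 + be) * normc l) `^ p)%:E * carleson_mass p al ((2 + be) * p) phi l)%E).
  apply: lee_wpmul2r; first exact: carleson_mass_ge0.
  rewrite lee_fin -powRN -[in leLHS](mulN1r p) powRrM powR_inv1//.
  apply: ge0_ler_powR; rewrite ?nnegrE ?(ltW p0)//.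
    by rewrite mulr_ge0 ?normc_ge0//; lra.
  nra.
by rewrite leeDr// lee_fin powR_ge0.
Qed.

End TestFunctions.

Section Boundedness.
Context {R : realType}.
Implicit Types (f g phi : R[i] -> R[i]) (z w l : R[i]) (p al be c : R).

Lemma denergy_comp p al c phi : 1 <= p -> -1 < al -> 0 < c -> 0 <= al + c ->
  holomorphic phi -> phi @` disc R `<=` disc R ->
  exists2 K : R, 0 <= K & forall f (h : R[i] -> R), holomorphic f -> disc_measurable h ->
    (forall w, disc R w ->
      ((normc (cder f w) `^ p)%:E * carleson_fun p al c phi w <= (h w)%:E)%E) ->
    (denergy p al (f \o phi) <= K%:E * disc_integral al h)%E.
Proof.
move=> p1 al1 c0 alc Hphi phiD; have [K K0 HK] := carleson p1 al1 c0 alc Hphi phiD.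
exists K => // f h Hf mh Hh.
have -> : denergy p al (f \o phi) =
    disc_integral al (fun z => (normc (cder f (phi z)) `^ p * normc (cder phi z) `^ p)%R).
  rewrite denergyE !disc_integralE; apply: dint_eq => z zD.
  by rewrite cder_comp// normcM powRM ?normc_ge0.
apply: HK; [exact: holomorphic_cderiv|exact: mh|].
by move=> w wD; rewrite EFinM -muleA; exact: Hh.
Qed.

Lemma dnorm_fin p al f : (dnorm p al f < +oo)%E ->
  exists2 e : R, 0 <= e & dnorm p al f = e%:E.
Proof.
have := dnorm_nneg p al f; case: (dnorm p al f) => [e| |]//; rewrite lee_fin => e0 _.
by exists e.
Qed.

(** [denergy_comp] takes care of the derivative, and point evaluation at [phi 0] of
    the value at 0. *)
Lemma composition_bounded p al c phi (S : R) : 1 <= p -> -1 < al -> 0 < c -> 0 <= al + c ->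
  holomorphic phi -> phi @` disc R `<=` disc R -> 0 <= S ->
  (forall w, disc R w -> (carleson_fun p al c phi w <= S%:E)%E) ->
  bounded_on_dirichlet p al (composition phi).
Proof.
move=> p1 al1 c0 alc Hphi phiD S0 HS; have p0 : 0 < p by lra.
have [K K0 HK] := denergy_comp p1 al1 c0 alc Hphi phiD.
have ph0 : normc (phi 0) < 1 by apply: phiD; exists 0 => //; exact: disc0.
have [C C0 HC] := point_eval p1 al1 ph0.
pose M := (C `^ p + K * S) `^ p^-1.
have KS : 0 <= C `^ p + K * S by rewrite addr_ge0 ?powR_ge0// mulr_ge0.
suff key f : dirichlet_space p al f -> (dnorm p al (composition phi f) <= M%:E * dnorm p al f)%E.
  split; last by exists M => f /key; rewrite !dnormE.
  move=> f Df; have [Hf fy] := Df; split; first exact: holomorphic_comp.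
  rewrite -dnormE; apply: le_lt_trans (key _ Df) _; rewrite -dnormE in fy.
  by have [e e0 ->] := dnorm_fin fy; rewrite -EFinM ltry.
move=> [Hf]; rewrite -dnormE => fy; have [e e0 fe] := dnorm_fin fy.
have fe' : (dnorm p al f <= e%:E)%E by rewrite fe.
have M0 : 0 <= M by exact: powR_ge0.
rewrite fe -EFinM dnorm_le ?mulr_ge0//.
rewrite powRM// -powRrM mulVf ?gt_eqF// powRr1// mulrDl EFinD energyE; apply: leeD.
  have [h _] := HC f e (phi 0) Hf e0 fe' (lexx _).
  rewrite lee_fin -powRM//; apply: ge0_ler_powR; rewrite ?nnegrE ?normc_ge0 ?mulr_ge0//.
  exact: ltW.
have mh : disc_measurable (fun z => normc (cder f z) `^ p) by exact: disc_measurable_cderiv.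
apply: (le_trans (HK f (fun w => S * normc (cder f w) `^ p) Hf _ _)).
- by apply: disc_measurableM; [exact: disc_measurable_cst|].
- move=> w wD; rewrite mulrC EFinM; apply: lee_wpmul2l; first by rewrite lee_fin powR_ge0.
  exact: HS.
rewrite disc_integralZ//; last by move=> z _; exact: powR_ge0.
rewrite muleA -EFinM (EFinM (K * S)); apply: lee_wpmul2l; first by rewrite lee_fin mulr_ge0.
rewrite -denergyE; rewrite dnorm_le// energyE in fe'; apply: le_trans fe'.
by rewrite leeDr// lee_fin powR_ge0.
Qed.

End Boundedness.

(** * Normal families along ultrafilters *)

Section UltraLimits.
Context {R : realType} {T : Type} (U : set_system T) {UF : UltraFilter U}.

(** The limit is the supremum of the [t] such that [t <= u] on a set of the
    ultrafilter: any number exceeding it is exceeded by [u] only off such a set. *)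
Lemma ultra_limitR (u : T -> R) (C : R) : U [set h | `|u h| <= C] ->
  exists L : R, forall e : R, 0 < e -> U [set h | `|u h - L| <= e].
Proof.
move=> UC; pose A := [set t : R | U [set h | t <= u h]].
have AC : A (- C) by apply: filterS UC => h /=; rewrite ler_norml => /andP[].
have ubA t : A t -> t <= C.
  move=> At; have [h [/= th]] := filter_ex (filterI At UC).
  by rewrite ler_norml => /andP[_ uC]; exact: le_trans th uC.
have supA : has_sup A by split; [exists (- C)|exists C].
exists (sup A) => e e0; have [t At te] := sup_adherent e0 supA.
have N : ~ A (sup A + e).
  by move=> /(ub_le_sup (proj2 supA)); rewrite leNgt ltrDl e0.
have [//|N'] := in_ultra_setVsetC [set h | sup A + e <= u h] UF.
apply: filterS (filterI At N') => h [/= th /negP]; rewrite -ltNge => uh.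
by rewrite ler_norml; apply/andP; split; lra.
Qed.

Lemma ultra_limitC (u : T -> R[i]) (C : R) : U [set h | normc (u h) <= C] ->
  exists L : R[i], forall e : R, 0 < e -> U [set h | normc (u h - L) <= e].
Proof.
move=> UC.
have [a Ha] : exists L : R, forall e : R, 0 < e -> U [set h | `|complex.Re (u h) - L| <= e].
  by apply: (@ultra_limitR _ C); apply: filterS UC => h /=; exact: le_trans (normc_Re _).
have [b Hb] : exists L : R, forall e : R, 0 < e -> U [set h | `|complex.Im (u h) - L| <= e].
  by apply: (@ultra_limitR _ C); apply: filterS UC => h /=; exact: le_trans (normc_Im _).
exists (a +i* b) => e e0; have e2 : 0 < e / 2 by lra.
apply: filterS (filterI (Ha _ e2) (Hb _ e2)) => h [/= h1 h2].
rewrite (le_trans (normc_le_ReIm _))// ReDc ImDc ReNc ImNc /=; lra.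
Qed.

End UltraLimits.

Section Exhaustion.
Context {R : realType}.
Notation mu2 := ((@lebesgue_measure R) \x (@lebesgue_measure R))%E.

(** Monotone convergence along concentric discs. The comparison function may change
    with the disc, as it does for a locally uniform limit. *)
Lemma dint_exhaust (k : R[i] -> R) (M : R) : disc_measurable k ->
  (forall z, disc R z -> 0 <= k z) ->
  (forall r : R, r < 1 -> exists g : R[i] -> R, [/\ disc_measurable g,
     forall z, disc R z -> 0 <= g z, forall z, normc z < r -> k z <= g z &
     (plane_int (@disc2 R) g <= M%:E)%E]) ->
  (plane_int (@disc2 R) k <= M%:E)%E.
Proof.
move=> mk k0 H; pose rr n : R := 1 - n.+1%:R^-1.
have r1 n : rr n < 1 by rewrite /rr ltrBlDr ltrDl invr_gt0.
pose F n : set (R * R) := @disc2 R `&` [set w | normc (pt w) < rr n].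
have FS n : F n `<=` @disc2 R by move=> w [].
have mF n : measurable (F n).
  have mn : disc_measurable (fun z : R[i] => normc z) := disc_measurable_normc holomorphic_id.
  have := mn measurable_disc2 `]-oo, rr n[%classic (measurable_itv _).
  by congr measurable; apply/seteqP; split=> w [wD] /=; rewrite in_itv.
have FE : @disc2 R = \bigcup_n F n.
  apply/seteqP; split=> [w wD|w [n _ []]//]; have w1 : normc (pt w) < 1 := wD.
  have s0 : 0 < 1 - normc (pt w) by rewrite subr_gt0.
  exists (Num.truncn (1 - normc (pt w))^-1) => //; split=> //=; rewrite /rr ltrBrDr addrC -ltrBrDr.
  by rewrite invf_plt ?posrE//; exact: truncnS_gt.
have mkF n : measurable_fun (F n) (fun w => (k (pt w))%:E).
  by apply: measurable_funS (measurable_EFin2 mk) => //; exact: measurable_disc2.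
have nd : {homo F : n m / (n <= m)%N >-> (n <= m)%O}.
  move=> n m nm; apply/subsetPset => w [wD /= wn]; split=> //=; apply: lt_le_trans wn _.
  by rewrite /rr lerD2l lerN2 lef_pV2 ?posrE// ler_nat.
have kF0 n (w : R * R) : F n w -> (0 <= (k (pt w))%:E)%E by move=> /FS wD; rewrite lee_fin; exact: k0.
have cv := ge0_nondecreasing_set_cvg_integral (mu := mu2) nd mF mkF kF0.
rewrite /plane_int [X in (\int[_]_(_ in X) _ <= _)%E]FE -(cvg_lim _ cv)//.
apply: lime_le; first by apply/cvg_ex; eexists; exact: cv.
apply: nearW => n; have [g [mg g0 kg gM]] := H _ (r1 n).
apply: le_trans gM; apply: (@le_trans _ _ (\int[mu2]_(w in F n) (g (pt w))%:E)%E).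
  apply: ge0_le_integral.
  - exact: mF.
  - exact: kF0.
  - exact: mkF.
  - by apply: measurable_funS (measurable_EFin2 mg) => //; exact: measurable_disc2.
  - by move=> w [wD wn]; rewrite lee_fin; exact: kg.
apply: ge0_subset_integral.
- exact: mF.
- exact: measurable_disc2.
- exact: measurable_EFin2.
- by move=> w wD; rewrite lee_fin; exact: g0.
- exact: FS.
Qed.

(** Either [y <= s * x] or [x <= y / s]. The point is that the constant in front of
    [x `^ p] tends to 1 with [s]. *)
Lemma ler_powRD (p s x y : R) : 0 < p -> 0 < s -> 0 <= x -> 0 <= y ->
  (x + y) `^ p <= (1 + s) `^ p * x `^ p + (1 + s^-1) `^ p * y `^ p.
Proof.
move=> p0 s0 x0 y0; have si : 0 < s^-1 by rewrite invr_gt0.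
have [h|h] := leP y (s * x).
- apply: (@le_trans _ _ (((1 + s) * x) `^ p)).
    by apply: ge0_ler_powR; rewrite ?nnegrE; nra.
  by rewrite powRM//; [rewrite lerDl mulr_ge0 ?powR_ge0|lra].
- have h' : x <= s^-1 * y by rewrite ler_pdivlMl// ltW.
  apply: (@le_trans _ _ (((1 + s^-1) * y) `^ p)).
    by apply: ge0_ler_powR; rewrite ?nnegrE; nra.
  by rewrite powRM//; [rewrite lerDr mulr_ge0 ?powR_ge0|lra].
Qed.

Lemma adde_le_real (x z : R) (y : \bar R) : (x%:E + y <= z%:E)%E = (y <= (z - x)%:E)%E.
Proof.
case: y => [y| |]; first by rewrite -EFinD !lee_fin lerBrDl.
  by rewrite addey// !leye_eq.
by rewrite addeNy !leNye.
Qed.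

Lemma disc_area_fin (al : R) : -1 < al ->
  exists2 A : R, 0 <= A & (disc_integral al (fun _ : R[i] => 1%R) <= A%:E)%E.
Proof.
move=> al1; have [C C0 HC] := forelli_rudin al1 (@ltr01 R).
have al0 : 0 <= 1 + al by lra.
have k0 : 0 <= (1 + al) / pi by rewrite divr_ge0 ?pi_ge0.
exists ((1 + al) / pi * C); first exact: mulr_ge0.
have z0 : normc (0 : R[i]) < 1 by rewrite normc0.
have := HC 0 z0; rewrite normc0 subr0 powR1 mulr1 => H.
rewrite (EFinM ((1 + al) / pi)).
apply: le_trans (lee_wpmul2l _ H); last by rewrite lee_fin.
rewrite -dintZ; last 3 first.
- exact: measurable_forelli.
- exact: k0.
- by move=> z _; rewrite mulr_ge0 ?invr_ge0 ?powR_ge0.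
rewrite disc_integralE le_eqVlt; apply/orP; left; apply/eqP; apply: dint_eq => z _.
rewrite conjc0 mul0r subr0 normc1 powR1 divr1 mul1r /weight.
by move: (pi : R) => P; ring.
Qed.

End Exhaustion.

Section NormalFamilies.
Context {R : realType}.
Implicit Types (f g : R[i] -> R[i]) (z w : R[i]).

Lemma csq_near z w (r : R) : normc (w - z) <= r -> csq z r w.
Proof.
move=> wz; have h1 := le_trans (normc_Re _) wz; have h2 := le_trans (normc_Im _) wz.
move: h1 h2; rewrite ReDc ImDc ReNc ImNc !ler_norml /csq /cbox /=.
by move=> /andP[? ?] /andP[? ?]; lra.
Qed.

(** The sum of the two remainders is [(D w' - D w) * (w' - w)]. *)
Lemma taylor_lipschitz (F D : R[i] -> R[i]) w w' (Q : R) :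
  normc (F w' - F w - D w * (w' - w)) <= Q * normc (w' - w) ^+ 2 ->
  normc (F w - F w' - D w' * (w - w')) <= Q * normc (w - w') ^+ 2 ->
  normc (D w' - D w) <= 2 * Q * normc (w' - w).
Proof.
have [->|ww] := eqVneq w' w; first by move=> _ _; rewrite !subrr normc0 mulr0.
rewrite (normc_distC w w') => h1 h2.
have n0 : 0 < normc (w' - w) by rewrite normc_gt0 subr_eq0.
rewrite -(ler_pM2r n0) -normcM.
have -> : (D w' - D w) * (w' - w) = (F w' - F w - D w * (w' - w)) + (F w - F w' - D w' * (w - w')).
  by ring.
by rewrite (le_trans (le_normcD _ _))//; move: h1 h2; rewrite expr2; nra.
Qed.

(** The radius and the constant are the same for the whole unit ball, as they come
    from [point_eval]. *)
Lemma ball_taylor (p al : R) z : 1 <= p -> -1 < al -> disc R z ->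
  exists2 rQ : R * R, 0 < rQ.1 & forall f, holomorphic f -> (dnorm p al f <= 1%:E)%E ->
   forall w w', normc (w - z) <= rQ.1 -> normc (w' - z) <= rQ.1 ->
    normc (f w' - f w - cder f w * (w' - w)) <= rQ.2 * normc (w' - w) ^+ 2.
Proof.
move=> p1 al1 zD; have z1 : normc z < 1 := zD.
pose r := (1 - normc z) / 4; have r0 : 0 < r by rewrite divr_gt0 ?subr_gt0.
have R1 : (1 + normc z) / 2 < 1 by lra.
have [C C0 HC] := point_eval p1 al1 R1.
exists (r / 2, 128 * C / r ^+ 2) => /=; first by lra.
move=> f Hf f1 w w' wz wz'; rewrite cderE.
have sub : csq z r `<=` disc R by exact: csq_disc.
apply: (@taylor_quad _ _ z) => //; [exact: holomorphic_on| |exact: csq_near|exact: csq_near].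
move=> v vr; have vR : normc v <= (1 + normc z) / 2.
  have vz := csq_normc vr; rewrite -(subrK z v) (le_trans (le_normcD _ _))//.
  by rewrite /r in vz; lra.
by have [h _] := HC f 1 v Hf ler01 f1 vR; rewrite mulr1 in h.
Qed.

(** Montel's theorem. Values and derivatives are bounded on the unit ball at each
    point, so they converge along the ultrafilter; the quadratic estimate of
    [ball_taylor] passes to the limit and shows that the limit of the derivatives
    is the derivative of the limit. *)
Lemma normal_limit (T : Type) (U : set_system T) (UF : UltraFilter U) (p al : R)
    (ff : T -> R[i] -> R[i]) : 1 <= p -> -1 < al ->
  U [set h | holomorphic (ff h) /\ (dnorm p al (ff h) <= 1%:E)%E] ->
  exists f, [/\ holomorphic f,
    forall z (e : R), disc R z -> 0 < e -> U [set h | normc (ff h z - f z) <= e],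
    forall z (e : R), disc R z -> 0 < e -> U [set h | normc (cder (ff h) z - cder f z) <= e] &
    forall z, disc R z -> exists2 rQ : R * R, 0 < rQ.1 & forall w w',
      normc (w - z) < rQ.1 -> normc (w' - z) < rQ.1 ->
      normc (f w' - f w - cder f w * (w' - w)) <= rQ.2 * normc (w' - w) ^+ 2].
Proof.
move=> p1 al1 Uff.
have lim z : exists L : R[i] * R[i], disc R z -> forall e : R, 0 < e ->
    U [set h | normc (ff h z - L.1) <= e] /\ U [set h | normc (cder (ff h) z - L.2) <= e].
  have [z1|z1] := ltP (normc z) 1; last first.
    by exists (0, 0) => zD; have : normc z < 1 := zD; rewrite ltNge z1.
  have [C C0 HC] := point_eval p1 al1 z1.
  have [a Ha] : exists L : R[i], forall e : R, 0 < e -> U [set h | normc (ff h z - L) <= e].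
    apply: (@ultra_limitC _ _ _ _ _ C); apply: filterS Uff => h [Hf f1] /=.
    by have [+ _] := HC _ 1 z Hf ler01 f1 (lexx _); rewrite mulr1.
  have [b Hb] : exists L : R[i], forall e : R, 0 < e -> U [set h | normc (cder (ff h) z - L) <= e].
    apply: (@ultra_limitC _ _ _ _ _ C); apply: filterS Uff => h [Hf f1] /=.
    by have [_] := HC _ 1 z Hf ler01 f1 (lexx _); rewrite mulr1.
  by exists (a, b) => _ e e0; split; [exact: Ha|exact: Hb].
have [L HL] := choice lim.
pose f z := (L z).1; pose f1 z := (L z).2.
have Hf z (e : R) : disc R z -> 0 < e -> U [set h | normc (ff h z - f z) <= e].
  by move=> zD e0; have [] := HL z zD e e0.
have Hf1 z (e : R) : disc R z -> 0 < e -> U [set h | normc (cder (ff h) z - f1 z) <= e].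
  by move=> zD e0; have [] := HL z zD e e0.
have quad z : disc R z -> exists2 rQ : R * R, 0 < rQ.1 & forall w w',
      normc (w - z) < rQ.1 -> normc (w' - z) < rQ.1 ->
      normc (f w' - f w - f1 w * (w' - w)) <= rQ.2 * normc (w' - w) ^+ 2.
  move=> zD; have z1 : normc z < 1 := zD.
  have [[r Q] /= r0 HQ] := ball_taylor p1 al1 zD.
  pose r' := Num.min r (1 - normc z).
  have r'0 : 0 < r' by rewrite lt_min r0 subr_gt0.
  exists (r', Q) => //= w w' wr wr'.
  have inD v : normc (v - z) < r' -> disc R v.
    rewrite lt_min => /andP[_ vz]; suff : normc v < 1 by [].
    by rewrite -(subrK z v) (le_lt_trans (le_normcD _ _))//; lra.
  have inr v : normc (v - z) < r' -> normc (v - z) <= r.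
    by rewrite lt_min => /andP[/ltW].
  apply/ler_addgt0Pr => e e0.
  pose d := normc (w' - w); have d0 : 0 <= d := normc_ge0 _.
  have k0 : 0 < 2 + d by lra.
  have e'0 : 0 < e / (2 + d) by rewrite divr_gt0.
  have [h [[[h1 h2] [Hh hn]] h3]] := filter_ex (filterI (filterI (filterI (Hf w' _ (inD _ wr') e'0)
     (Hf w _ (inD _ wr) e'0)) Uff) (Hf1 w _ (inD _ wr) e'0)).
  have hQ := HQ _ Hh hn w w' (inr _ wr) (inr _ wr').
  have -> : f w' - f w - f1 w * (w' - w) = (ff h w' - ff h w - cder (ff h) w * (w' - w)) -
     (ff h w' - f w') + (ff h w - f w) + (cder (ff h) w - f1 w) * (w' - w) by ring.
  have E : e = e / (2 + d) + e / (2 + d) + e / (2 + d) * d by field; rewrite gt_eqF.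
  rewrite (le_trans (le_normcD _ _))// normcM.
  rewrite (le_trans (lerD (le_normcD _ _) (lexx _)))//.
  rewrite (le_trans (lerD (lerD (le_normcD _ _) (lexx _)) (lexx _)))// normcN.
  rewrite E; move: h1 h2 h3 hQ; rewrite /= -/d => h1 h2 h3 hQ.
  have h4 : normc (cder (ff h) w - f1 w) * d <= e / (2 + d) * d by rewrite ler_wpM2r.
  by move: h1 h2 h4 hQ; clear; lra.
have dfz z : disc R z -> has_cderiv f z (f1 z).
  move=> zD; have [[r Q] /= r0 HQ] := quad z zD.
  apply: (@has_cderiv_quad _ _ _ _ r Q) => // h hr.
  have := HQ z (z + h); rewrite subrr normc0 [z + h - z]addrC addKr; exact.
have fE z : disc R z -> cder f z = f1 z by move=> /dfz/cderP.
have Hol : holomorphic f by apply: holomorphicI => z zD; exists (f1 z); exact: dfz.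
exists f; split=> //.
- by move=> z e zD e0; rewrite fE//; exact: Hf1.
- move=> z zD; have z1 : normc z < 1 := zD.
  have [[r Q] /= r0 HQ] := quad z zD.
  exists (Num.min r (1 - normc z), Q); first by rewrite /= lt_min r0 subr_gt0.
  move=> w w' /=; rewrite !lt_min => /andP[wr wz] /andP[wr' _].
  rewrite fE; first exact: HQ.
  by suff : normc w < 1 by []; rewrite -(subrK z w) (le_lt_trans (le_normcD _ _))//; lra.
Qed.

Lemma compact_square : compact (`[(-1)%R, 1%R] `*` `[(-1)%R, 1%R] : set (R * R)).
Proof. by apply: compact_setX; exact: segment_compact. Qed.

(** The derivatives are equi-Lipschitz near each point of the disc, so that their
    pointwise convergence is uniform on compact sets. The square [-1, 1]^2 serves
    as a compact set that contains the disc; its points off the disc have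
    neighbourhoods that avoid [normc z <= r]. *)
Lemma normal_limit_unif (T : Type) (U : set_system T) (UF : UltraFilter U) (p al : R)
    (ff : T -> R[i] -> R[i]) f : 1 <= p -> -1 < al ->
  U [set h | holomorphic (ff h) /\ (dnorm p al (ff h) <= 1%:E)%E] ->
  (forall z (e : R), disc R z -> 0 < e -> U [set h | normc (cder (ff h) z - cder f z) <= e]) ->
  (forall z, disc R z -> exists2 rQ : R * R, 0 < rQ.1 & forall w w',
      normc (w - z) < rQ.1 -> normc (w' - z) < rQ.1 ->
      normc (f w' - f w - cder f w * (w' - w)) <= rQ.2 * normc (w' - w) ^+ 2) ->
  forall r e : R, r < 1 -> 0 < e ->
    U [set h | forall z, normc z <= r -> normc (cder (ff h) z - cder f z) <= e].
Proof.
move=> p1 al1 Uff Hf1 Hq r e r1 e0.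
have /compact_near_coveringP cov := compact_square.
have ball (x : R * R) (d : R) : 0 < d -> nbhs x [set x' | normc (pt x' - pt x) < d].
  move=> d0; have d2 : 0 < d / 2 by lra.
  exists (ball x.1 (d / 2), ball x.2 (d / 2)); first by split; apply: nbhsx_ballx.
  move=> [a b] [/= ha hb]; suff h : normc (pt (a, b) - pt x) < d by exact: h.
  apply: (le_lt_trans (normc_pt_sub (a, b) x)) => /=.
  move: ha hb; rewrite /ball /= => ha hb; rewrite distrC in ha; rewrite distrC in hb; lra.
pose P h x := normc (pt x) <= r -> normc (cder (ff h) (pt x) - cder f (pt x)) <= e.
suff HU : U (fun h => `[(-1)%R, 1%R] `*` `[(-1)%R, 1%R] `<=` P h).
  apply: filterS HU => h Hh z zr.
  have /(Hh (complex.Re z, complex.Im z)) : (`[(-1)%R, 1%R] `*` `[(-1)%R, 1%R])%classic (complex.Re z, complex.Im z).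
    have h1 := le_trans (normc_Re z) zr; have h2 := le_trans (normc_Im z) zr.
    by move: h1 h2; rewrite !ler_norml => /andP[? ?] /andP[? ?]; split; rewrite /= in_itv /=; lra.
  rewrite /P; have -> : pt (complex.Re z, complex.Im z) = z by case: (z).
  exact.
apply: cov => x _; have [xr|x1] := ltP (normc (pt x)) 1; last first.
  exists ([set x' | normc (pt x' - pt x) < 1 - r], setT).
    by split; [apply: ball; rewrite subr_gt0|exact: filterT].
  move=> [x' h] [xx _] xr'; have {}xx : normc (pt x' - pt x) < 1 - r := xx.
  have := ler_normcB (pt x) (pt x'); rewrite normc_distC; lra.
have xD : disc R (pt x) := xr.
have [[s Q] /= s0 HQ] := Hq _ xD; have [[s' Q'] /= s'0 HQ'] := ball_taylor p1 al1 xD.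
have e3 : 0 < e / 3 by lra.
pose d := Num.min (Num.min s s') (e / 3 / (2 * (`|Q| + `|Q'| + 1))).
have K0 : 0 < 2 * (`|Q| + `|Q'| + 1) by rewrite mulr_gt0// ltr_wpDl// addr_ge0.
have d0 : 0 < d by rewrite !lt_min s0 s'0 divr_gt0.
exists ([set x' | normc (pt x' - pt x) < d], [set h | (holomorphic (ff h) /\ (dnorm p al (ff h) <= 1%:E)%E)
    /\ normc (cder (ff h) (pt x) - cder f (pt x)) <= e / 3]).
  by split; [exact: ball|apply: filterI => //; exact: Hf1].
move=> [x' h] [xx [[Hh hn] hx]] _; have {}xx : normc (pt x' - pt x) < d := xx.
rewrite /= in hx *.
move: xx; rewrite !lt_min => /andP[/andP[xs xs']]; rewrite ltr_pdivlMr// => xK.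
have t0 : normc (pt x - pt x) = 0 by rewrite subrr normc0.
have h1 : normc (cder f (pt x') - cder f (pt x)) <= 2 * Q * normc (pt x' - pt x).
  by apply: (@taylor_lipschitz f); apply: HQ; rewrite ?t0.
have h2 : normc (cder (ff h) (pt x') - cder (ff h) (pt x)) <= 2 * Q' * normc (pt x' - pt x).
  by apply: (@taylor_lipschitz (ff h)); apply: HQ'; rewrite ?t0// ltW.
have -> : cder (ff h) (pt x') - cder f (pt x') = (cder (ff h) (pt x) - cder f (pt x)) +
   (cder (ff h) (pt x') - cder (ff h) (pt x)) - (cder f (pt x') - cder f (pt x)) by ring.
rewrite (le_trans (le_normcD _ _))// normcN (le_trans (lerD (le_normcD _ _) (lexx _)))//.
have := ler_norm Q; have := ler_norm Q'; have := normr_ge0 Q; have := normr_ge0 Q'.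
have := normc_ge0 (pt x' - pt x); move: h1 h2 hx xK.
move: (normc (pt x' - pt x)) (normc (cder f _ - _)) (normc (cder (ff h) (pt x') - _))
  (normc (cder (ff h) (pt x) - _)) `|Q| `|Q'| => t A B C q q'.
by clear -e0; nra.
Qed.

(** Lower semicontinuity of the norm, without a sequence to which Fatou's lemma
    would apply: on a smaller disc [f'] is uniformly close to some [(ff h)'], and
    [ler_powRD] compares the energies up to the factor [(1 + s) `^ p] and an error
    that vanishes with [eta]. The bound obtained does not depend on the disc, so
    [dint_exhaust] applies; [s] is then arbitrary. *)
Lemma normal_limit_dnorm (T : Type) (U : set_system T) (UF : UltraFilter U) (p al : R)
    (ff : T -> R[i] -> R[i]) f : 1 <= p -> -1 < al -> holomorphic f ->
  U [set h | holomorphic (ff h) /\ (dnorm p al (ff h) <= 1%:E)%E] ->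
  (forall e : R, 0 < e -> U [set h | normc (ff h 0 - f 0) <= e]) ->
  (forall r e : R, r < 1 -> 0 < e ->
    U [set h | forall z, normc z <= r -> normc (cder (ff h) z - cder f z) <= e]) ->
  (dnorm p al f <= 1%:E)%E.
Proof.
move=> p1 al1 Hf Uff U0 U1; have p0 : 0 < p by lra.
have [A A0 HA] := disc_area_fin al1.
have key (s eta : R) : 0 < s -> 0 < eta ->
    (energy p al f <= ((1 + s) `^ p + (1 + s^-1) `^ p * eta `^ p * (1 + A))%:E)%E.
  move=> s0 eta0; set B := (1 + s^-1) `^ p * eta `^ p.
  have B0 : 0 <= B by rewrite mulr_ge0 ?powR_ge0.
  have sp : 0 <= (1 + s) `^ p by exact: powR_ge0.
  have approx a b : normc (b - a) <= eta -> normc a `^ p <= (1 + s) `^ p * normc b `^ p + B.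
    move=> ab; apply: (@le_trans _ _ ((normc b + eta) `^ p)).
      apply: ge0_ler_powR; rewrite ?nnegrE ?normc_ge0 ?(ltW p0)// ?addr_ge0 ?normc_ge0 ?(ltW eta0)//.
      by have := ler_normcB a b; rewrite normc_distC; lra.
    by apply: ler_powRD; rewrite ?normc_ge0// ltW.
  rewrite energyE adde_le_real denergyE disc_integralE; apply: dint_exhaust.
  - by apply: disc_measurableM; [exact: disc_measurable_cderiv|exact: disc_measurable_weight].
  - by move=> z _; apply: mulr_ge0; [exact: powR_ge0|exact: weight_ge0].
  move=> r r1; have [h [[[Hh hn] h0] hr]] := filter_ex (filterI (filterI Uff (U0 _ eta0)) (U1 _ _ r1 eta0)).
  have mh : disc_measurable (fun z => normc (cder (ff h) z) `^ p) by exact: disc_measurable_cderiv.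
  have mc1 : disc_measurable (fun _ : R[i] => (1 + s) `^ p) by exact: disc_measurable_cst.
  have mB : disc_measurable (fun _ : R[i] => B) by exact: disc_measurable_cst.
  have m1 : disc_measurable (fun _ : R[i] => 1 : R) by exact: disc_measurable_cst.
  exists (fun z => ((1 + s) `^ p * normc (cder (ff h) z) `^ p + B * 1) * weight al z); split.
  - apply: disc_measurableM; last exact: disc_measurable_weight.
    apply: disc_measurableD; first by apply: disc_measurableM; [exact: mc1|exact: mh].
    by apply: disc_measurableM; [exact: mB|exact: m1].
  - move=> z _; apply: mulr_ge0; last exact: weight_ge0.
    by rewrite mulr1 addr_ge0// mulr_ge0 ?powR_ge0.
  - move=> z zr; apply: ler_wpM2r; first exact: weight_ge0.
    by rewrite mulr1; apply: approx; apply: hr; exact: ltW.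
  rewrite -disc_integralE disc_integralD//; last 4 first.
  - by apply: disc_measurableM; [exact: mc1|exact: mh].
  - by apply: disc_measurableM; [exact: mB|exact: m1].
  - by move=> z _; rewrite mulr_ge0 ?powR_ge0.
  - by move=> z _; rewrite mulr1.
  rewrite disc_integralZ//; last by move=> z _; exact: powR_ge0.
  rewrite [X in (_ + X)%E]disc_integralZ// -denergyE.
  rewrite dnorm_le// powR1 energyE adde_le_real in hn.
  have a0 := approx _ _ h0.
  have sp' : (0 <= ((1 + s) `^ p)%:E)%E by rewrite lee_fin.
  have B0' : (0 <= B%:E)%E by rewrite lee_fin.
  apply: (le_trans (leeD (lee_wpmul2l sp' hn) (lee_wpmul2l B0' HA))).
  rewrite -(EFinM ((1 + s) `^ p)) -(EFinM B) -EFinD lee_fin -/B.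
  by move: a0; clear; nra.
apply/lee_addgt0Pr => e e0; rewrite -EFinD dnorm_le//; last by lra.
have e2 : 0 < e / 2 by lra.
pose gam := (1 + e) `^ p - (1 + e / 2) `^ p.
have gam0 : 0 < gam by rewrite subr_gt0; apply: gt0_ltr_powR; rewrite ?nnegrE; lra.
pose k := (1 + (e / 2)^-1) `^ p * (1 + A).
have k0 : 0 < k.
  rewrite mulr_gt0//; last by lra.
  by rewrite powR_gt0// ltr_pwDl// invr_ge0 ltW.
pose eta := (gam / k) `^ p^-1.
have eta0 : 0 < eta by apply: powR_gt0; exact: divr_gt0.
apply: (le_trans (key _ _ e2 eta0)); rewrite lee_fin.
rewrite /eta -powRrM mulVf ?gt_eqF// powRr1 ?divr_ge0 ?(ltW gam0) ?(ltW k0)//.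
have -> : (1 + (e / 2)^-1) `^ p * (gam / k) * (1 + A) = gam / k * k by rewrite /k; ring.
by rewrite mulfVK ?gt_eqF// /gam; lra.
Qed.

End NormalFamilies.

(** * The topology of the Dirichlet space and compact composition operators *)

Section NormAlgebra.
Context {R : realType}.
Implicit Types (f g h : R[i] -> R[i]) (z : R[i]) (p al : R).

Lemma dnorm_sym p al f g : 0 < p -> -1 < al -> holomorphic f -> holomorphic g ->
  dnorm p al (g \- f)%R = dnorm p al (f \- g)%R.
Proof.
move=> p0 al1 Hf Hg; rewrite !dnorm_energy ?gt_eqF//; congr (_ `^ _)%E.
rewrite !energyE /= normc_distC; congr (_ + _)%E.
rewrite !denergyE !disc_integralE; apply: dint_eq => z zD.
by rewrite !cderB// normc_distC.
Qed.

Lemma dnorm_triangle p al f g h (e : R) : 1 <= p -> -1 < al -> 0 <= e ->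
  holomorphic f -> holomorphic g -> holomorphic h ->
  (dnorm p al (f \- g)%R <= e%:E)%E -> (dnorm p al (h \- g)%R <= e%:E)%E ->
  (dnorm p al (f \- h)%R <= (4 * e)%:E)%E.
Proof.
move=> p1 al1 e0 Hf Hg Hh fg hg; have p0 : 0 < p by lra.
have H1 := holomorphicB Hf Hg; have H2 := holomorphicB Hh Hg.
have E z : disc R z -> ((f \- g) \- (h \- g))%R z = (f \- h)%R z.
  by move=> _ /=; rewrite opprB addrA subrK.
rewrite (dnorm_eq p0 al1 (holomorphicB H1 H2) E).
exact: (dnorm_sub p1 al1 e0 H1 H2 fg hg).
Qed.

Lemma energyZ p al f (a : R) : 0 < p -> -1 < al -> 0 <= a -> holomorphic f ->
  energy p al (fun z => a%:C * f z) = ((a `^ p)%:E * energy p al f)%E.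
Proof.
move=> p0 al1 a0 Hf; rewrite !energyE ge0_muleDr ?lee_fin ?powR_ge0 ?denergy_ge0//.
congr (_ + _)%E; first by rewrite normcM normcR ger0_norm// powRM ?normc_ge0.
rewrite !denergyE -disc_integralZ ?powR_ge0//; last 2 first.
- exact: disc_measurable_cderiv.
- by move=> z _; exact: powR_ge0.
rewrite !disc_integralE; apply: dint_eq => z zD; congr (_ * _).
by rewrite cderZ// normcM normcR ger0_norm// powRM ?normc_ge0.
Qed.

Lemma dnorm_scale p al f (a : R) : 0 < p -> -1 < al -> 0 <= a -> holomorphic f ->
  dnorm p al (fun z => a%:C * f z) = (a%:E * dnorm p al f)%E.
Proof.
move=> p0 al1 a0 Hf; rewrite !dnorm_energy ?gt_eqF// energyZ//.
rewrite poweRM ?energy_ge0 ?lee_fin ?powR_ge0//; congr (_ * _)%E.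
rewrite -[LHS]/((a `^ p) `^ p^-1)%:E -powRrM divff ?gt_eqF//.
by rewrite powRr1.
Qed.

Lemma dnorm_self p al f (e : R) : 0 < p -> -1 < al -> 0 <= e -> holomorphic f ->
  (dnorm p al (f \- f)%R <= e%:E)%E.
Proof.
move=> p0 al1 e0 Hf.
have E z : disc R z -> (fun z => 0%:C * f z) z = (f \- f)%R z.
  by move=> _ /=; rewrite subrr mul0r.
rewrite (dnorm_eq p0 al1 (@holomorphicZ _ f 0%:C Hf) E) (dnorm_scale p0 al1 (lexx 0) Hf).
have := dnorm_nneg p al f; case: (dnorm p al f) => [x| |]//.
  by rewrite -EFinM mul0r lee_fin.
by rewrite mul0e lee_fin.
Qed.

End NormAlgebra.

Section DirichletTopology.
Context {R : realType} (p al : R).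
Notation D := (dirichlet p al).

Lemma dirichlet_holo (h : D) : holomorphic h.
Proof. by have [] := dirichlet_funP h. Qed.

Lemma nbhs_dirichlet (h : D) (A : set D) : nbhs h A ->
  exists2 e : R, 0 < e & forall g : D, (dnorm p al (g \- h)%R < e%:E)%E -> A g.
Proof.
rewrite nbhsE => -[B [oB Bh] BA].
have oB' : dirichlet_open B := oB.
have [e e0 H] := oB' h Bh; exists e => // g gh; apply: BA; apply: H.
by rewrite /dirichlet_ball /= -dnormE.
Qed.

(** Only a quasi-triangle inequality is at hand, so the ball itself need not be
    shown to be open: the points at which some smaller ball still fits into it
    form an open set. *)
Lemma nbhs_dirichlet_ball (h : D) (e : R) : 1 <= p -> -1 < al -> 0 < e ->
  nbhs h [set g : D | (dnorm p al (g \- h)%R < e%:E)%E].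
Proof.
move=> p1 al1 e0; have p0 : 0 < p by lra.
pose V := [set g : D | exists2 d : R, 0 < d & forall k : D,
  (dnorm p al (k \- g)%R < d%:E)%E -> (dnorm p al (k \- h)%R < e%:E)%E].
rewrite nbhsE; exists V; last first.
  move=> g [d d0 H]; apply: H; apply: (@le_lt_trans _ _ (d / 2)%:E).
    apply: dnorm_self => //; [lra|exact: dirichlet_holo].
  by rewrite lte_fin; lra.
split; last by exists e.
suff oV : dirichlet_open V by exact: oV.
move=> g [d d0 H]; have d8 : 0 < d / 8 by lra.
exists (d / 8) => // g' gg'; have {}gg' : (dnorm p al (g' \- g)%R < (d / 8)%:E)%E by rewrite dnormE.
exists (d / 8) => // k kg'; apply: H.
apply: (@le_lt_trans _ _ (4 * (d / 8))%:E); last by rewrite lte_fin; lra.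
apply: (@dnorm_triangle _ _ _ _ g') => //; try exact: dirichlet_holo; try exact: ltW.
by rewrite dnorm_sym; [exact: ltW|exact: p0|exact: al1|exact: dirichlet_holo|exact: dirichlet_holo].
Qed.

End DirichletTopology.

Section Compactness.
Context {R : realType}.
Implicit Types (f g phi : R[i] -> R[i]) (z w l : R[i]) (p al be c : R).

(** [denergy_comp] with a majorant that has two parts: on [normc w <= r] the
    derivative of [g] is small, and elsewhere [carleson_fun] is. *)
Lemma composition_small p al c phi (S L : R) : 1 <= p -> -1 < al -> 0 < c -> 0 <= al + c ->
  holomorphic phi -> phi @` disc R `<=` disc R -> 0 <= S -> 0 <= L ->
  (forall w, disc R w -> (carleson_fun p al c phi w <= S%:E)%E) ->
  (forall e : R, 0 < e -> exists2 r : R, r < 1 & forall w, r < normc w -> normc w < 1 ->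
     (carleson_fun p al c phi w <= e%:E)%E) ->
  forall e : R, 0 < e -> exists2 r : R, r < 1 & exists2 eta : R, 0 < eta &
    forall g, holomorphic g -> normc (g (phi 0)) <= eta ->
      (forall w, normc w <= r -> normc (cder g w) <= eta) ->
      (denergy p al g <= L%:E)%E -> (dnorm p al (g \o phi) <= e%:E)%E.
Proof.
move=> p1 al1 c0 alc Hphi phiD S0 L0 HS Hr e e0; have p0 : 0 < p by lra.
have [K K0 HK] := denergy_comp p1 al1 c0 alc Hphi phiD.
have [A A0 HA] := disc_area_fin al1.
have ep : 0 < e `^ p by exact: powR_gt0.
pose e' := e `^ p / (2 * (K * L + 1)).
have KL : 0 < 2 * (K * L + 1) by rewrite mulr_gt0// ltr_wpDl// mulr_ge0.
have e'0 : 0 < e' by exact: divr_gt0.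
pose Q := 2 * (1 + K * (S * A)).
have Q0 : 0 < Q by rewrite mulr_gt0// ltr_pwDl// !mulr_ge0.
pose eta := (e `^ p / Q) `^ p^-1.
have eta0 : 0 < eta by apply: powR_gt0; exact: divr_gt0.
have etap : eta `^ p = e `^ p / Q.
  by rewrite /eta -powRrM mulVf ?gt_eqF// powRr1// ltW// divr_gt0.
have [r r1 rG] := Hr e' e'0.
exists r => //; exists eta => // g Hg g0 gr gL.
have mg : disc_measurable (fun w => normc (cder g w) `^ p) by exact: disc_measurable_cderiv.
have m1 : disc_measurable (fun _ : R[i] => 1 : R) by exact: disc_measurable_cst.
have etaS : 0 <= eta `^ p * S by rewrite mulr_ge0 ?powR_ge0.
have e'0' := ltW e'0.
have B : (denergy p al (g \o phi) <= (K * (eta `^ p * S * A + e' * L))%:E)%E.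
  apply: (le_trans (HK g (fun w => eta `^ p * S * 1 + e' * normc (cder g w) `^ p) Hg _ _)).
  - apply: disc_measurableD; apply: disc_measurableM; try exact: disc_measurable_cst.
    exact: mg.
  - move=> w wD; have w1 : normc w < 1 := wD; have [wr|wr] := leP (normc w) r.
      apply: (@le_trans _ _ ((eta `^ p)%:E * S%:E)%E).
        apply: lee_pmul; [by rewrite lee_fin powR_ge0|exact: carleson_fun_ge0| |exact: HS].
        rewrite lee_fin; apply: ge0_ler_powR; rewrite ?nnegrE ?normc_ge0 ?(ltW eta0) ?(ltW p0)//.
        exact: gr.
      by rewrite -EFinM lee_fin mulr1 lerDl mulr_ge0 ?powR_ge0.
    apply: (@le_trans _ _ ((normc (cder g w) `^ p)%:E * e'%:E)%E).
      by apply: lee_wpmul2l; [rewrite lee_fin powR_ge0|exact: rG].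
    by rewrite -EFinM lee_fin mulr1 mulrC lerDr.
  rewrite EFinM; apply: lee_wpmul2l; first by rewrite lee_fin.
  rewrite disc_integralD//; last 4 first.
  - by apply: disc_measurableM; [exact: disc_measurable_cst|exact: m1].
  - by apply: disc_measurableM; [exact: disc_measurable_cst|exact: mg].
  - by move=> z _; rewrite mulr1.
  - by move=> z _; rewrite mulr_ge0 ?powR_ge0.
  rewrite disc_integralZ// [X in (_ + X)%E]disc_integralZ//; last by move=> z _; exact: powR_ge0.
  rewrite -denergyE EFinD (EFinM (eta `^ p * S)) (EFinM e').
  by apply: leeD; apply: lee_wpmul2l; rewrite ?lee_fin.
rewrite dnorm_le ?(ltW e0)// energyE.
apply: (@le_trans _ _ ((eta `^ p)%:E + (K * (eta `^ p * S * A + e' * L))%:E)%E).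
  apply: leeD B; rewrite lee_fin; apply: ge0_ler_powR; rewrite ?nnegrE ?normc_ge0 ?(ltW eta0) ?(ltW p0)//.
rewrite -EFinD lee_fin etap.
have -> : e `^ p / Q + K * (e `^ p / Q * S * A + e' * L) =
    e `^ p / Q * (1 + K * (S * A)) + e' * (K * L) by ring.
have h1 : e `^ p / Q * (1 + K * (S * A)) = e `^ p / 2.
  by rewrite /Q; field; rewrite gt_eqF// ltr_pwDl// !mulr_ge0.
have h2 : e' * (K * L) <= e `^ p / 2.
  have : e' * (K * L + 1) = e `^ p / 2 by rewrite /e'; field; rewrite gt_eqF// ltr_wpDl// mulr_ge0.
  move=> <-; rewrite ler_wpM2l//; lra.
rewrite h1; move: h2; lra.
Qed.

(** The image of the unit ball under [C_phi], saturated for equality on the disc,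
    which makes it closed. *)
Definition image_ball p al phi : set (dirichlet p al) := [set h | exists f,
  [/\ holomorphic f, (dnorm p al f <= 1%:E)%E & forall z, disc R z -> h z = f (phi z)]].

(** Along an ultrafilter the preimages in the unit ball have a limit [f] in the unit
    ball, by the section on normal families, and [composition_small] turns the
    locally uniform convergence of the derivatives into convergence in norm of the
    images to [f \o phi]. *)
Lemma image_ball_compact p al c phi (S : R) : 1 <= p -> -1 < al -> 0 < c -> 0 <= al + c ->
  holomorphic phi -> phi @` disc R `<=` disc R -> 0 <= S ->
  (forall w, disc R w -> (carleson_fun p al c phi w <= S%:E)%E) ->
  (forall e : R, 0 < e -> exists2 r : R, r < 1 & forall w, r < normc w -> normc w < 1 ->
     (carleson_fun p al c phi w <= e%:E)%E) ->
  compact (@image_ball p al phi).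
Proof.
move=> p1 al1 c0 alc Hphi phiD S0 HS Hr; have p0 : 0 < p by lra.
have [Tmap _] := composition_bounded p1 al1 c0 alc Hphi phiD S0 HS.
rewrite compact_ultra => U UU UB.
have pre (h : dirichlet p al) : exists f, image_ball phi h ->
    [/\ holomorphic f, (dnorm p al f <= 1%:E)%E & forall z, disc R z -> h z = f (phi z)].
  by have [[f Hf]|nB] := pselect (image_ball phi h); [exists f|exists id].
have [ff Hff] := choice pre.
have Uff : U [set h | holomorphic (ff h) /\ (dnorm p al (ff h) <= 1%:E)%E].
  by apply: filterS UB => h /Hff[].
have [f [Hf Uf0 Uf1 Hq]] := normal_limit UU p1 al1 Uff.
have Uf := normal_limit_unif UU p1 al1 Uff Uf1 Hq.
have f1 : (dnorm p al f <= 1%:E)%E.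
  by apply: (normal_limit_dnorm UU p1 al1 Hf Uff _ Uf) => e e0; apply: Uf0 => //; exact: disc0.
have Df : dirichlet_space p al f.
  by split=> //; rewrite -dnormE; apply: le_lt_trans f1 _; exact: ltry.
pose h0 := Dirichlet (Tmap f Df).
exists h0; split; first by exists f.
move=> A /nbhs_dirichlet[e e0 HA].
have e2 : 0 < e / 2 by lra.
have L0 : 0 <= 2 `^ p * (1 + 1) by rewrite mulr_ge0 ?powR_ge0.
have [r r1 [eta eta0 small]] := composition_small p1 al1 c0 alc Hphi phiD S0 L0 HS Hr e2.
have ph0 : disc R (phi 0) by apply: phiD; exists 0 => //; exact: disc0.
apply: filterS (filterI (filterI UB (Uf0 _ _ ph0 eta0)) (Uf _ _ r1 eta0)) => h [[/Hff[Hh h1 hE] hz] hr].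
apply: HA; apply: (@le_lt_trans _ _ (e / 2)%:E); last by rewrite lte_fin; lra.
have HB := holomorphicB Hh Hf.
have HD : (dnorm p al ((ff h \- f)%R \o phi) <= (e / 2)%:E)%E.
  apply: small; [exact: HB|exact: hz| |].
    move=> w wr; have w1 : disc R w by have : normc w < 1 by exact: le_lt_trans wr r1.
    by rewrite cderB//; exact: hr.
  apply: (le_trans (denergyB p0 al1 Hh Hf)).
  have den g : (dnorm p al g <= 1%:E)%E -> (denergy p al g <= 1%:E)%E.
    rewrite dnorm_le// powR1 energyE; apply: le_trans.
    by rewrite leeDr// lee_fin powR_ge0.
  rewrite EFinM; apply: lee_wpmul2l; first by rewrite lee_fin powR_ge0.
  by rewrite EFinD; apply: leeD; exact: den.
have E z : disc R z -> ((ff h \- f)%R \o phi) z = (h \- h0)%R z by move=> zD /=; rewrite hE.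
by rewrite (dnorm_eq p0 al1 (holomorphic_comp HB Hphi phiD) E).
Qed.

(** Convergence in norm forces convergence at each point of the disc, and
    limits in the norm topology are determined up to values off the disc. *)
Lemma image_ball_closed p al phi : 1 <= p -> -1 < al ->
  compact (@image_ball p al phi) -> closed (@image_ball p al phi).
Proof.
move=> p1 al1 cB h clh.
have PF : ProperFilter (within (@image_ball p al phi) (nbhs h)) by exact: within_nbhs_proper.
have [h0 [Bh0 clu]] := cB _ PF (withinT _ _).
have hh0 z : disc R z -> h z = h0 z.
  move=> zD; have z1 : normc z < 1 := zD.
  have [C C0 HC] := point_eval p1 al1 z1.
  apply/eqP; rewrite -subr_eq0 -normc_eq0 eq_le normc_ge0 andbT.
  apply/ler_addgt0Pr => e e0; rewrite add0r.
  pose e' := e / (2 * C + 1); have k0 : 0 < 2 * C + 1 by lra.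
  have e'0 : 0 < e' by exact: divr_gt0.
  have N1 : within (@image_ball p al phi) (nbhs h) [set g | (dnorm p al (g \- h)%R < e'%:E)%E].
    by apply: filterS (nbhs_dirichlet_ball h p1 al1 e'0) => k.
  have [k [/= k1 k2]] := clu _ _ N1 (nbhs_dirichlet_ball h0 p1 al1 e'0).
  have Hk := @dirichlet_holo _ _ _ k.
  have [b1 _] := HC _ e' z (holomorphicB Hk (@dirichlet_holo _ _ _ h)) (ltW e'0) (ltW k1) (lexx _).
  have [b2 _] := HC _ e' z (holomorphicB Hk (@dirichlet_holo _ _ _ h0)) (ltW e'0) (ltW k2) (lexx _).
  have -> : h z - h0 z = (k z - h0 z) - (k z - h z) by ring.
  rewrite (le_trans (le_normcD _ _))// normcN.
  have E : e = 2 * (C * e') + e' by rewrite /e'; field; rewrite gt_eqF.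
  by rewrite E; move: b1 b2 e'0 => /=; lra.
have [f [Hf f1 fE]] := Bh0.
by exists f; split=> // z zD; rewrite hh0// fE.
Qed.

Lemma image_ball_precompact p al phi : compact (@image_ball p al phi) -> closed (@image_ball p al phi) ->
  0 < p ->
  precompact [set g : dirichlet p al | exists2 f : dirichlet p al,
      (dirichlet_norm p al f <= 1)%E & g = composition phi f :> (R[i] -> R[i])].
Proof.
move=> cB clB p0; exists (@image_ball p al phi); last by split.
move=> g [f f1 gE]; exists f; split; first exact: dirichlet_holo.
  by rewrite dnormE.
by move=> z _; rewrite gE.
Qed.

Lemma powR_lt_small (d e : R) : 0 < d -> 0 < e -> exists2 t : R, 0 < t &
  forall x : R, 0 <= x -> x <= t -> x `^ d <= e.
Proof.
move=> d0 e0; exists (e `^ d^-1); first exact: powR_gt0.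
move=> x x0 xt; apply: (@le_trans _ _ ((e `^ d^-1) `^ d)).
  by apply: ge0_ler_powR; rewrite ?nnegrE ?powR_ge0 ?(ltW d0).
by rewrite -powRrM mulVf ?gt_eqF// powRr1// ltW.
Qed.

Lemma testF_pointwise be (d : R) z : 0 <= be -> 0 < d -> normc z < 1 ->
  forall e : R, 0 < e -> exists2 r : R, r < 1 & forall l, r < normc l -> normc l < 1 ->
    (1 - normc l ^+ 2) `^ d * normc (testF l be z) <= e.
Proof.
move=> be0 d0 z1 e e0; have s0 : 0 < 1 - normc z by lra.
have B0 : 0 < (1 - normc z) `^ (1 + be) by exact: powR_gt0.
have [t t0 Ht] := powR_lt_small d0 (mulr_gt0 e0 B0).
exists (1 - t / 2); first by lra.
move=> l lr l1; have l0 := normc_ge0 l.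
rewrite normc_testF ler_pdivrMr ?powR_gt0 ?normc1B_gt0//.
apply: (@le_trans _ _ (e * (1 - normc z) `^ (1 + be))).
  by apply: Ht; nra.
rewrite ler_pM2l//; apply: ge0_ler_powR; rewrite ?nnegrE ?normc_ge0 ?(ltW s0)//; first lra.
exact: normc1B_ge.
Qed.

Lemma dnorm_testF_le p al be c : 1 <= p -> -1 < al -> 0 <= be -> 0 < c ->
  2 + al + c = (2 + be) * p -> exists2 C : R, 0 < C & forall l, normc l < 1 ->
    (((1 - normc l ^+ 2) `^ (c / p))%:E * dnorm p al (testF l be) <= C%:E)%E.
Proof.
move=> p1 al1 be0 c0 qE; have p0 : 0 < p by lra.
have [C C0 HC] := energy_testF_le p1 al1 be0 c0 qE.
have Cp1 : 0 < C `^ p^-1 + 1 by rewrite ltr_wpDl ?powR_ge0.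
exists (C `^ p^-1 + 1) => // l l1; have /andP[s0 _] := one_sub_sqr l1.
rewrite scaled_dnorm_le ?powR_gt0 ?(ltW Cp1)// -powRrM mulfVK ?gt_eqF//.
apply: (le_trans (HC l l1)); rewrite lee_fin.
apply: (@le_trans _ _ ((C `^ p^-1) `^ p)).
  by rewrite -powRrM mulVf ?gt_eqF// powRr1.
by apply: ge0_ler_powR; rewrite ?nnegrE ?powR_ge0 ?(ltW p0) ?(ltW Cp1)// lerDl.
Qed.

(** The test functions, divided by the bound on their norms, lie in the unit ball
    and tend to 0 at each point as [|l|] tends to 1. If the norms of their images
    did not tend to 0, the filter [FF] generated by the images of norm bounded
    below would have a cluster point in the compact set; its values on the disc
    vanish, so that the images would come arbitrarily close to 0 in norm. *)
Lemma compact_testF p al be c phi : 1 <= p -> -1 < al -> 0 <= be -> 0 < c ->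
  2 + al + c = (2 + be) * p -> holomorphic phi -> phi @` disc R `<=` disc R ->
  compact_on_dirichlet p al (composition phi) ->
  forall e : R, 0 < e -> exists2 r : R, r < 1 & forall l, r < normc l -> normc l < 1 ->
    (((1 - normc l ^+ 2) `^ (c / p))%:E * dnorm p al (testF l be \o phi) <= e%:E)%E.
Proof.
move=> p1 al1 be0 c0 qE Hphi phiD [Tmap [K KS [cK clK]]] e e0.
have p0 : 0 < p by lra.
have cp0 : 0 < c / p by exact: divr_gt0.
have [C' C'0 HC] := dnorm_testF_le p1 al1 be0 c0 qE.
pose a l := (1 - normc l ^+ 2) `^ (c / p) / C'.
have a0 l : 0 <= a l by rewrite divr_ge0 ?powR_ge0// ltW.
pose F l z := (a l)%:C * testF l be z.
have HF l : normc l < 1 -> holomorphic (F l).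
  by move=> l1; apply: holomorphicZ; exact: holomorphic_testF.
have F1 l : normc l < 1 -> (dnorm p al (F l) <= 1%:E)%E.
  move=> l1; rewrite (dnorm_scale p0 al1 (a0 l) (holomorphic_testF be0 l1)).
  have := HC l l1.
  by rewrite /a [_ / C']mulrC EFinM -muleA lee_pdivrMl// mule1.
have DF l : normc l < 1 -> dirichlet_space p al (F l).
  move=> l1; split; first exact: HF.
  by rewrite -dnormE; apply: le_lt_trans (F1 l l1) _; exact: ltry.
have NE l : normc l < 1 -> (((1 - normc l ^+ 2) `^ (c / p))%:E * dnorm p al (testF l be \o phi))%E =
    (C'%:E * dnorm p al (F l \o phi))%E.
  move=> l1; have -> : F l \o phi = (fun z => (a l)%:C * (testF l be \o phi) z) by [].
  have HT := holomorphic_comp (holomorphic_testF be0 l1) Hphi phiD.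
  rewrite (dnorm_scale p0 al1 (a0 l) HT).
  by rewrite muleA -EFinM /a mulrCA divff ?mulr1// gt_eqF.
have [//|nlim] := pselect (exists2 r : R, r < 1 & forall l, r < normc l -> normc l < 1 ->
    (((1 - normc l ^+ 2) `^ (c / p))%:E * dnorm p al (testF l be \o phi) <= e%:E)%E).
exfalso.
pose bad r (k : dirichlet p al) := exists l, [/\ r < normc l, normc l < 1,
  ~ (((1 - normc l ^+ 2) `^ (c / p))%:E * dnorm p al (testF l be \o phi) <= e%:E)%E &
  k = F l \o phi :> (R[i] -> R[i])].
pose FF : set_system (dirichlet p al) := filter_from [set r : R | r < 1] (fun r => [set k | bad r k]).
have PF : ProperFilter FF.
  apply: filter_from_proper; first apply: filter_from_filter.
  - by exists 0; rewrite /= ltr01.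
  - move=> r s /= r1 s1; exists (Num.max r s); first by rewrite /= gt_max r1.
    by move=> k [l [+ l1 nb kE]]; rewrite gt_max => /andP[rl sl]; split; exists l.
  - move=> r /= r1.
    have [l [rl l1 nb]] : exists l, [/\ r < normc l, normc l < 1 &
       ~ (((1 - normc l ^+ 2) `^ (c / p))%:E * dnorm p al (testF l be \o phi) <= e%:E)%E].
      apply: contrapT => H; apply: nlim; exists r => // l rl l1.
      by apply: contrapT => nb; apply: H; exists l.
    by exists (Dirichlet (Tmap _ (DF l l1))); exists l.
have FK : FF K.
  exists 0; first by rewrite /= ltr01.
  move=> k [l [_ l1 _ kE]]; apply: KS; exists (Dirichlet (DF l l1)) => //.
  by rewrite -dnormE; exact: F1.
have [h [_ clu]] := cK FF PF FK.
have Hh := @dirichlet_holo _ _ _ h.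
have h0 z : disc R z -> h z = 0.
  move=> zD; have z1 : normc z < 1 := zD.
  have pz1 : normc (phi z) < 1 by apply: phiD; exists z.
  have [M M0 HM] := point_eval p1 al1 z1.
  apply/eqP; rewrite -normc_eq0 eq_le normc_ge0 andbT.
  apply/ler_addgt0Pr => e1 e10; rewrite add0r.
  pose e2 := e1 / (M + 1); have k0 : 0 < M + 1 by lra.
  have e20 : 0 < e2 by exact: divr_gt0.
  have [r r1 Hr] := testF_pointwise be0 cp0 pz1 (mulr_gt0 e20 C'0).
  have Fr : FF [set k | bad r k] by exists r.
  have [k [[l [rl l1 _ kE]] /= kh]] := clu _ _ Fr (nbhs_dirichlet_ball h p1 al1 e20).
  have [b1 _] := HM _ e2 z (holomorphicB (@dirichlet_holo _ _ _ k) Hh) (ltW e20) (ltW kh) (lexx _).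
  have b2 : normc (k z) <= e2.
    rewrite kE -[(F l \o phi) z]/((a l)%:C * testF l be (phi z)) normcM normcR ger0_norm// /a mulrAC ler_pdivrMr//.
    exact: Hr.
  have -> : h z = k z - (k z - h z) by ring.
  rewrite (le_trans (le_normcD _ _))// normcN.
  have -> : e1 = M * e2 + e2 by rewrite /e2; field; rewrite gt_eqF.
  by move: b1 b2 => /=; lra.
have F0 : FF [set k | bad 0 k] by exists 0 => //=; rewrite ltr01.
have eC : 0 < e / C' by exact: divr_gt0.
have [k [[l [_ l1 nb kE]] /= kh]] := clu _ _ F0 (nbhs_dirichlet_ball h p1 al1 eC).
apply: nb; rewrite NE// -lee_pdivlMl// -EFinM mulrC; apply: ltW; apply: le_lt_trans kh.
have E z : disc R z -> (k \- h)%R z = (F l \o phi) z by move=> zD /=; rewrite h0// subr0 kE.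
by rewrite (dnorm_eq p0 al1 (holomorphicB (@dirichlet_holo _ _ _ k) Hh) E).
Qed.

End Compactness.

(** * The two criteria *)

Section Criteria.
Context {R : realType}.
Implicit Types (f g phi : R[i] -> R[i]) (z w l : R[i]) (p al be c : R).

Lemma carleson_fun_inner p al c phi (r : R) : 1 <= p -> -1 < al -> 0 < c ->
  dirichlet_space p al phi -> phi @` disc R `<=` disc R -> r < 1 ->
  exists2 S : R, 0 <= S & forall l, normc l <= r -> (carleson_fun p al c phi l <= S%:E)%E.
Proof.
move=> p1 al1 c0 [Hphi phiy] phiD r1; have p0 : 0 < p by lra.
rewrite -dnormE in phiy; have [e e0 He] := dnorm_fin phiy.
have He' : (dnorm p al phi <= e%:E)%E by rewrite He.
rewrite dnorm_le// in He'.
have den : (denergy p al phi <= (e `^ p)%:E)%E.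
  by apply: le_trans He'; rewrite energyE leeDr// lee_fin powR_ge0.
have q0 : 0 <= 2 + al + c by lra.
exists ((1 - r) `^ (- (2 + al + c)) * e `^ p); first by rewrite mulr_ge0 ?powR_ge0.
move=> l lr; have l1 : normc l < 1 := le_lt_trans lr r1.
have /andP[s0 s1] := one_sub_sqr l1.
rewrite -[X in (_ <= X)%E]mul1e; apply: lee_pmul.
- by rewrite lee_fin powR_ge0.
- exact: carleson_mass_ge0.
- rewrite lee_fin -[leRHS](powRr0 (1 - normc l ^+ 2)); apply: ger_powR; first by rewrite s0.
  exact: ltW.
apply: (le_trans (carleson_mass_le p al1 q0 Hphi phiD r1 lr)).
by rewrite EFinM; apply: lee_wpmul2l; first by rewrite lee_fin powR_ge0.
Qed.

(** Near the circle the test functions control [carleson_fun], and inside it is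
    bounded by the energy of [phi]. *)
Lemma carleson_fun_bounded p al be c phi (M r : R) : 1 <= p -> -1 < al -> 0 <= be -> 0 < c ->
  2 + al + c = (2 + be) * p ->
  dirichlet_space p al phi -> phi @` disc R `<=` disc R -> r < 1 -> 0 <= M ->
  (forall l, r < normc l -> normc l < 1 ->
    (((1 - normc l ^+ 2) `^ (c / p))%:E * dnorm p al (testF l be \o phi) <= M%:E)%E) ->
  exists2 S : R, 0 <= S & forall w, disc R w -> (carleson_fun p al c phi w <= S%:E)%E.
Proof.
move=> p1 al1 be0 c0 qE Dphi phiD r1 M0 HM; have p0 : 0 < p by lra.
have r'1 : Num.max r 2^-1 < 1 by rewrite gt_max r1 /=; lra.
have [S S0 HS] := carleson_fun_inner p1 al1 c0 Dphi phiD r'1.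
exists (Num.max S ((2 * M) `^ p)); first by rewrite le_max S0.
move=> w wD; have w1 : normc w < 1 := wD.
have [wr|] := leP (normc w) (Num.max r 2^-1).
  by apply: (le_trans (HS w wr)); rewrite lee_fin le_max lexx.
rewrite gt_max => /andP[rw w2].
have [Hphi _] := Dphi.
apply: (@le_trans _ _ ((2 * M) `^ p)%:E); last by rewrite lee_fin le_max lexx orbT.
apply: (carleson_fun_test p0 al1 be0 qE Hphi phiD (ltW w2) w1 M0).
exact: HM.
Qed.

Lemma cvg_to_circle0 (N : R[i] -> \bar R) : (forall l, (0 <= N l)%E) ->
  (N l @[l --> to_circle R] --> 0%E) <->
  (forall e : R, 0 < e -> exists2 r : R, r < 1 &
     forall l, r < normc l -> normc l < 1 -> (N l <= e%:E)%E).
Proof.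
move=> N0; split=> [cv e e0|H A A0].
- have /cv : nbhs (0%E : \bar R) [set x | (x <= e%:E)%E].
    suff : nbhs (0 : R) [set x | (x%:E <= e%:E)%E] by [].
    apply/nbhs_ballP; exists e => // x; rewrite /ball /= sub0r normrN lee_fin => xe.
    by rewrite (le_trans (ler_norm _))// ltW.
  by move=> [r /= r1 Hr]; exists r => // l rl l1; apply: Hr; rewrite /= rl.
- have A0' : nbhs (0 : R) [set x | A x%:E] by [].
  have /nbhs_ballP[e /= e0 He] := A0'; have e2 : 0 < e / 2 by lra.
  have [r r1 Hr] := H _ e2; exists r => // l /= /andP[rl l1].
  have := Hr l rl l1; have := N0 l; case: (N l) => [x| |]//; rewrite !lee_fin => x0 xe.
  by apply: He; rewrite /ball /= sub0r normrN ger0_norm//; lra.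
Qed.

End Criteria.

Theorem theorem2p2 (R : realType) (p alpha beta : R) (phi : R[i] -> R[i]) :
  1 < p -> -1 < alpha ->
  dirichlet_space p alpha phi -> phi @` disc R `<=` disc R ->
  0 <= beta ->
  let delta := 2 + beta - (2 + alpha) / p in
  0 < delta ->
  let N := fun lambda : R[i] =>
    (((1 - normc lambda ^+ 2) `^ delta)%:E *
     dirichlet_norm p alpha (testF lambda beta \o phi))%E in
  (bounded_on_dirichlet p alpha (composition phi) <->
     (ereal_sup [set N lambda | lambda in disc R] < +oo)%E) /\
  (compact_on_dirichlet p alpha (composition phi) <->
     N lambda @[lambda --> to_circle R] --> 0%E).
Proof.
move=> p1' al1 Dphi phiD be0 delta d0 N; have p1 := ltW p1'; have p0 : 0 < p by lra.
have [Hphi _] := Dphi.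
pose c := delta * p; have c0 : 0 < c by exact: mulr_gt0.
have cp : c / p = delta by rewrite /c mulfK// gt_eqF.
have qE : 2 + alpha + c = (2 + beta) * p.
  by rewrite /c /delta; field; rewrite gt_eqF.
have alc : 0 <= alpha + c by clear -qE be0 p1; nra.
have NE l : N l = (((1 - normc l ^+ 2) `^ (c / p))%:E * dnorm p alpha (testF l beta \o phi))%E.
  by rewrite cp dnormE.
have N0 l : (0 <= N l)%E.
  by rewrite NE; apply: mule_ge0; [rewrite lee_fin powR_ge0|exact: dnorm_nneg].
split; split.
- move=> [_ [M HM]]; have [C C0 HC] := dnorm_testF_le p1 al1 be0 c0 qE.
  apply: (@le_lt_trans _ _ (`|M| * C)%:E); last exact: ltry.
  apply: ge_ereal_sup => _ [l lD <-]; have l1 : normc l < 1 := lD.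
  have HlC := HC l l1; have /andP[s0 _] := one_sub_sqr l1.
  have Dl : dirichlet_space p alpha (testF l beta).
    split; first exact: holomorphic_testF.
    rewrite -dnormE; apply: (@le_lt_trans _ _ (((1 - normc l ^+ 2) `^ (c / p))^-1%:E * C%:E)%E).
      by rewrite lee_pdivlMl// powR_gt0.
    by rewrite -EFinM ltry.
  have := HM _ Dl; rewrite -!dnormE => HMl.
  have s1 : (0 <= ((1 - normc l ^+ 2) `^ (c / p))%:E)%E by rewrite lee_fin powR_ge0.
  rewrite NE; apply: (@le_trans _ _ (((1 - normc l ^+ 2) `^ (c / p))%:E *
      (`|M|%:E * dnorm p alpha (testF l beta)))%E).
    apply: lee_wpmul2l => //; apply: (le_trans HMl).
    by apply: lee_wpmul2r; [exact: dnorm_nneg|rewrite lee_fin ler_norm].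
  by rewrite muleCA EFinM; apply: lee_wpmul2l; first by rewrite lee_fin.
- move=> sup_fin.
  have Nsup l : normc l < 1 -> (N l <= ereal_sup [set N lambda | lambda in disc R])%E.
    by move=> l1; apply: ereal_sup_ubound; exists l.
  have z1 : normc (0 : R[i]) < 1 by rewrite normc0.
  have [M M0 HM] : exists2 M : R, 0 <= M & forall l, normc l < 1 -> (N l <= M%:E)%E.
    move: Nsup sup_fin; case: (ereal_sup _) => [M| |] Nsup // _.
    - exists M => //; rewrite -lee_fin; exact: le_trans (N0 0) (Nsup 0 z1).
    - by have := le_trans (N0 0) (Nsup 0 z1).
  have r1 : 0 < 1 :> R by [].
  have [S S0 HS] := carleson_fun_bounded p1 al1 be0 c0 qE Dphi phiD r1 M0
    (fun l _ l1 => eq_ind _ (fun x => (x <= M%:E)%E) (HM l l1) _ (NE l)).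
  exact: (composition_bounded p1 al1 c0 alc Hphi phiD S0 HS).
- move=> cT; apply/(cvg_to_circle0 N0) => e e0.
  have [r r1 Hr] := compact_testF p1 al1 be0 c0 qE Hphi phiD cT e0.
  by exists r => // l rl l1; rewrite NE; exact: Hr.
- move=> /(cvg_to_circle0 N0) cvN.
  have [r r1 Hr] := cvN 1 ltr01.
  have [S S0 HS] := carleson_fun_bounded p1 al1 be0 c0 qE Dphi phiD r1 ler01
    (fun l rl l1 => eq_ind _ (fun x => (x <= 1%:E)%E) (Hr l rl l1) _ (NE l)).
  have small e : 0 < e -> exists2 r : R, r < 1 & forall w, r < normc w -> normc w < 1 ->
      (carleson_fun p alpha c phi w <= e%:E)%E.
    move=> e0; have M0 : 0 < e `^ p^-1 / 2 by rewrite divr_gt0// powR_gt0.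
    have [s s1 Hs] := cvN _ M0.
    exists (Num.max s 2^-1); first by rewrite gt_max s1 /=; lra.
    move=> w; rewrite gt_max => /andP[sw w2] w1.
    have := carleson_fun_test p0 al1 be0 qE Hphi phiD (ltW w2) w1 (ltW M0).
    rewrite -NE => /(_ (Hs w sw w1)).
    by rewrite mulrCA divff ?mulr1// -powRrM mulVf ?gt_eqF// powRr1// ltW.
  have [Tmap _] := composition_bounded p1 al1 c0 alc Hphi phiD S0 HS.
  split=> //.
  have cB := image_ball_compact p1 al1 c0 alc Hphi phiD S0 HS small.
  exact: (image_ball_precompact cB (image_ball_closed p1 al1 cB) p0).
Qed.
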